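(* Let $(\mathcal G,\lambda)$ be a locally compact groupoid, where $\lambda$ is a left Haar system. Then $(\mathcal G,\lambda)$ is Liouville if and only if it is Reiter.
   Context: A groupoid is a small category in which every morphism is invertible: a set $\mathcal G$ of morphisms, a set $\mathcal G^{(0)}$ of objects (units), surjective source and target maps $\mathbf s,\mathbf t:\mathcal G\to\mathcal G^{(0)}$, and a composition $(\zeta,\eta)\mapsto\zeta\eta$ on $\{(\zeta,\eta)\in\mathcal G^2:\mathbf s(\zeta)=\mathbf t(\eta)\}$. Units are identified with identity morphisms, so $\mathcal G^{(0)}\subseteq\mathcal G$. For $x\in\mathcal G^{(0)}$ put $\mathcal G^x=\mathbf t^{-1}(x)$. A locally compact groupoid is a groupoid with a locally compact, Hausdorff, second countable topology on $\mathcal G$ such that composition, inversion, $\mathbf s$ and $\mathbf t$ are continuous. A continuous system of measures on $\mathcal G$ is a family $\lambda=(\lambda^x)_{x\in\mathcal G^{(0)}}$ of nonzero $\sigma$-finite positive Radon measures $\lambda^x$ on $\mathcal G^x$ (regarded also as measures on $\mathcal G$ vanishing outside $\mathcal G^x$) such that $x\mapsto\int f\,d\lambda^x$ is continuous for every $f\in C_c(\mathcal G)$. For $\gamma\in\mathcal G$ and a measure $\rho$ on $\mathcal G^{\mathbf s(\gamma)}$, $\gamma\rho$ is the pushforward of $\rho$ under $\mathcal G^{\mathbf s(\gamma)}\to\mathcal G^{\mathbf t(\gamma)}$, $\eta\mapsto\gamma\eta$; $\prec$ denotes absolute continuity. A left Haar system is a continuous system of measures $\lambda$ with $\gamma\lambda^{\mathbf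 s(\gamma)}=\lambda^{\mathbf t(\gamma)}$ for all $\gamma\in\mathcal G$. A continuous system $\theta=(\theta^x)_x$ of probability measures $\theta^x$ on $\mathcal G^x$ is $\lambda$-adapted if $\theta^x\prec\lambda^x$ for every $x$ and $(\gamma,\eta)\in\mathcal G^2\mapsto\frac{d(\gamma\theta^{\mathbf s(\gamma)})}{d\lambda^{\mathbf t(\gamma)}}(\eta)\in[0,\infty]$ is Borel. $\|\cdot\|$ is the total variation norm. $(\mathcal G,\lambda)$ is Reiter if there is a sequence $(\theta_n)_n$ of $\lambda$-adapted continuous systems of probability measures such that $\lim_{n\to\infty}\|\theta_n^{\mathbf t(\gamma)}-\gamma\theta_n^{\mathbf s(\gamma)}\|=0$ for all $\gamma\in\mathcal G$. For a $\lambda$-adapted continuous system of probability measures $\pi=(\pi_x)_x$, define $P_x$ on $L^\infty(\mathcal G^x,\lambda^x)$ by $P_x(f)(\zeta)=\int_{\mathcal G^{\mathbf s(\zeta)}}f(\zeta\eta)\,d\pi_{\mathbf s(\zeta)}(\eta)$, and $H_{\pi,x}(\mathcal G)=\{f\in L^\infty(\mathcal G^x,\lambda^x):P_x(f)=f\}$. $(\mathcal G,\lambda)$ is Liouville if there is a $\lambda$-adapted continuous system of probability measures $\pi$ with $H_{\pi,x}(\mathcal G)=\mathbb C\mathbf 1$ (the constants) for all $x\in\mathcal G^{(0)}$. *)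

(* Defs.v *)
From HB Require Import structures.
From mathcomp Require Import all_boot all_order all_algebra.
From mathcomp Require Import complex.
From mathcomp Require Import all_classical all_reals all_analysis.
From mathcomp Require Import measurable_realfun.
Import Order.TTheory GRing.Theory Num.Theory.
Import numFieldNormedType.Exports.

Set Implicit Arguments.
Unset Strict Implicit.
Unset Printing Implicit Defensive.

Local Open Scope classical_set_scope.
Local Open Scope ring_scope.

(* T equipped with its Borel sigma-algebra; convertible to T. *)
Notation borel T := (g_sigma_algebraType (@open T)).

Notation borel_measure R T := {measure set (borel T) -> \bar R}.

(* Units are identified with identity morphisms.  [gmul] and all maps on
   measures below are total; [gmul g h] is meaningful only when
   [src g = tgt h]. *)
Record groupoid (G : Type) := Groupoid {
  units : set G;
  src : G -> G;
  tgt : G -> G;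
  gmul : G -> G -> G;
  ginv : G -> G;
  src_units : forall g, units (src g);
  tgt_units : forall g, units (tgt g);
  src_unit : forall x, units x -> src x = x;
  tgt_unit : forall x, units x -> tgt x = x;
  src_gmul : forall g h, src g = tgt h -> src (gmul g h) = src h;
  tgt_gmul : forall g h, src g = tgt h -> tgt (gmul g h) = tgt g;
  gmulA : forall g h k, src g = tgt h -> src h = tgt k ->
    gmul g (gmul h k) = gmul (gmul g h) k;
  gmul_src : forall g, gmul g (src g) = g;
  gmul_tgt : forall g, gmul (tgt g) g = g;
  src_ginv : forall g, src (ginv g) = tgt g;
  tgt_ginv : forall g, tgt (ginv g) = src g;
  gmulV : forall g, gmul g (ginv g) = tgt g;
  gmulVg : forall g, gmul (ginv g) g = src g
}.

Definition composable (G : Type) (gr : groupoid G) : set (G * G) :=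
  [set p | src gr p.1 = tgt gr p.2].

Record locally_compact_groupoid (G : topologicalType) (gr : groupoid G) : Prop
  := LocallyCompactGroupoid {
  lcg_locally_compact : locally_compact [set: G];
  lcg_hausdorff : hausdorff_space G;
  lcg_second_countable : @second_countable G;
  lcg_gmul : {within composable gr,
               continuous (fun p : G * G => gmul gr p.1 p.2)};
  lcg_ginv : continuous (ginv gr);
  lcg_src : continuous (src gr);
  lcg_tgt : continuous (tgt gr)
}.

(* The set of arrows with target x. *)
Definition fiber (G : Type) (gr : groupoid G) (x : G) : set G :=
  [set g | tgt gr g = x].

Definition radon_measure (R : realType) (T : ptopologicalType)
    (mu : borel_measure R T) : Prop :=
  (forall K : set T, compact K -> (mu K < +oo)%E) /\
  (forall A : set (borel T), measurable A ->
     mu A = ereal_sup [set mu K | K in [set K : set T | compact K /\ K `<=` A]]).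

Definition compactly_supported_continuous (R : realType) (T : topologicalType)
    (f : T -> R) : Prop :=
  continuous f /\ compact (closure [set z | f z != 0]).

(* The measure at x, living on [fiber gr x], is given by its extension by zero
   to G.  The values of a system at points that are not units are irrelevant. *)
Definition continuous_system (R : realType) (G : ptopologicalType)
    (gr : groupoid G) (lambda : G -> borel_measure R G) : Prop :=
  (forall x, units gr x ->
    [/\ radon_measure (lambda x), sigma_finite setT (lambda x),
        lambda x setT <> 0%E & lambda x (~` fiber gr x) = 0%E]) /\
  (forall f : G -> R, compactly_supported_continuous f ->
    {within units gr, continuous (fun x => \int[lambda x]_z f z)}).

Definition continuous_probability_system (R : realType) (G : ptopologicalType)
    (gr : groupoid G) (theta : G -> borel_measure R G) : Prop :=
  continuous_system gr theta /\
  (forall x, units gr x -> theta x setT = 1%E).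

(* The pushforward of rho, a measure on [fiber gr (src gr g)], under left
   multiplication by g. *)
Definition translate (R : realType) (G : ptopologicalType) (gr : groupoid G)
    (g : G) (rho : borel_measure R G) : set G -> \bar R :=
  fun A => rho (fiber gr (src gr g) `&` gmul gr g @^-1` A).

Definition left_haar_system (R : realType) (G : ptopologicalType)
    (gr : groupoid G) (lambda : G -> borel_measure R G) : Prop :=
  continuous_system gr lambda /\
  (forall (g : G) (A : set (borel G)), measurable A ->
     translate gr g (lambda (src gr g)) A = lambda (tgt gr g) A).

(* A Radon-Nikodym derivative is only defined up to null sets: Borelness of
   (g, h) |-> d(g theta^(s g))/d lambda^(t g) (h) is the existence of a Borel
   function on G * G that is a version of the derivative for every g. *)
Definition adapted (R : realType) (G : ptopologicalType) (gr : groupoid G)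
    (lambda theta : G -> borel_measure R G) : Prop :=
  (forall x, units gr x -> theta x `<< lambda x) /\
  (exists D : borel (G * G)%type -> \bar R,
     [/\ measurable_fun setT D,
         forall p, (0 <= D p)%E &
         forall (g : G) (A : set (borel G)), measurable A ->
           translate gr g (theta (src gr g)) A =
           (\int[lambda (tgt gr g)]_(h in A) D (g, h))%E]).

Definition total_variation_norm (R : realType) (T : ptopologicalType)
    (nu : set T -> \bar R) : \bar R :=
  ereal_sup [set r | exists (n : nat) (A : 'I_n -> set (borel T)),
    [/\ forall i, measurable (A i), trivIset setT A,
        \bigcup_i A i = setT & r = (\sum_(i < n) `|nu (A i)|)%E]].

Definition reiter (R : realType) (G : ptopologicalType) (gr : groupoid G)
    (lambda : G -> borel_measure R G) : Prop :=
  exists theta : nat -> G -> borel_measure R G,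
    (forall n, continuous_probability_system gr (theta n) /\
               adapted gr lambda (theta n)) /\
    (forall g : G,
      (fun n => total_variation_norm
         (fun A => theta n (tgt gr g) A -
                   translate gr g (theta n (src gr g)) A)%E) @ \oo --> 0%E).

(* Representatives of the classes in the complex space
   L^infty(fiber gr x, lambda x). *)
Definition Linfty (R : realType) (G : ptopologicalType) (gr : groupoid G)
    (lambda : G -> borel_measure R G) (x : G) : set (G -> R[i]) :=
  [set f : G -> R[i] | [/\ measurable_fun (fiber gr x : set (borel G))
                 (fun z => complex.Re (f z)),
               measurable_fun (fiber gr x : set (borel G))
                 (fun z => complex.Im (f z)) &
               exists M : R, {ae lambda x, forall z,
                 fiber gr x z -> `|f z| <= M%:C%C}]].

Definition complex_integral (R : realType) (T : ptopologicalType)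
    (mu : borel_measure R T) (D : set T) (f : T -> R[i]) : R[i] :=
  ((\int[mu]_(z in D) complex.Re (f z)) +i*
   (\int[mu]_(z in D) complex.Im (f z)))%C.

Definition markov_operator (R : realType) (G : ptopologicalType)
    (gr : groupoid G) (pi : G -> borel_measure R G) (f : G -> R[i]) :
    G -> R[i] :=
  fun z => complex_integral (pi (src gr z)) (fiber gr (src gr z))
             (fun h => f (gmul gr z h)).

Definition bounded_harmonic (R : realType) (G : ptopologicalType)
    (gr : groupoid G) (lambda pi : G -> borel_measure R G) (x : G) :
    set (G -> R[i]) :=
  [set f : G -> R[i] | Linfty gr lambda x f /\
           markov_operator gr pi f = f %[ae lambda x in fiber gr x]].

(* Representatives of the classes in C1. *)
Definition constant_functions (R : realType) (G : ptopologicalType)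
    (gr : groupoid G) (lambda : G -> borel_measure R G) (x : G) :
    set (G -> R[i]) :=
  [set f : G -> R[i] | Linfty gr lambda x f /\
           exists c : R[i], f = cst c %[ae lambda x in fiber gr x]].

Definition liouville (R : realType) (G : ptopologicalType) (gr : groupoid G)
    (lambda : G -> borel_measure R G) : Prop :=
  exists pi : G -> borel_measure R G,
    [/\ continuous_probability_system gr pi, adapted gr lambda pi &
        forall x, units gr x ->
          bounded_harmonic gr lambda pi x = constant_functions gr lambda x].

(* Main.v *)
(* Write P for the averaging operator f |-> (z |-> int f(z h) dpi_(s z)(h)).

   Liouville => Reiter. Let theta_n be the Cesaro means of the convolution powers
   of pi. If theta_n were not asymptotically invariant at g, there would be a
   fixed e > 0 and, for infinitely many n, a Borel set A_n such that
   h_n(z) = (z theta_n^(s z))(A_n) satisfies |P h_n - h_n| <= 1/(n+1) and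
   h_n(t g) - h_n(g) > e. Suitable convex combinations of the h_n converge almost
   everywhere, to a harmonic function h with P h (t g) <> P h (g); but h is almost
   everywhere constant on the fiber.

   Reiter => Liouville. Convolving theta_n on the right with a fixed system having
   a lower semicontinuous density with respect to lambda makes the defect of
   invariance N_n(g) upper semicontinuous in g. It tends to 0 only pointwise, but
   by an argument of Simons some infinite convex combination of the systems
   theta_n, n >= m, has a defect that is small uniformly on a prescribed compact
   set, even after applying finitely many averaging operators. Following
   Kaimanovich and Vershik, one chooses such systems al_k inductively along a
   compact exhaustion of G and takes pi = sum_k 2^-(k+1) al_k: a bounded function f
   with P f = f then satisfies f(g) = f(t g). *)
From HB Require Import structures.
Require Import Defs.
From mathcomp Require Import all_boot all_order all_algebra.
From mathcomp Require Import complex.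
From mathcomp Require Import all_classical all_reals all_analysis.
From mathcomp Require Import measurable_realfun.
From mathcomp Require Import ring lra.
Import Order.TTheory GRing.Theory Num.Theory.
Import numFieldNormedType.Exports.

Set Implicit Arguments.
Unset Strict Implicit.
Unset Printing Implicit Defensive.

Local Open Scope classical_set_scope.
Local Open Scope ring_scope.

(** A continuous system is tested on compactly supported functions, a class that averaging need not
    preserve. Nonnegative lower semicontinuous functions take their place: they are stable under
    sums, series, products, minima and integration over moving fibers. Total mass 1 gives continuity
    back, by applying semicontinuity to [f + M] and to [M - f], and a Dynkin argument turns it into
    Borel measurability. A second obstacle is that bounded harmonic functions are only classes
    modulo [lambda]. Adaptedness makes every translate of [pi] absolutely continuous, so [P f] has a
    definite value at every arrow that depends only on the class of [f]. This is why the
    contradiction in Liouville => Reiter is sought in the values of [P h] rather than of [h], and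
    why in the converse an almost everywhere harmonic function can be replaced by one that is
    harmonic everywhere. Simons' argument is called for because the defects do not decrease with n,
    so that Dini's theorem does not apply; it lives on upper semicontinuity, pointwise convergence
    and closure under infinite convex combinations. *)

Lemma countable_enum (T : pointedType) (A : set T) : countable A ->
  exists e : nat -> T, A `<=` range e.
Proof.
move=> /countable_injP[f finj].
exists (fun n => xget point [set x | A x /\ f x = n]) => x Ax.
exists (f x) => //; case: xgetP => [y _ [Ay fxy]|/(_ x)/not_andP[]//].
by apply: finj => //; rewrite inE.
Qed.

(** * Countable families of bump functions and compact exhaustions *)

Section bump_functions.
Context (R : realType) (G : ptopologicalType).
Hypothesis lcG : locally_compact [set: G].
Hypothesis hsG : hausdorff_space G.

Lemma precompact_nbhs (a : G) :
  exists C : set G, [/\ nbhs a C, compact C & closed C].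
Proof.
have := lcG (I : [set: G] a); rewrite withinET => -[C nC [cC clC]].
by exists C.
Qed.

(** Complete regularity alone gives the value 1 only at [a]; a whole neighbourhood is needed so that
    basic open sets can index the bumps in [bump_family]. *)
Lemma bump_function (a : G) (V : set G) : nbhs a V ->
  exists f : G -> R, [/\ compactly_supported_continuous f,
    forall z, 0 <= f z <= 1, (\forall z \near a, f z = 1) &
    forall z, ~ V z -> f z = 0].
Proof.
move=> aV; have [C [aC cC clC]] := precompact_nbhs a.
have aVC : nbhs a (V `&` C) by exact: filterI.
move: (aVC); rewrite nbhsE => -[W [oW Wa] WVC].
have /(@uniform_separatorP _ R)[f [cf f01 fa fW]] :=
  locally_compact_completely_regular (R := R) lcG hsG (open_closedC oW)
    (fun h : (~` W) a => h Wa).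
have f01z z : 0 <= f z <= 1.
  by have := f01 (f z) (ex_intro2 _ _ z I erefl); rewrite /= in_itv.
have fa0 : f a = 0 by apply: fa; exists a.
have fW1 z : ~ W z -> f z = 1 by move=> Wz; apply: fW; exists z.
have g0W z : Num.min 1 (2 * (1 - f z)) != 0 -> W z.
  by apply: contra_neqP => /fW1 ->; rewrite subrr mulr0 min_r.
(* [1 - f] is 1 at [a]; doubling and truncating makes the function 1 wherever [f <= 1 / 2]. *)
exists (fun z => Num.min 1 (2 * (1 - f z))); split.
- split; last first.
    apply: (subclosed_compact _ cC); first exact: closed_closure.
    rewrite [X in _ `<=` X](closure_id C).1//; apply: closure_subset => z /= /g0W /WVC[]//.
  move=> z; apply: (@continuous_min _ _ (cst 1) (fun z => 2 * (1 - f z))).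
    exact: cst_continuous.
  apply: cvgM; first exact: cst_continuous.
  by apply: cvgB; [exact: cst_continuous|exact: cf].
- move=> z; have /andP[f0 f1] := f01z z.
  rewrite ge_min lexx/= andbT le_min ler01/= mulr_ge0// subr_ge0//.
- have : \forall z \near a, f z < 1 / 2.
    by apply: (cvgr_lt _ (cf a)); rewrite fa0 divr_gt0.
  by apply: filterS => z fz; rewrite min_l//; lra.
- by move=> z Vz; rewrite fW1 ?subrr ?mulr0 ?min_r// => /WVC[].
Qed.

(** One function is chosen for each pair of basic open sets [(U, W)] that admits a bump equal to 1
    on [U] and to 0 off [W]. *)
Lemma bump_family : @second_countable G ->
  exists f : nat -> G -> R, [/\ forall n, compactly_supported_continuous (f n),
    forall n z, 0 <= f n z <= 1 &
    forall a V, nbhs a V -> exists n, f n a = 1 /\ forall z, ~ V z -> f n z = 0].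
Proof.
move=> [B cB [oB bB]].
have [e eB] : exists e : nat -> set G * set G, B `*` B `<=` range e.
  by apply: countable_enum; exact: countableX.
pose P (p : set G * set G) (f : G -> R) := [/\ compactly_supported_continuous f,
  forall z, 0 <= f z <= 1, (forall z, p.1 z -> f z = 1) &
    forall z, ~ p.2 z -> f z = 0].
(* Pairs that admit no bump receive the zero function, which still satisfies the first two
   properties. *)
pose F p := xget (fun=> 0) (P p).
exists (F \o e); split.
- move=> n; rewrite /F /=; case: xgetP => [f _ []//|_].
  split; first exact: cst_continuous.
  rewrite [X in closure X](_ : _ = set0) ?closure0; first exact: compact0.
  by apply/seteqP; split=> z //=; rewrite eqxx.
- move=> n z; rewrite /F /=; case: xgetP => [f _ []//|_].
  by rewrite lexx ler01.
- move=> a V aV; have [W [BW Wa] WV] := bB _ _ aV.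
  have [f [cf f01 f1 f0]] := bump_function (open_nbhs_nbhs (conj (oB _ BW) Wa)).
  have [U [BU Ua] Uf] := bB _ _ f1.
  have [n _ en] := eB (U, W) (conj BU BW).
  exists n; rewrite /F /= en; case: xgetP => [h _ [_ _ h1 h0]|/(_ f)]; last first.
    by case; split.
  by split=> [|z Vz]; [exact: h1|apply: h0 => /WV].
Qed.

Lemma compact_exhaustion : @second_countable G ->
  exists K : nat -> set G, [/\ forall n, compact (K n),
    {homo K : m n / (m <= n)%N >-> m `<=` n} & \bigcup_n K n = setT].
Proof.
move=> /bump_family[f [cf f01 fV]].
pose C n := closure [set z | f n z != 0].
exists (fun n => \bigcup_(i < n) C i); split.
- move=> n; rewrite bigcup_mkord; elim/big_ind: _ => //; first exact: compact0.
    by move=> *; exact: compactU.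
  by move=> i _; have [] := cf i.
- by move=> m n mn; apply: bigcup_sub => i /= im z Cz; exists i => //=; exact: leq_trans mn.
- apply/seteqP; split=> // z _; have [n [fz _]] := fV z setT filterT.
  exists n.+1 => //; exists n => //=; apply: subset_closure => /=.
  by rewrite fz oner_neq0.
Qed.

End bump_functions.

(** * Lower semicontinuous functions with values in the extended reals *)

Section lower_semicontinuity.
Context (R : realType).
Local Open Scope ereal_scope.

Lemma open_borel_measurable (T : ptopologicalType) (A : set T) :
  open A -> measurable (A : set (borel T)).
Proof. by move=> oA; apply: sub_sigma_algebra. Qed.

Lemma closed_borel_measurable (T : ptopologicalType) (A : set T) :
  closed A -> measurable (A : set (borel T)).
Proof.
move=> cA; rewrite -(setCK A); apply: measurableC.
by apply: open_borel_measurable; rewrite openC.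
Qed.

Lemma lsc_measurable (T : ptopologicalType) (D : set (borel T)) (f : T -> \bar R) :
  lower_semicontinuous f -> measurable_fun D (f : borel T -> \bar R).
Proof.
move=> /lower_semicontinuousP lf; apply: measurable_funTS.
apply: (measurability _ (ErealGenOInfty.measurableE R)).
move=> _ [_ [a ->] <-]; rewrite setTI preimage_itvoy.
exact: open_borel_measurable (lf a).
Qed.

Section closure_properties.
Context (X : topologicalType).
Implicit Types f g : X -> \bar R.

Lemma lsc_ge0_nbhs f a (x : X) : (forall x, 0 <= f x) -> (a < 0)%R ->
  exists2 V, nbhs x V & forall y, V y -> a%:E < f y.
Proof.
move=> f0 a0; exists setT; first exact: filterT.
by move=> y _; rewrite (lt_le_trans _ (f0 y))// lte_fin.
Qed.

Lemma lsc_cst (c : \bar R) : lower_semicontinuous (fun _ : X => c).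
Proof. by move=> x a ac; exists setT => //; exact: filterT. Qed.

Lemma lsc_EFin (f : X -> R) : continuous f ->
  lower_semicontinuous (fun x => (f x)%:E).
Proof.
move=> cf x a; rewrite lte_fin => afx.
exists [set y | (a < f y)%R]; first exact: (cvgr_gt _ (cf x)).
by move=> y; rewrite lte_fin.
Qed.

Lemma lsc_sup (I : Type) (F : I -> X -> \bar R) f :
  (forall i, lower_semicontinuous (F i)) -> (forall i x, F i x <= f x) ->
  (forall x a, a%:E < f x -> exists i, a%:E < F i x) ->
  lower_semicontinuous f.
Proof.
move=> lF Ff fF x a /fF[i aFi]; have [V xV aV] := lF i _ _ aFi.
by exists V => // y /aV /lt_le_trans; apply.
Qed.

Lemma lscD f g : (forall x, 0 <= f x) -> (forall x, 0 <= g x) ->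
  lower_semicontinuous f -> lower_semicontinuous g ->
  lower_semicontinuous (fun x => f x + g x).
Proof.
move=> f0 g0 lf lg x a afg.
have [b [c [bf cg abc]]] :
    exists b c, [/\ b%:E < f x, c%:E < g x & (a <= b + c)%R].
  (* At an infinite value of one term the bound -1, strictly below the other nonnegative term, is
     enough. If both are finite, the gap between the sum and [a] is shared equally. *)
  have [fx|fx] := eqVneq (f x) +oo.
    exists (a + 1)%R, (- 1)%R; rewrite fx ltry addrK; split=> //.
    by rewrite (lt_le_trans _ (g0 x))// lte_fin.
  have [gx|gx] := eqVneq (g x) +oo.
    exists (- 1)%R, (a + 1)%R; rewrite gx ltry addrC addrK; split=> //.
    by rewrite (lt_le_trans _ (f0 x))// lte_fin.
  have : f x \is a fin_num by rewrite ge0_fin_numE// ltey.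
  have : g x \is a fin_num by rewrite ge0_fin_numE// ltey.
  move: afg => /[swap] /fineK <- /[swap] /fineK <-.
  rewrite -EFinD lte_fin => afg.
  exists (fine (f x) - (fine (f x) + fine (g x) - a) / 2)%R.
  exists (fine (g x) - (fine (f x) + fine (g x) - a) / 2)%R.
  by rewrite !lte_fin; split; lra.
have [V xV bV] := lf _ _ bf; have [W xW cW] := lg _ _ cg.
exists (V `&` W); first exact: filterI.
move=> y [/bV bfy /cW cgy]; apply: (@le_lt_trans _ _ (b + c)%:E).
  by rewrite lee_fin.
by rewrite EFinD lteD.
Qed.

Lemma lsc_sum (I : Type) (s : seq I) (P : pred I) (F : I -> X -> \bar R) :
  (forall i x, P i -> 0 <= F i x) ->
  (forall i, P i -> lower_semicontinuous (F i)) ->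
  lower_semicontinuous (fun x => \sum_(i <- s | P i) F i x).
Proof.
move=> F0 lF; elim: s => [|i s ih].
  by under eq_fun do rewrite big_nil; exact: lsc_cst.
under eq_fun do rewrite big_cons.
case Pi: (P i) => //.
apply: lscD => //; last exact: lF.
- by move=> x; exact: F0.
- by move=> x; apply: sume_ge0 => j; exact: F0.
Qed.

Lemma lsc_nneseries (F : nat -> X -> \bar R) : (forall i x, 0 <= F i x) ->
  (forall i, lower_semicontinuous (F i)) ->
  lower_semicontinuous (fun x => \sum_(i <oo) F i x).
Proof.
move=> F0 lF.
apply: (@lsc_sup nat (fun n x => \sum_(i < n) F i x)).
- by move=> n; exact: lsc_sum.
- by move=> n x; rewrite -(big_mkord xpredT (F^~ x)); exact: nneseries_lim_ge.
- move=> x a afx; apply: contrapT => /forallNP Fa.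
  suff : \sum_(i <oo) F i x <= a%:E by rewrite leNgt afx.
  apply: lime_le; first exact: is_cvg_nneseries.
  apply: nearW => n; rewrite big_mkord leNgt; apply/negP; exact: Fa.
Qed.

Lemma lsc_mine f g : lower_semicontinuous f -> lower_semicontinuous g ->
  lower_semicontinuous (fun x => Order.min (f x) (g x)).
Proof.
move=> lf lg x a; rewrite lt_min => /andP[/lf[V xV aV] /lg[W xW aW]].
exists (V `&` W); first exact: filterI.
by move=> y [/aV afy /aW agy]; rewrite lt_min afy.
Qed.

Lemma lscM (f g : X -> \bar R) : (forall x, 0 <= f x) -> (forall x, 0 <= g x) ->
  lower_semicontinuous f -> lower_semicontinuous g ->
  lower_semicontinuous (fun x => f x * g x).
Proof.
move=> f0 g0 lf lg x a afg.
have [a0|a0] := ltP a 0%R.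
  by apply: lsc_ge0_nbhs => // y; exact: mule_ge0.
have [b [c [b0 c0 bf cg abc]]] :
    exists b c, [/\ (0 <= b)%R, (0 <= c)%R, b%:E < f x, c%:E < g x & (a <= b * c)%R].
  (* As [a >= 0] lies strictly below the product, both factors are positive and the convention 0 *
     +oo = 0 does not interfere. *)
  have fg0 : 0 < f x * g x by rewrite (le_lt_trans _ afg).
  have fx0 : 0 < f x.
    by rewrite lt_neqAle f0 andbT; apply: contraTneq fg0 => <-; rewrite mul0e ltxx.
  have gx0 : 0 < g x.
    by rewrite lt_neqAle g0 andbT; apply: contraTneq fg0 => <-; rewrite mule0 ltxx.
  have pos (u : \bar R) : 0 < u -> exists2 d : R, (0 < d)%R & d%:E < u.
    case: u => [u u0|_|]; [|by exists 1%R; rewrite ?ltry|by rewrite ltNge leNye].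
    by exists (u / 2)%R; rewrite ?lte_fin; move: u0; rewrite lte_fin => u0; lra.
  have [fx|fx] := eqVneq (f x) +oo.
    have [d d0 dg] := pos _ gx0.
    exists (a / d)%R, d; rewrite fx ltry divfK ?gt_eqF//.
    by split=> //; rewrite ?divr_ge0// ltW.
  have [gx|gx] := eqVneq (g x) +oo.
    have [d d0 df] := pos _ fx0.
    exists d, (a / d)%R; rewrite gx ltry [(d * _)%R]mulrC divfK ?gt_eqF//.
    by split=> //; rewrite ?divr_ge0// ltW.
  have : f x \is a fin_num by rewrite ge0_fin_numE// ltey.
  have : g x \is a fin_num by rewrite ge0_fin_numE// ltey.
  move=> /fineK gxE /fineK fxE; move: afg fx0 gx0; rewrite -gxE -fxE.
  move: (fine (g x)) (fine (f x)) => u v.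
  rewrite -EFinM !lte_fin => auv v0 u0.
  have [e e0 eu] : exists2 e : R, (0 < e < 1)%R & (a <= v * u * (1 - e) ^+ 2)%R.
    have vu0 : (0 < v * u)%R by rewrite mulr_gt0.
    have w1 : (a / (v * u) < 1)%R by rewrite ltr_pdivrMr// mul1r.
    have w0 : (0 <= a / (v * u))%R by rewrite divr_ge0// ltW.
    (* For w = a / (v u) this choice gives (1 - e)^2 = ((1 + w) / 2)^2 >= w. *)
    exists ((1 - a / (v * u)) / 2)%R; first lra.
    rewrite -ler_pdivrMl// mulrC; move: (a / _)%R w0 w1 => w w0 w1; nra.
  exists (v * (1 - e))%R, (u * (1 - e))%R; rewrite !lte_fin.
  by split; nra.
have [V xV bV] := lf _ _ bf; have [W xW cW] := lg _ _ cg.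
exists (V `&` W); first exact: filterI.
move=> y [/bV bfy /cW cgy]; apply: (@le_lt_trans _ _ (b * c)%:E).
  by rewrite lee_fin.
by rewrite EFinM lte_pmul// lee_fin.
Qed.

End closure_properties.

Lemma lsc_comp (X Y : topologicalType) (h : X -> Y) (f : Y -> \bar R) :
  continuous h -> lower_semicontinuous f -> lower_semicontinuous (f \o h).
Proof.
move=> ch lf x a /lf[V hxV aV]; exists (h @^-1` V); first exact: ch.
by move=> y /aV.
Qed.

Lemma lsc_section (X Y : topologicalType) (f : X * Y -> \bar R) (x : X) :
  lower_semicontinuous f -> lower_semicontinuous (fun y => f (x, y)).
Proof.
apply: (@lsc_comp _ _ (fun y => (x, y))) => y.
by apply: cvg_pair => //=; exact: cvg_cst.
Qed.

(* Extending by +oo off a closed set preserves lower semicontinuity; under an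
   integral that does not see the complement, the extension is harmless. *)
Lemma lsc_patch (X Y : topologicalType) (D : set X) (h : X -> Y)
    (f : Y -> \bar R) : closed D -> {within D, continuous h} ->
  lower_semicontinuous f ->
  lower_semicontinuous (patch (cst +oo) D (f \o h)).
Proof.
move=> cD /subspace_continuousP ch lf x a; rewrite /patch.
case: ifPn => [|/negP]; rewrite in_setE => Dx.
  move=> /lf[V hxV aV]; exists [set y | D y -> V (h y)].
    exact: ch Dx _ hxV.
  by move=> y Vy; case: ifPn => [/set_mem/Vy/aV//|_]; rewrite ltry.
move=> _; exists (~` D); first by apply: open_nbhs_nbhs; split=> //; rewrite openC.
by move=> y /= Dy; case: ifPn => [/set_mem//|_]; rewrite ltry.
Qed.

End lower_semicontinuity.

Lemma rat_between (R : realType) (u v : \bar R) : (u < v)%E -> (0 <= u)%E ->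
  exists b : rat, [/\ (u < (ratr b : R)%:E)%E, ((ratr b : R)%:E < v)%E
    & 0 <= (ratr b : R)].
Proof.
case: u => [u| |]; [|by rewrite ltNge leey|by []].
case: v => [v|_ u0|//].
  rewrite lte_fin => uv u0; have [b] := rat_in_itvoo uv.
  rewrite in_itv/= => /andP[ub bv]; exists b; rewrite !lte_fin; split=> //.
  by rewrite (le_trans _ (ltW ub))// -lee_fin.
have [b] := rat_in_itvoo (ltr_pwDr ltr01 (lexx u)).
rewrite in_itv/= => /andP[ub bv]; exists b; rewrite !lte_fin ltry; split=> //.
by rewrite (le_trans _ (ltW ub))// -lee_fin.
Qed.

(** * Semicontinuity of integrals over moving fibers *)

Section integration_over_fibers.
Context (R : realType) (G : ptopologicalType) (gr : groupoid G).
Hypothesis lcgG : locally_compact_groupoid gr.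
Implicit Types kappa : G -> borel_measure R G.

Let lcG := lcg_locally_compact lcgG.
Let hsG := lcg_hausdorff lcgG.
Let scG := lcg_second_countable lcgG.

Lemma closed_eq (T : topologicalType) (f h : T -> G) :
  continuous f -> continuous h -> closed [set z | f z = h z].
Proof.
move=> cf ch z clz; apply: hsG => A B fA hB.
have [y [fy [/= Ay By]]] : [set z | f z = h z] `&` (f @^-1` A `&` h @^-1` B) !=set0.
  by apply: clz; apply: filterI; [exact: cf|exact: ch].
by exists (f y); split=> //; rewrite fy.
Qed.

Lemma closed_fiber (x : G) : closed (fiber gr x).
Proof. exact: closed_eq (lcg_tgt lcgG) (@cst_continuous _ _ x). Qed.

Lemma measurable_fiber (x : G) : measurable (fiber gr x : set (borel G)).
Proof. by apply: closed_borel_measurable; exact: closed_fiber. Qed.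


Lemma csc_measurable (f : G -> R) : continuous f ->
  measurable_fun setT (f : borel G -> R).
Proof.
by move=> cf; apply/measurable_EFinP; apply: lsc_measurable; exact: lsc_EFin.
Qed.

Lemma csc_measurable_EFin (D : set (borel G)) (f : G -> R) :
  compactly_supported_continuous f ->
  measurable_fun D ((fun z => (f z)%:E) : borel G -> \bar R).
Proof.
by move=> [cf _]; apply: lsc_measurable; exact: lsc_EFin.
Qed.

Lemma csc_max (f g : G -> R) : compactly_supported_continuous f ->
  compactly_supported_continuous g ->
  compactly_supported_continuous (fun z => Num.max (f z) (g z)).
Proof.
move=> [cf kf] [cg kg]; split.
  by move=> z; apply: (@continuous_max _ _ f g); [exact: cf|exact: cg].
apply: (subclosed_compact (@closed_closure _ _) (compactU kf kg)).
rewrite -closureU; apply: closure_subset => z /= fgz.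
have [fz|fz] := eqVneq (f z) 0; last by left.
right; apply: contraNneq fgz => gz.
by rewrite fz gz maxxx.
Qed.

Lemma csc0 : compactly_supported_continuous (fun _ : G => 0 : R).
Proof.
split; first exact: cst_continuous.
rewrite [X in closure X](_ : _ = set0) ?closure0; first exact: compact0.
by apply/seteqP; split=> z //=; rewrite eqxx.
Qed.

Lemma csc_scale (c : R) (f : G -> R) : compactly_supported_continuous f ->
  compactly_supported_continuous (fun z => c * f z).
Proof.
move=> [cf kf]; split.
  by move=> z; apply: cvgM; [exact: cst_continuous|exact: cf].
apply: (subclosed_compact (@closed_closure _ _) kf).
by apply: closure_subset => z /=; apply: contra_neq => ->; rewrite mulr0.
Qed.

Lemma csc_bounded (f : G -> R) : compactly_supported_continuous f ->
  exists M, forall z, `|f z| <= M.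
Proof.
move=> [cf kf].
have := compact_bounded (continuous_compact (continuous_subspaceT cf) kf).
move=> [M [_ /(_ (M + 1))]]; rewrite ltrDl ltr01 => /(_ isT) fM.
exists (Num.max 0 (M + 1)) => z; rewrite le_max.
have [->|fz] := eqVneq (f z) 0; first by rewrite normr0 lexx.
by rewrite (fM (f z)) ?orbT//; exists z => //; exact: subset_closure.
Qed.

Local Open Scope ereal_scope.

Lemma csc_integrable kappa x (f : G -> R) : continuous_system gr kappa ->
  units gr x -> compactly_supported_continuous f ->
  (kappa x).-integrable setT (EFin \o f).
Proof.
move=> [sk _] /sk[[kfin _] _ _ _] cf; have [M fM] := csc_bounded cf.
have [cf1 kf] := cf.
pose S : set (borel G) := closure [set z | f z != 0%R].
have mS : measurable S by apply: closed_borel_measurable; exact: closed_closure.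
have mf := csc_measurable cf1.
have iS : (kappa x).-integrable setT (fun z => M%:E * (\1_S z)%:E).
  apply: integrableZl => //; apply/integrableP; split; first exact/measurable_EFinP.
  under eq_integral do rewrite gee0_abs ?lee_fin//.
  by rewrite integral_indic// setIT; exact: kfin.
apply: le_integrable iS => //; first exact/measurable_EFinP.
move=> z _ /=; rewrite lee_fin; have [->|fz] := eqVneq (f z) 0%R.
  by rewrite normr0.
rewrite indicE mem_set ?mulr1 ?(le_trans (fM z)) ?ler_norm//.
exact: subset_closure.
Qed.

Lemma integral_setT_fiber kappa x (f : G -> \bar R) : units gr x ->
  continuous_system gr kappa -> measurable_fun setT (f : borel G -> \bar R) ->
  (forall z, 0 <= f z) ->
  \int[kappa x]_z f z = \int[kappa x]_(z in fiber gr x) f z.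
Proof.
move=> ux [/(_ _ ux)[_ _ _ kx0] _] mf f0.
rewrite (ge0_negligible_integral _ _ _ _ kx0)//.
- by rewrite setTD setCK.
- exact: measurableC (measurable_fiber x).
Qed.

Lemma vague_continuous_comp (Z : topologicalType) (q : Z -> G) kappa (f : G -> R) :
  continuous q -> (forall z, units gr (q z)) -> continuous_system gr kappa ->
  compactly_supported_continuous f ->
  continuous (fun z => (\int[kappa (q z)]_h f h)%R).
Proof.
move=> cq uq [_ ck] /ck /subspace_continuousP kf z.
have /kf kfz := uq z; move=> A /kfz; rewrite nbhs_simpl /= => Aq.
by apply: (@filterS _ (nbhs z)) (cq z _ Aq) => y /(_ (uq y)).
Qed.

Section lsc_integral.
Context (Z : topologicalType) (q : Z -> G) (kappa : G -> borel_measure R G).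
Hypothesis cq : continuous q.
Hypothesis uq : forall z, units gr (q z).
Hypothesis ck : continuous_system gr kappa.

(* Countably many bump functions suffice to approximate [k (z0, _)] from below;
   each of them minorizes [k (z, _)] on the fiber over [q z] for all z near z0. *)
Lemma lsc_integral_fiber (k : Z * G -> \bar R) : (forall p, 0 <= k p) ->
  lower_semicontinuous k ->
  lower_semicontinuous
    (fun z => \int[kappa (q z)]_(h in fiber gr (q z)) k (z, h)).
Proof.
move=> k0 lk z0 a ak.
have [f [cf f01 fV]] := bump_family R lcG hsG scG.
(* The candidates are the nonnegative rational multiples of the bumps, numbered by [pickle]; numbers
   that code nothing give 0. *)
pose g (i : nat) : G -> R := if unpickle i is Some (n, c)
  then (fun h => Num.max 0 (ratr c) * f n h)%R else (fun=> 0%R).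
have g0 i h : (0 <= g i h)%R.
  rewrite /g; case: unpickle => [[n c]|]//.
  by rewrite mulr_ge0 ?le_max ?lexx//; have /andP[] := f01 n h.
have cg i : compactly_supported_continuous (g i).
  rewrite /g; case: unpickle => [[n c]|]; last exact: csc0.
  exact: csc_scale.
(* Candidates that fail to minorize [k] near [z0] are replaced by 0 in [psi]. A finite maximum [M m]
   then minorizes [k] on a neighbourhood of [z0], a finite intersection of neighbourhoods. *)
pose small i := \forall z \near z0,
  forall h, fiber gr (q z) h -> (g i h)%:E <= k (z, h).
pose psi i : G -> R := if `[< small i >] then g i else (fun=> 0%R).
have psi0 i h : (0 <= psi i h)%R by rewrite /psi; case: asboolP.
have cpsi i : compactly_supported_continuous (psi i).
  by rewrite /psi; case: asboolP => _; [exact: cg|exact: csc0].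
have psik i : \forall z \near z0,
    forall h, fiber gr (q z) h -> (psi i h)%:E <= k (z, h).
  rewrite /psi; case: asboolP => // _.
  by apply: filterE => z h _.
pose M := fix M m h : R :=
  if m is m'.+1 then Num.max (M m' h) (psi m' h) else 0%R.
have cM m : compactly_supported_continuous (M m).
  elim: m => [|m ih] /=; first exact: csc0.
  exact: csc_max.
have M0 m h : (0 <= M m h)%R.
  by case: m => //= m; rewrite le_max psi0 orbT.
have Mk m : \forall z \near z0,
    forall h, fiber gr (q z) h -> (M m h)%:E <= k (z, h).
  elim: m => [|m ih]; first by apply: filterE => z h _ /=.
  apply: filterS2 ih (psik m) => z Mz pz h qh /=.
  by rewrite EFin_max ge_max Mz ?pz.
have ndM h : {homo M^~ h : m n / (m <= n)%N >-> (m <= n)%R}.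
  by apply: homo_leq => [x|y x z|m /=]; [exact: lexx|exact: le_trans|rewrite le_max lexx].
have mM m : measurable_fun (fiber gr (q z0) : set (borel G)) ((fun h => (M m h)%:E) : borel G -> \bar R).
  exact: csc_measurable_EFin.
have Mlim h : fiber gr (q z0) h -> k (z0, h) <= limn (fun m => (M m h)%:E).
  move=> qh; rewrite leNgt; apply/negP => limk.
  have [b [limb bk b0]] : exists b : rat,
      [/\ limn (fun m => (M m h)%:E) < (ratr b : R)%:E, (ratr b : R)%:E < k (z0, h)
        & (0 <= ratr b :> R)%R].
    have : 0 <= limn (fun m => (M m h)%:E).
      apply: lime_ge; last by apply: nearW => m; rewrite lee_fin.
      by apply: ereal_nondecreasing_is_cvgn => m n mn; rewrite lee_fin ndM.
    exact: rat_between limk.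
  (* Semicontinuity of [k] at [(z0, h)] provides a box on which [k] exceeds [b]; [b] times a bump
     supported in [V] with value 1 at [h] is then one of the [small] candidates. *)
  have [[/= U V] [z0U hV] UVk] : filter_prod (nbhs z0) (nbhs h)
      [set p | (ratr b : R)%:E < k p].
    have [W Wn bW] := lk _ _ bk; apply: filterS Wn; exact: bW.
  have [n [fnh fn0]] := fV h V hV.
  pose i := pickle (n, b).
  have gE y : g i y = (ratr b * f n y)%R.
    by rewrite /g pickleK max_r.
  have si : small i.
    apply: filterS z0U => z Uz y qy; rewrite gE.
    have [Vy|Vy] := pselect (V y); last by rewrite fn0// mulr0.
    rewrite (le_trans _ (ltW (UVk (z, y) (conj Uz Vy))))// lee_fin.
    by rewrite ler_piMr//; have /andP[] := f01 n y.
  have : (ratr b : R)%:E <= limn (fun m => (M m h)%:E).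
    apply: lime_ge.
      by apply: ereal_nondecreasing_is_cvgn => m m' mm'; rewrite lee_fin ndM.
    exists i.+1 => // m /= im; rewrite lee_fin (le_trans _ (ndM _ _ _ im))//=.
    by rewrite le_max /psi asboolT// gE fnh mulr1 lexx orbT.
  by rewrite leNgt limb.
have Mint m : \int[kappa (q z0)]_(h in fiber gr (q z0)) (M m h)%:E =
    (\int[kappa (q z0)]_h M m h)%R%:E.
  rewrite -integral_setT_fiber//; last 2 first.
    exact: csc_measurable_EFin.
    by move=> z; rewrite lee_fin.
  rewrite /Rintegral fineK//; apply: integrable_fin_num => //.
  exact: csc_integrable.
(* Monotone convergence at [z0] alone selects [m]; the integral of the fixed function [M m] is
   continuous in [z] and carries the bound to nearby points. *)
have [m aM] : exists m, a%:E < \int[kappa (q z0)]_(h in fiber gr (q z0)) (M m h)%:E.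
  apply: contrapT => /forallNP aM.
  move: ak; apply/negP; rewrite -leNgt.
  apply: (@le_trans _ _ (\int[kappa (q z0)]_(h in fiber gr (q z0))
      limn (fun m => (M m h)%:E))).
    apply: ge0_le_integral => //.
    - exact: measurable_fiber.
    - by apply: lsc_measurable; exact: lsc_section.
    - apply: (emeasurable_fun_cvg (fun m (h : borel G) => (M m h)%:E)) => //.
      move=> h _; apply: ereal_nondecreasing_is_cvgn => m m' mm'.
      by rewrite lee_fin ndM.
  rewrite monotone_convergence//; last 3 first.
  - exact: measurable_fiber.
  - by move=> m h _; rewrite lee_fin.
  - by move=> h _ m m' mm'; rewrite lee_fin ndM.
  apply: lime_le.
    apply: ereal_nondecreasing_is_cvgn => m m' mm'; apply: ge0_le_integral => //.
    - exact: measurable_fiber.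
    - by move=> h _; rewrite lee_fin.
    - by move=> h _; rewrite lee_fin ndM.
  apply: nearW => m; rewrite leNgt; apply/negP; exact: aM.
move: aM; rewrite Mint lte_fin => aM.
have cz := @vague_continuous_comp _ _ _ _ cq uq ck (cM m) z0.
exists [set z | (a < \int[kappa (q z)]_h M m h)%R /\
    forall h, fiber gr (q z) h -> (M m h)%:E <= k (z, h)].
  by apply: filterI; [exact: (cvgr_gt _ cz)|exact: Mk].
move=> z [az Mz].
apply: (@lt_le_trans _ _ (\int[kappa (q z)]_(h in fiber gr (q z)) (M m h)%:E)).
  rewrite -integral_setT_fiber//; last 2 first.
    exact: csc_measurable_EFin.
    by move=> h; rewrite lee_fin.
  rewrite -[ltRHS]fineK ?lte_fin//; apply: integrable_fin_num => //.
  exact: csc_integrable.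
apply: ge0_le_integral => //.
- exact: measurable_fiber.
- by move=> h _; rewrite lee_fin.
- exact: csc_measurable_EFin.
- by apply: lsc_measurable; exact: lsc_section.
Qed.

End lsc_integral.

End integration_over_fibers.

(** * Induction over nonnegative measurable functions and comparison of integrals *)

Section nonnegative_integrals.
Context d (T : measurableType d) (R : realType).
Local Open Scope ereal_scope.

Import HBNNSimple.

Lemma ge0_measurable_ind (P : (T -> \bar R) -> Prop) :
  (forall A, measurable A -> P (fun x => (\1_A x)%:E)) ->
  (forall (c : R) f, (0 <= c)%R -> measurable_fun setT f -> (forall x, 0 <= f x) ->
     P f -> P (fun x => c%:E * f x)) ->
  (forall f g, measurable_fun setT f -> measurable_fun setT g ->
     (forall x, 0 <= f x) -> (forall x, 0 <= g x) ->
     P f -> P g -> P (fun x => f x + g x)) ->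
  (forall f_ : nat -> T -> \bar R, (forall n, measurable_fun setT (f_ n)) ->
     (forall n x, 0 <= f_ n x) ->
     (forall x, {homo f_^~ x : m n / (m <= n)%N >-> m <= n}) ->
     (forall n, P (f_ n)) -> P (fun x => limn (f_^~ x))) ->
  forall f, measurable_fun setT f -> (forall x, 0 <= f x) -> P f.
Proof.
move=> Pind Pscale Padd Plim f mf f0.
pose g := nnsfun_approx measurableT mf.
have -> : f = (fun x => limn (fun n => (g n x)%:E)).
  by apply/funext => x; apply/esym/cvg_lim => //; exact: cvg_nnsfun_approx.
apply: (Plim (fun n x => (g n x)%:E)) => [n|n x|x m n mn|n].
- exact/measurable_EFinP.
- by rewrite lee_fin.
- by rewrite lee_fin; exact/lefP/nd_nnsfun_approx.
have mg r : measurable (g n @^-1` [set r]) by [].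
(* Truncating the coefficients by [Num.max r 0] makes the induction over an arbitrary list possible;
   on the values of the approximation it changes nothing. *)
have Psum (s : seq R) : P (fun x => \sum_(r <- s)
    (Num.max r 0)%:E * (\1_(g n @^-1` [set r]) x)%:E).
  have r0 (r : R) : (0 <= Num.max r 0)%R by rewrite le_max lexx orbT.
  elim: s => [|r s ih].
    rewrite (_ : (fun _ => _) = (fun x => (\1_set0 x)%:E)); first exact: Pind.
    by apply/funext => x; rewrite big_nil indic0.
  rewrite (_ : (fun _ => _) = (fun x =>
      (Num.max r 0)%:E * (\1_(g n @^-1` [set r]) x)%:E +
      \sum_(j <- s) (Num.max j 0)%:E * (\1_(g n @^-1` [set j]) x)%:E)); last first.
    by apply/funext => x; rewrite big_cons.
  apply: Padd => //.
  - by apply: measurable_funeM; exact/measurable_EFinP.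
  - by apply: emeasurable_sum => i; apply: measurable_funeM; exact/measurable_EFinP.
  - by move=> x; rewrite mule_ge0// lee_fin.
  - by move=> x; apply: sume_ge0 => i _; rewrite mule_ge0// lee_fin.
  - by apply: Pscale => //; [exact/measurable_EFinP|exact: Pind].
rewrite (_ : (fun _ => _) = (fun x => \sum_(r <- finmap.enum_fset (fset_set (range (g n))))
    (Num.max r 0)%:E * (\1_(g n @^-1` [set r]) x)%:E))//.
apply/funext => x; rewrite fimfunE fsbig_finite//= -sumEFin.
apply: eq_big_seq => r; rewrite in_fset_set// => /set_mem[y _ <-].
by rewrite max_l.
Qed.

Lemma measure_of_set_function (m : set T -> \bar R) : m set0 = 0 ->
  (forall A, 0 <= m A) -> semi_sigma_additive m ->
  exists mu : {measure set T -> \bar R}, forall A, mu A = m A.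
Proof.
move=> m0 mge0 madd; pose mix := isMeasure.Build d T R m m0 mge0 madd.
pose mu : {measure set T -> \bar R} := HB.pack m mix.
by exists mu.
Qed.

Lemma measure_bigcupT (mu : {measure set T -> \bar R}) (F : nat -> set T) :
  (forall n, measurable (F n)) -> trivIset setT F ->
  mu (\bigcup_n F n) = \sum_(n <oo) mu (F n).
Proof.
move=> mF tF; rewrite measure_bigcup//.
by apply: eq_eseriesl => n; rewrite in_setT.
Qed.

Lemma semi_sigma_additive_nneseries (m : set T -> \bar R) :
  (forall A, 0 <= m A) ->
  (forall F : nat -> set T, (forall n, measurable (F n)) -> trivIset setT F ->
    m (\bigcup_n F n) = \sum_(n <oo) m (F n)) -> semi_sigma_additive m.
Proof.
move=> m0 mU F mF tF mUF; rewrite mU//.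
exact: is_cvg_nneseries.
Qed.

Lemma probability_integral01 (mu : {measure set T -> \bar R}) (f : T -> \bar R) :
  mu setT = 1 -> measurable_fun setT f -> (forall x, 0 <= f x <= 1) ->
  0 <= \int[mu]_x f x <= 1.
Proof.
move=> mu1 mf f01; have f0 x : 0 <= f x by case/andP: (f01 x).
rewrite integral_ge0//= -mu1 -[leRHS]mul1e -integral_cst//.
by apply: ge0_le_integral => // x _; case/andP: (f01 x).
Qed.

(* Peel off the leading binary digit of [f] until what remains is negligible. *)
Lemma le_integral_of_le_measure (mu nu : {measure set T -> \bar R}) (e : R) :
  mu setT = 1 -> nu setT = 1 ->
  (forall A, measurable A -> mu A <= nu A + e%:E) ->
  forall f : T -> \bar R, measurable_fun setT f -> (forall x, 0 <= f x <= 1) ->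
  \int[mu]_x f x <= \int[nu]_x f x + e%:E.
Proof.
move=> mu1 nu1 le_e f mf f01.
have e0 : (0 <= e)%R.
  by have := le_e _ measurableT; rewrite mu1 nu1 -EFinD lee_fin lerDl.
have fin01 (u : \bar R) : 0 <= u <= 1 -> u \is a fin_num.
  by case/andP => u0 u1; rewrite ge0_fin_numE// (le_lt_trans u1)// ltry.
suff claim n : forall f : T -> \bar R, measurable_fun setT f ->
    (forall x, 0 <= f x <= 1) ->
    \int[mu]_x f x <= \int[nu]_x f x + (e + 2 ^- n)%:E.
  apply/lee_addgt0Pr => r r0.
  have [n nr] : exists n, (2 ^- n <= r)%R.
    have := archi_boundP (ltW (eqbRL (invr_gt0 r) r0)); set n := Num.bound _ => rn.
    exists n; rewrite invf_ple ?posrE ?exprn_gt0//.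
    by rewrite (le_trans (ltW rn))// -natrX ler_nat ltnW// ltn_expl.
  rewrite (le_trans (claim n _ mf f01))// -[leRHS]addeA leeD//.
  by rewrite -EFinD lee_fin lerD2l.
elim: n {f mf f01} => [|n ih] f mf f01.
  have /andP[i0 i1] := probability_integral01 mu1 mf f01.
  rewrite (le_trans i1)// -[leLHS]add0e leeD//.
    by have /andP[] := probability_integral01 nu1 mf f01.
  by rewrite expr0 invr1 lee_fin lerDr.
pose A := f @^-1` `[(1 / 2)%:E, +oo[.
have mA : measurable A.
  by rewrite /A -[X in measurable X]setTI; apply: mf => //; exact: emeasurable_itv.
pose g x := (2 * fine (f x) - \1_A x)%R.
have fE x : f x = (1 / 2)%:E * (\1_A x)%:E + (1 / 2)%:E * (g x)%:E.
  rewrite -!EFinM -EFinD -[LHS](fineK (fin01 _ (f01 x))); congr EFin.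
  by rewrite /g; lra.
have mg : measurable_fun setT (EFin \o g).
  apply/measurable_EFinP/measurable_funB => //.
  apply: measurable_funM => //; exact: measurableT_comp.
have g01 x : 0 <= (g x)%:E <= 1.
  have := f01 x; rewrite -(fineK (fin01 _ (f01 x))) !lee_fin => /andP[fx0 fx1].
  rewrite /g indicE; case: (boolP (x \in A)) => [/set_mem|/negP]; rewrite ?in_setE /A /=.
    rewrite in_itv/= -(fineK (fin01 _ (f01 x))) lee_fin => /andP[h _]; apply/andP; split; lra.
  rewrite in_itv/= andbT -(fineK (fin01 _ (f01 x))) lee_fin => /negP; rewrite -ltNge => h.
  apply/andP; split; lra.
have intE (m : {measure set T -> \bar R}) : \int[m]_x f x =
    (1 / 2)%:E * m A + (1 / 2)%:E * \int[m]_x (g x)%:E.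
  under eq_integral do rewrite fE.
  rewrite ge0_integralD//; last 3 first.
  - by apply: measurable_funeM; exact/measurable_EFinP.
  - by move=> x _; rewrite mule_ge0//; case/andP: (g01 x).
  - exact: measurable_funeM.
  rewrite ge0_integralZl//; last exact/measurable_EFinP.
  rewrite ge0_integralZl//; last by move=> x _; case/andP: (g01 x).
  by rewrite integral_indic// setIT.
have A01 (m : {measure set T -> \bar R}) : m setT = 1 -> 0 <= m A <= 1.
  by move=> m1; rewrite measure_ge0 -m1 le_measure ?inE.
(* The error for [f] is the mean of the error [e] for [A] and the error [e + 2^-n] for [g], which is
   [e + 2^-(n+1)]. *)
rewrite !intE.
move: (ih _ mg g01) (le_e _ mA).
move: (probability_integral01 mu1 mg g01) (probability_integral01 nu1 mg g01) (A01 _ mu1) (A01 _ nu1).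
move=> /fin01/fineK <- /fin01/fineK <- /fin01/fineK <- /fin01/fineK <-.
rewrite -!EFinM -!EFinD !lee_fin exprS invfM.
set v := (2 ^- n)%R; lra.
Qed.

End nonnegative_integrals.

(** For [c = +oo] continuity of multiplication fails; monotonicity replaces it, since either [u]
    vanishes identically or the products are eventually +oo. *)
Lemma limn_mule (R : realType) (u : nat -> \bar R) (c : \bar R) :
  (forall n, 0 <= u n)%E -> {homo u : m n / (m <= n)%N >-> (m <= n)%E} ->
  (0 <= c)%E -> limn (fun n => u n * c)%E = (limn u * c)%E.
Proof.
move=> u0 ndu; have cu : cvgn u by exact: ereal_nondecreasing_is_cvgn.
case: c => [c| |//] c0.
  by apply/cvg_lim => //; apply: cvgeZr.
have [un|/existsNP[n /eqP un]] := pselect (forall n, u n = 0).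
  have -> : (fun n => u n * +oo)%E = cst 0%E by apply/funext => n; rewrite un mul0e.
  have -> : u = cst 0%E by apply/funext.
  by rewrite (cvg_lim _ (cvg_cst 0%E))// mul0e.
have un0 : (0 < u n)%E by rewrite lt_neqAle eq_sym un u0.
have lu : (0 < limn u)%E.
  rewrite (lt_le_trans un0)//; apply: lime_ge => //.
  by exists n => // m /= nm; exact: ndu.
rewrite gt0_muley//; apply/cvg_lim => //; apply: cvg_near_cst.
exists n => // m /= nm; rewrite gt0_muley//.
by rewrite (lt_le_trans un0)// ndu.
Qed.

(** * Image measures, mixtures and measures with a density *)

Section constructions.
Context d1 d2 (X : measurableType d1) (Y : measurableType d2) (R : realType).
Local Open Scope ereal_scope.

Lemma limn_nd_integral d (T : measurableType d) (mu : {measure set T -> \bar R})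
    (D : set T) (f_ : nat -> T -> \bar R) : measurable D ->
  (forall n, measurable_fun D (f_ n)) -> (forall n x, D x -> 0 <= f_ n x) ->
  (forall x, D x -> {homo f_^~ x : m n / (m <= n)%N >-> m <= n}) ->
  {homo (fun n => \int[mu]_(x in D) f_ n x) : m n / (m <= n)%N >-> m <= n}.
Proof.
move=> mD mf f0 ndf m n mn; apply: ge0_le_integral => //.
- by move=> x Dx; exact: f0.
- by move=> x Dx; exact: ndf.
Qed.

(** The map is restricted to [D] because left multiplication by an arrow is under control only on
    one fiber. *)
Lemma image_measure_exists (mu : {measure set X -> \bar R}) (D : set X)
    (phi : X -> Y) : measurable D -> measurable_fun D phi ->
  exists nu : {measure set Y -> \bar R},
    (forall A, measurable A -> nu A = mu (D `&` phi @^-1` A)) /\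
    (forall f, measurable_fun setT f -> (forall y, 0 <= f y) ->
      \int[nu]_y f y = \int[mu]_(x in D) f (phi x)).
Proof.
move=> mD mphi.
have [nu nuE] : exists nu : {measure set Y -> \bar R},
    forall A, nu A = mu (D `&` phi @^-1` A).
  apply: measure_of_set_function => //.
  - by rewrite preimage_set0 setI0.
  - apply: semi_sigma_additive_nneseries => // F mF tF.
    rewrite preimage_bigcup setI_bigcupr measure_bigcupT//.
      by move=> n; exact: mphi.
    apply/trivIsetP => i j _ _ ij; rewrite setIACA -preimage_setI.
    by move/trivIsetP : tF => /(_ _ _ I I ij) ->; rewrite preimage_set0 setI0.
exists nu; split=> [A _|]; first exact: nuE.
apply: ge0_measurable_ind.
- move=> A mA; have mDA : measurable (D `&` phi @^-1` A) by exact: mphi.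
  rewrite integral_indic// setIT nuE.
  rewrite (eq_integral (fun x => (\1_(D `&` phi @^-1` A) x)%:E)).
    by rewrite integral_indic// setIAC setIid.
  by move=> x Dx; rewrite !indicE in_setI Dx.
- move=> c f c0 mf f0 ih; rewrite ge0_integralZl//.
  rewrite ih -ge0_integralZl//.
  exact: measurableT_comp.
- move=> f g mf mg f0 g0 ihf ihg; rewrite ge0_integralD// ihf ihg ge0_integralD//.
    exact: measurableT_comp.
  exact: measurableT_comp.
- move=> f_ mf f0 ndf ih; rewrite monotone_convergence//.
  rewrite [RHS]monotone_convergence//.
    by apply/congr_lim/funext.
  by move=> n; exact: measurableT_comp.
Qed.

Lemma mixture_exists (mu : {measure set X -> \bar R})
    (l : X -> {measure set Y -> \bar R}) :
  (forall A, measurable A -> measurable_fun setT (l^~ A)) ->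
  exists nu : {measure set Y -> \bar R},
    (forall A, measurable A -> nu A = \int[mu]_x l x A) /\
    (forall f, measurable_fun setT f -> (forall y, 0 <= f y) ->
      \int[nu]_y f y = \int[mu]_x \int[l x]_y f y).
Proof.
move=> ml.
have [nu nuE] : exists nu : {measure set Y -> \bar R},
    forall A, nu A = \int[mu]_x l x A.
  apply: measure_of_set_function.
  - by under eq_integral do rewrite measure0; rewrite integral0.
  - by move=> A; apply: integral_ge0.
  - apply: semi_sigma_additive_nneseries => [A|F mF tF]; first exact: integral_ge0.
    rewrite -integral_nneseries//; last by move=> n; exact: ml.
    by apply: eq_integral => x _; rewrite measure_bigcupT.
have mint f : measurable_fun setT f -> (forall y, 0 <= f y) ->
    measurable_fun setT (fun x => \int[l x]_y f y).
  by move=> mf f0; exact: measurable_fun_integral_kernel.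
exists nu; split=> [A _|]; first exact: nuE.
apply: ge0_measurable_ind.
- move=> A mA; rewrite integral_indic// setIT nuE.
  by apply: eq_integral => x _; rewrite integral_indic// setIT.
- move=> c f c0 mf f0 ih; rewrite ge0_integralZl// ih -ge0_integralZl//.
  + by apply: eq_integral => x _; rewrite ge0_integralZl.
  + exact: mint.
  + by move=> x _; exact: integral_ge0.
- move=> f g mf mg f0 g0 ihf ihg; rewrite ge0_integralD// ihf ihg -ge0_integralD//.
  + by apply: eq_integral => x _; rewrite ge0_integralD.
  + by move=> x _; exact: integral_ge0.
  + exact: mint.
  + by move=> x _; exact: integral_ge0.
  + exact: mint.
- move=> f_ mf f0 ndf ih; rewrite monotone_convergence//.
  under [RHS]eq_integral do rewrite monotone_convergence//.
  rewrite [RHS]monotone_convergence//.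
  + by apply/congr_lim/funext.
  + by move=> n; exact: mint.
  + by move=> n x _; exact: integral_ge0.
  + by move=> x _; exact: limn_nd_integral.
Qed.

Lemma density_measure_exists (mu : {measure set X -> \bar R}) (D : X -> \bar R) :
  measurable_fun setT D -> (forall x, 0 <= D x) ->
  exists nu : {measure set X -> \bar R},
    forall A, measurable A -> nu A = \int[mu]_(x in A) D x.
Proof.
move=> mD D0.
have [nu nuE] : exists nu : {measure set X -> \bar R},
    forall A, nu A = \int[mu]_(x in A) D x.
  apply: measure_of_set_function.
  - by rewrite integral_set0.
  - by move=> A; apply: integral_ge0.
  - apply: semi_sigma_additive_nneseries => [A|F mF tF]; first exact: integral_ge0.
    rewrite ge0_integral_bigcup//; exact: measurable_funTS.
by exists nu => A _.
Qed.

Lemma integral_density (mu nu : {measure set X -> \bar R}) (D : X -> \bar R) :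
  measurable_fun setT D -> (forall x, 0 <= D x) ->
  (forall A, measurable A -> nu A = \int[mu]_(x in A) D x) ->
  forall f, measurable_fun setT f -> (forall y, 0 <= f y) ->
    \int[nu]_y f y = \int[mu]_y (f y * D y).
Proof.
move=> mD D0 nuE; apply: ge0_measurable_ind.
- move=> A mA; rewrite integral_indic// setIT nuE// integral_mkcond.
  apply: eq_integral => x _; rewrite patchE indicE.
  by case: ifPn => _; rewrite ?mul1e ?mul0e.
- move=> c f c0 mf f0 ih; rewrite ge0_integralZl// ih -ge0_integralZl//.
  + by apply: eq_integral => x _; rewrite muleA.
  + exact: emeasurable_funM.
  + by move=> x _; rewrite mule_ge0.
- move=> f g mf mg f0 g0 ihf ihg; rewrite ge0_integralD// ihf ihg -ge0_integralD//.
  + by apply: eq_integral => x _; rewrite ge0_muleDl.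
  + by move=> x _; rewrite mule_ge0.
  + exact: emeasurable_funM.
  + by move=> x _; rewrite mule_ge0.
  + exact: emeasurable_funM.
- move=> f_ mf f0 ndf ih; rewrite monotone_convergence//.
  transitivity (\int[mu]_x limn (fun n => f_ n x * D x)).
    rewrite [RHS]monotone_convergence//.
    + by apply/congr_lim/funext.
    + by move=> n; exact: emeasurable_funM.
    + by move=> n x _; rewrite mule_ge0.
    + by move=> x _ m n mn; rewrite lee_wpmul2r// ndf.
  apply: eq_integral => x _.
  by apply: limn_mule => // m n mn; exact: ndf.
Qed.

End constructions.

(* [borel (G * G)%type] requires a pointed topological structure on the product. *)
HB.instance Definition _ (T U : ptopologicalType) := Topological.on (T * U)%type.

Lemma within_continuous_measurable (T U : ptopologicalType) (D : set T)
    (f : T -> U) : closed D -> {within D, continuous f} ->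
  measurable_fun (D : set (borel T)) (f : borel T -> borel U).
Proof.
move=> cD cf.
apply: (measurability _ (erefl : @measurable _ (borel U) = <<s @open U >>)).
move=> _ [B oB <-].
have /open_subspaceP[V oV VD] : open (f @^-1` B : set (subspace D)).
  by move/continuousP : cf; apply.
rewrite setIC -VD; apply: measurableI; first exact: open_borel_measurable.
exact: closed_borel_measurable.
Qed.

(** * Averaging operators and convolution of systems *)

Section convolution_operator.
Context (R : realType) (G : ptopologicalType) (gr : groupoid G).
Hypothesis lcgG : locally_compact_groupoid gr.
Implicit Types al be : G -> borel_measure R G.
Local Open Scope ereal_scope.

(** The Markov operator of the random walk with increments [al], on nonnegative extended functions.
    At a fixed [g] it is integration against the translate of [al (src gr g)] by [g]. *)
Definition conv_op al (f : G -> \bar R) (g : G) : \bar R :=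
  \int[al (src gr g)]_(h in fiber gr (src gr g)) f (gmul gr g h).

Lemma closed_composable : closed (composable gr).
Proof.
apply: (@closed_eq _ _ lcgG _ (src gr \o fst) (tgt gr \o snd)) => p.
- by apply: continuous_comp; [exact: cvg_fst|exact: lcg_src].
- by apply: continuous_comp; [exact: cvg_snd|exact: lcg_tgt].
Qed.

Lemma within_continuous_gmul (g : G) :
  {within fiber gr (src gr g), continuous (gmul gr g)}.
Proof.
apply/subspace_continuousP => h gh A /=.
have /subspace_continuousP/(_ (g, h)) := lcg_gmul lcgG.
rewrite /composable /= => /(_ (esym gh)) c /c.
rewrite !nbhs_simpl /= => -[[U V] /= [gU hV] UV].
rewrite /within /=; apply: filterS hV => y Vy gy.
by apply: (UV (g, y)) => //=; split=> //; exact: nbhs_singleton.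
Qed.

Lemma measurable_gmul (g : G) : measurable_fun
  (fiber gr (src gr g) : set (borel G)) (gmul gr g : borel G -> borel G).
Proof.
apply: within_continuous_measurable; first exact: closed_fiber.
exact: within_continuous_gmul.
Qed.

Lemma translate_measure (g : G) (rho : borel_measure R G) :
  exists nu : borel_measure R G,
    (forall A : set (borel G), measurable A -> nu A = translate gr g rho A) /\
    (forall f : borel G -> \bar R, measurable_fun setT f -> (forall y, 0 <= f y) ->
      \int[nu]_y f y = \int[rho]_(h in fiber gr (src gr g)) f (gmul gr g h)).
Proof.
apply: image_measure_exists; last exact: measurable_gmul.
exact: measurable_fiber.
Qed.

Lemma measurable_gmul_comp (g : G) (f : borel G -> \bar R) :
  measurable_fun setT f ->
  measurable_fun (fiber gr (src gr g) : set (borel G)) (fun h => f (gmul gr g h)).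
Proof. by move=> mf; apply: measurableT_comp mf _; exact: measurable_gmul. Qed.

Section kernel.
Context (Z : ptopologicalType) (q : Z -> G) (al : G -> borel_measure R G).
Hypothesis cq : continuous q.
Hypothesis uq : forall z, units gr (q z).
Hypothesis cal : continuous_probability_system gr al.

Lemma probability_fiber x : units gr x -> al x (fiber gr x) = 1.
Proof.
move=> ux; have [[/(_ _ ux)[_ _ _ al0] _] /(_ _ ux) al1] := cal.
have mf := measurable_fiber lcgG x.
have : al x (fiber gr x) + al x (~` fiber gr x) = 1.
  by rewrite -al1 -measureU ?setUv//; [exact: measurableC|rewrite setICr].
by rewrite al0 adde0.
Qed.

(** For indicators of open sets this follows from [lsc_integral_fiber]. A Dynkin argument reaches
    all Borel sets, total mass 1 allowing complements to be subtracted, and integration against a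
    kernel does the rest. *)
Lemma measurable_integral_fiber (k : borel (Z * G)%type -> \bar R) :
  measurable_fun setT k -> (forall p, 0 <= k p) ->
  measurable_fun setT ((fun z =>
    \int[al (q z)]_(h in fiber gr (q z)) k (z, h)) : borel Z -> \bar R).
Proof.
move=> mk k0.
have mpair (z : Z) : measurable_fun (fiber gr (q z) : set (borel G))
    ((fun h => (z, h)) : borel G -> borel (Z * G)%type).
  apply: (@within_continuous_measurable G (Z * G)%type _ (fun h => (z, h))).
    exact: closed_fiber.
  by apply: continuous_subspaceT => h; apply: cvg_pair => //=; exact: cvg_cst.
have /choice[l lE] : forall z : borel Z, exists nu : borel_measure R (Z * G)%type,
    (forall A : set (borel (Z * G)%type), measurable A ->
       nu A = al (q z) (fiber gr (q z) `&` (fun h => (z, h)) @^-1` A)) /\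
    (forall f : borel (Z * G)%type -> \bar R, measurable_fun setT f ->
       (forall y, 0 <= f y) ->
       \int[nu]_y f y = \int[al (q z)]_(h in fiber gr (q z)) f (z, h)).
  move=> z; apply: image_measure_exists; last exact: mpair.
  exact: measurable_fiber.
have l1 z : l z setT = 1.
  by have [-> // _] := lE z; rewrite preimage_setT setIT probability_fiber.
have ml (A : set (borel (Z * G)%type)) : measurable A -> measurable_fun setT (l ^~ A).
  pose P (B : set (borel (Z * G)%type)) := measurable_fun setT (l ^~ B).
  suff : <<s @open (Z * G)%type >> `<=` P by exact.
  move=> B; apply: (@dynkin_induction _ (borel (Z * G)%type) _ P erefl) => {B}.
  - exact: openI.
  - by rewrite /P; under eq_fun do rewrite l1; exact: measurable_cst.
  - move=> U oU.
    have mU : measurable (U : set (borel (Z * G)%type)) by exact: open_borel_measurable.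
    rewrite /P (_ : l ^~ U = fun z : Z => \int[al (q z)]_(h in fiber gr (q z)) (\1_U (z, h))%:E); last first.
      apply/funext => z; have [_ /(_ (fun p => (\1_U p)%:E)) <-//] := lE z.
      - by rewrite integral_indic// setIT.
      - exact/measurable_EFinP.
    apply: lsc_measurable; apply: (lsc_integral_fiber lcgG cq uq (cal.1)
        (k := fun p => (\1_U p)%:E)).
      by move=> p; rewrite lee_fin.
    move=> p a; rewrite lte_fin indicE => ap.
    have [Up|Up] := boolP (p \in U); move: ap.
      rewrite Up => a1; exists U; first by apply: open_nbhs_nbhs; split=> //; exact: set_mem.
      by move=> y Uy; rewrite lte_fin indicE mem_set.
    rewrite (negbTE Up) => a0; exists setT; first exact: filterT.
    by move=> y _; rewrite lte_fin (lt_le_trans a0).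
  - move=> S mS mlS; rewrite /P.
    rewrite (_ : l ^~ (~` S) = fun z => 1 - l z S); last first.
      apply/funext => z; have := measure_ge0 (l z) S; rewrite -(l1 z) => lS0.
      rewrite -setTD measureD//.
        by rewrite setTI.
      by apply: (@eq_ind_r _ 1 (fun t => t < +oo)); [exact: ltry|exact: l1].
    by apply: emeasurable_funB => //; exact: measurable_cst.
  - move=> F mF tF mlF; rewrite /P.
    under eq_fun do rewrite measure_bigcupT//.
    by apply: ge0_emeasurable_sum => // n _; exact: mlF.
rewrite (_ : (fun _ => _) = fun z : borel Z => \int[l z]_p k p).
  exact: measurable_fun_integral_kernel.
by apply/funext => z; have [_ ->] := lE z.
Qed.

End kernel.

Lemma measurable_conv_op al (f : borel G -> \bar R) :
  continuous_probability_system gr al ->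
  measurable_fun setT f -> (forall g, 0 <= f g) ->
  measurable_fun setT (conv_op al f : borel G -> \bar R).
Proof.
move=> cal mf f0.
pose k : borel (G * G)%type -> \bar R := (fun p => f (gmul gr p.1 p.2)) \_ (composable gr).
have mk : measurable_fun setT k.
  apply/(measurable_restrictT _ _).1.
    exact: (closed_borel_measurable (T := (G * G)%type) closed_composable).
  apply: measurableT_comp mf _.
  apply: (@within_continuous_measurable (G * G)%type G _ (fun p => gmul gr p.1 p.2)).
    exact: closed_composable.
  exact: lcg_gmul.
have k0 p : 0 <= k p by rewrite /k patchE; case: ifP.
rewrite (_ : conv_op al f = fun g : G =>
    \int[al (src gr g)]_(h in fiber gr (src gr g)) k (g, h)); last first.
  apply/funext => g; apply: eq_integral => h; rewrite inE => gh.
  by rewrite /k patchE mem_set.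
apply: measurable_integral_fiber => //.
- exact: lcg_src.
- exact: src_units.
Qed.

Lemma lsc_conv_op al f : continuous_system gr al -> (forall g, 0 <= f g) ->
  lower_semicontinuous f -> lower_semicontinuous (conv_op al f).
Proof.
move=> cal f0 lf.
pose k := patch (cst +oo) (composable gr) (f \o (fun p : G * G => gmul gr p.1 p.2)).
rewrite (_ : conv_op al f = fun g : G =>
    \int[al (src gr g)]_(h in fiber gr (src gr g)) k (g, h)); last first.
  apply/funext => g; apply: eq_integral => h; rewrite inE => gh.
  by rewrite /k /patch mem_set.
apply: (lsc_integral_fiber lcgG (lcg_src lcgG) (src_units gr) cal).
  by move=> p; rewrite /k /patch; case: ifP => _ /=; [exact: f0|exact: leey].
apply: lsc_patch => //; first exact: closed_composable.
exact: lcg_gmul.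
Qed.

End convolution_operator.

Lemma measure_integral_indic d (T : measurableType d) (R : realType)
    (mu : {measure set T -> \bar R}) (A : set T) : measurable A ->
  mu A = (\int[mu]_z (\1_A z)%:E)%E.
Proof. by move=> mA; rewrite integral_indic// setIT. Qed.

Lemma measurable_EFin_indic d (T : measurableType d) (R : realType) (A : set T) :
  measurable A -> measurable_fun setT (fun z => (\1_A z)%:E : \bar R).
Proof. by move=> mA; exact/measurable_EFinP. Qed.

Section convolution_operator_theory.
Context (R : realType) (G : ptopologicalType) (gr : groupoid G).
Hypothesis lcgG : locally_compact_groupoid gr.
Implicit Types al be : G -> borel_measure R G.
Local Open Scope ereal_scope.

Lemma conv_op_ge0 al (f : borel G -> \bar R) g : (forall z, 0 <= f z) ->
  0 <= conv_op gr al f g.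
Proof. by move=> f0; exact: integral_ge0. Qed.

Lemma eq_conv_op al (f f' : borel G -> \bar R) g :
  (forall z, tgt gr z = tgt gr g -> f z = f' z) ->
  conv_op gr al f g = conv_op gr al f' g.
Proof.
move=> ff'; apply: eq_integral => h; rewrite inE => gh; apply: ff'.
by rewrite tgt_gmul// gh.
Qed.

Lemma conv_opD al (f f' : borel G -> \bar R) g :
  measurable_fun setT f -> measurable_fun setT f' ->
  (forall z, 0 <= f z) -> (forall z, 0 <= f' z) ->
  conv_op gr al (fun z => f z + f' z) g = conv_op gr al f g + conv_op gr al f' g.
Proof.
move=> mf mf' f0 f'0; apply: ge0_integralD => //.
- exact: measurable_fiber.
- exact: measurable_gmul_comp.
- exact: measurable_gmul_comp.
Qed.

Lemma conv_opZ al (c : R) (f : borel G -> \bar R) g : (0 <= c)%R ->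
  measurable_fun setT f -> (forall z, 0 <= f z) ->
  conv_op gr al (fun z => c%:E * f z) g = c%:E * conv_op gr al f g.
Proof.
move=> c0 mf f0; apply: ge0_integralZl => //.
- exact: measurable_fiber.
- exact: measurable_gmul_comp.
Qed.

Lemma conv_op_nneseries al (f : nat -> borel G -> \bar R) g :
  (forall n, measurable_fun setT (f n)) -> (forall n z, 0 <= f n z) ->
  conv_op gr al (fun z => \sum_(n <oo) f n z) g = \sum_(n <oo) conv_op gr al (f n) g.
Proof.
move=> mf f0; apply: integral_nneseries => //.
- exact: measurable_fiber.
- by move=> n; exact: measurable_gmul_comp.
Qed.

Lemma conv_op_sum al (I : Type) (s : seq I) (f : I -> borel G -> \bar R) g :
  (forall n, measurable_fun setT (f n)) -> (forall n z, 0 <= f n z) ->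
  conv_op gr al (fun z => \sum_(n <- s) f n z) g = \sum_(n <- s) conv_op gr al (f n) g.
Proof.
move=> mf f0; apply: ge0_integral_sum => //.
- exact: measurable_fiber.
- by move=> n; exact: measurable_gmul_comp.
Qed.

Lemma le_conv_op al (f f' : borel G -> \bar R) g :
  measurable_fun setT f -> measurable_fun setT f' -> (forall z, 0 <= f z) ->
  (forall z, tgt gr z = tgt gr g -> f z <= f' z) ->
  conv_op gr al f g <= conv_op gr al f' g.
Proof.
move=> mf mf' f0 ff'; apply: ge0_le_integral => //.
- exact: measurable_fiber.
- exact: measurable_gmul_comp.
- exact: measurable_gmul_comp.
- by move=> h gh; apply: ff'; rewrite tgt_gmul// gh.
Qed.

Lemma conv_op_gmul al (f : borel G -> \bar R) g z : src gr g = tgt gr z ->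
  conv_op gr al f (gmul gr g z) = conv_op gr al (fun h => f (gmul gr g h)) z.
Proof.
move=> gz; rewrite /conv_op src_gmul//; apply: eq_integral => h.
by rewrite inE => zh; rewrite gmulA// zh.
Qed.

Lemma conv_op_tgt al (v : G -> \bar R) g : continuous_probability_system gr al ->
  conv_op gr al (v \o tgt gr) g = v (tgt gr g).
Proof.
move=> cal; rewrite /conv_op (eq_integral (cst (v (tgt gr g)))) => [|h]; last first.
  by rewrite inE => gh; rewrite /= tgt_gmul// gh.
rewrite integral_cst; last exact: measurable_fiber.
by rewrite (probability_fiber lcgG cal)// ?mule1//; exact: src_units.
Qed.

Lemma conv_op_cst al c g : continuous_probability_system gr al ->
  conv_op gr al (cst c) g = c.
Proof. by move=> cal; rewrite -[RHS](conv_op_tgt (cst c) g cal). Qed.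

Lemma conv_op01 al (f : borel G -> \bar R) g : continuous_probability_system gr al ->
  measurable_fun setT f -> (forall z, 0 <= f z <= 1) -> 0 <= conv_op gr al f g <= 1.
Proof.
move=> cal mf f01; have f0 z : 0 <= f z by case/andP: (f01 z).
rewrite conv_op_ge0//= -[leRHS](conv_op_cst 1 g cal).
by apply: le_conv_op => // z _; case/andP: (f01 z).
Qed.

Lemma translateE al g (A : set (borel G)) : measurable A ->
  translate gr g (al (src gr g)) A = conv_op gr al (fun z => (\1_A z)%:E) g.
Proof.
move=> mA; have [nu [nuA nuf]] := translate_measure lcgG g (al (src gr g)).
have mA1 := @measurable_EFin_indic _ _ R _ mA.
by rewrite -nuA// /conv_op -(nuf _ mA1)// integral_indic// setIT.
Qed.

Lemma unit_conv_op al (f : borel G -> \bar R) x : continuous_system gr al ->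
  units gr x -> measurable_fun setT f -> (forall z, 0 <= f z) ->
  conv_op gr al f x = \int[al x]_z f z.
Proof.
move=> cal ux mf f0; rewrite (integral_setT_fiber lcgG ux cal mf f0).
rewrite /conv_op src_unit//; apply: eq_integral => h; rewrite inE => xh.
by congr f; rewrite -[RHS](gmul_tgt gr) xh.
Qed.

(** [ga x] is the mixture under [al x] of the translates of [be]. That these measures form a
    continuous system is postponed to [convolution_system], where domination by [lambda] yields the
    Radon property. *)
Lemma convolution_exists al be : continuous_probability_system gr be ->
  exists ga : G -> borel_measure R G, forall x f, measurable_fun setT f ->
    (forall z, 0 <= f z) ->
    \int[ga x]_z f z = \int[al x]_z conv_op gr be f z.
Proof.
move=> cbe.
have /choice[l lE] : forall z : borel G, exists nu : borel_measure R G,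
    (forall A : set (borel G), measurable A ->
      nu A = translate gr z (be (src gr z)) A) /\
    (forall f : borel G -> \bar R, measurable_fun setT f -> (forall y, 0 <= f y) ->
      \int[nu]_y f y = conv_op gr be f z).
  by move=> z; exact: translate_measure.
have /choice[ga gaE] : forall x, exists nu : borel_measure R G,
    (forall A, measurable A -> nu A = \int[al x]_z l z A) /\
    (forall f, measurable_fun setT f -> (forall y, 0 <= f y) ->
      \int[nu]_y f y = \int[al x]_z \int[l z]_y f y).
  move=> x; apply: mixture_exists => A mA.
  rewrite (_ : l ^~ A = conv_op gr be (fun z => (\1_A z)%:E)); last first.
    by apply/funext => z; have [-> // _] := lE z; rewrite translateE.
  by apply: measurable_conv_op => //; exact/measurable_EFinP.
exists ga => x f mf f0; have [_ ->//] := gaE x.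
by apply: eq_integral => z _; have [_ ->] := lE z.
Qed.

Section convolution.
Context (al be ga : G -> borel_measure R G).
Hypothesis cal : continuous_probability_system gr al.
Hypothesis cbe : continuous_probability_system gr be.
Hypothesis gaE : forall x f, measurable_fun setT f -> (forall z, 0 <= f z) ->
    \int[ga x]_z f z = \int[al x]_z conv_op gr be f z.

Lemma conv_op_convolution (f : borel G -> \bar R) g : measurable_fun setT f ->
  (forall z, 0 <= f z) ->
  conv_op gr ga f g = conv_op gr al (conv_op gr be f) g.
Proof.
move=> mf f0; have [[/(_ _ (src_units gr g)) al4 _] al1] := cal.
rewrite {1}/conv_op integral_mkcond gaE; last 2 first.
- apply/(measurable_restrictT _ _).1; first exact: measurable_fiber.
  exact: measurable_gmul_comp.
- by move=> z; rewrite patchE; case: ifP.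
rewrite (integral_setT_fiber lcgG (src_units gr g) cal.1); last 2 first.
- apply: measurable_conv_op => //.
    apply/(measurable_restrictT _ _).1; first exact: measurable_fiber.
    exact: measurable_gmul_comp.
  by move=> z; rewrite patchE; case: ifP.
- by move=> z; apply: conv_op_ge0 => y; rewrite patchE; case: ifP.
apply: eq_integral => z; rewrite inE => gz.
rewrite conv_op_gmul//; apply: eq_conv_op => y yz.
by rewrite patchE mem_set// /fiber /= yz gz.
Qed.

Lemma convolution_setT x : units gr x -> ga x setT = 1.
Proof.
move=> ux; rewrite -[LHS]mul1e -integral_cst// gaE//.
under eq_integral do rewrite (conv_op_cst _ _ cbe).
by rewrite integral_cst// mul1e; apply: cal.2.
Qed.

Lemma convolution_fiber x : units gr x -> ga x (~` fiber gr x) = 0.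
Proof.
move=> ux; have mF : measurable (~` fiber gr x : set (borel G)).
  by apply: measurableC; exact: measurable_fiber.
rewrite measure_integral_indic// gaE//; last exact: measurable_EFin_indic.
have mf : measurable_fun setT (conv_op gr be (fun z => (\1_(~` fiber gr x) z)%:E) : borel G -> \bar R).
  by apply: measurable_conv_op => //; exact/measurable_EFinP.
rewrite (integral_setT_fiber lcgG ux cal.1) => [||z]//; last exact: conv_op_ge0.
apply: integral0_eq => z xz; apply: integral0_eq => h zh.
by rewrite indicE memNset//= /fiber /= tgt_gmul// zh.
Qed.

Lemma lsc_convolution (f : G -> \bar R) : (forall z, 0 <= f z) ->
  lower_semicontinuous f ->
  lower_semicontinuous (fun g => \int[ga (src gr g)]_z f z).
Proof.
move=> f0 lf.
have mf : measurable_fun setT (f : borel G -> \bar R) by exact: lsc_measurable.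
have mbf : measurable_fun setT (conv_op gr be f : borel G -> \bar R).
  exact: measurable_conv_op.
rewrite (_ : (fun _ => _) = conv_op gr al (conv_op gr be f) \o src gr).
  apply: lsc_comp; first exact: lcg_src.
  apply: lsc_conv_op => //; first exact: cal.1.
    by move=> z; exact: conv_op_ge0.
  by apply: lsc_conv_op => //; exact: cbe.1.
apply/funext => g /=; rewrite gaE// unit_conv_op//; first exact: cal.1.
  exact: src_units.
by move=> z; exact: conv_op_ge0.
Qed.

End convolution.

End convolution_operator_theory.

(** * Continuity of systems dominated by the Haar system *)

Lemma measure_setDK d (T : measurableType d) (R : realType)
    (mu : {measure set T -> \bar R}) (A B : set T) :
  measurable A -> measurable B -> B `<=` A -> mu A = (mu B + mu (A `\` B))%E.
Proof.
move=> mA mB BA; rewrite -[in LHS](setDUK BA) measureU//; first exact: measurableD.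
by rewrite setDE setICA setICr setI0.
Qed.

Section dominated_systems.
Context (R : realType) (G : ptopologicalType) (gr : groupoid G).
Hypothesis lcgG : locally_compact_groupoid gr.
Local Open Scope ereal_scope.

Lemma compact_borel_measurable (K : set G) : compact K ->
  measurable (K : set (borel G)).
Proof.
move=> cK; apply: closed_borel_measurable.
exact: (compact_closed (lcg_hausdorff lcgG)).
Qed.

(* The countably many compact sets exhausting [A] for the Radon measure [nu]
   exhaust it for [mu] as well, by absolute continuity. *)
Lemma radon_dominated (mu nu : borel_measure R G) :
  radon_measure nu -> sigma_finite setT nu -> mu `<< nu -> mu setT = 1 ->
  radon_measure mu.
Proof.
move=> [_ nuK] [F FT Fnu] munu mu1; split.
  move=> K cK; rewrite (@le_lt_trans _ _ 1) ?ltry// -mu1 le_measure ?inE//.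
  exact: compact_borel_measurable.
move=> A mA; apply/eqP; rewrite eq_le; apply/andP; split; last first.
  apply: ge_ereal_sup => _ [K [cK KA] <-]; rewrite le_measure ?inE//.
  exact: compact_borel_measurable.
have mAF n : measurable (A `&` F n) by apply: measurableI => //; case: (Fnu n).
have AFfin n : nu (A `&` F n) < +oo.
  have [mF] := Fnu n; apply: le_lt_trans; apply: le_measure; rewrite ?inE//.
have /choice[K KP] : forall p : nat * nat, exists K : set (borel G),
    [/\ compact (K : set G), K `<=` A `&` F p.1 &
      nu ((A `&` F p.1) `\` K) <= (p.2.+1%:R^-1)%:E].
  move=> [n m] /=.
  have : nu (A `&` F n) - (m.+1%:R^-1)%:E < nu (A `&` F n).
    have : nu (A `&` F n) \is a fin_num by rewrite ge0_fin_numE.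
    by move=> /fineK <-; rewrite -EFinB lte_fin ltrBlDr ltrDl invr_gt0.
  rewrite [X in _ < X](nuK _ (mAF n)) => /ereal_sup_gt[_ [K [cK KA] <-] ltK].
  exists K; split=> //; have mK := compact_borel_measurable cK.
  have AE := measure_setDK nu (mAF n) mK KA.
  have : nu (A `&` F n) \is a fin_num by rewrite ge0_fin_numE.
  move: ltK; rewrite AE; have := measure_ge0 nu ((A `&` F n) `\` K).
  have := measure_ge0 nu K.
  case: (nu K) => [k| |]; case: (nu (_ `\` K)) => [r| |] //=.
  rewrite -!EFinD lte_fin lee_fin => _ _ + _; move: (_^-1)%R => e; lra.
pose L (j : nat) : set (borel G) := if unpickle j is Some p then K p else set0.
have cL j : compact (L j : set G).
  by rewrite /L; case: unpickle => [p|]; [case: (KP p)|exact: compact0].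
have LA j : L j `<=` A.
  rewrite /L; case: unpickle => [p|]//; have [_ + _] := KP p.
  by move=> /subset_trans; apply; exact: subIsetl.
pose U n : set (borel G) := \bigcup_(j < n) L j.
have cU n : compact (U n : set G).
  rewrite /U bigcup_mkord; elim/big_ind: _ => //; first exact: compact0.
  by move=> *; exact: compactU.
have mU n : measurable (U n) by exact: compact_borel_measurable.
have mN n : measurable ((A `&` F n) `\` \bigcup_m K (n, m)).
  apply: measurableD => //; apply: bigcup_measurable => m _.
  by apply: compact_borel_measurable; case: (KP (n, m)).
have N0 n : mu ((A `&` F n) `\` \bigcup_m K (n, m)) = 0.
  apply: (null_content_dominatesP _ _).1 munu _ (mN n) _.
  apply/eqP; rewrite eq_le measure_ge0 andbT; apply/lee_addgt0Pr => e e0.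
  have [m me] := ltr_add_invr e0; rewrite add0r in me; rewrite add0e.
  have [/= cK _ Ke] := KP (n, m).
  apply: (@le_trans _ _ (m.+1%:R^-1)%:E); last by rewrite lee_fin ltW.
  apply: le_trans Ke.
  apply: le_measure; rewrite ?inE//=.
    by apply: measurableD => //; exact: compact_borel_measurable.
  by move=> z [Az Kz]; split=> // Kz'; apply: Kz; exists m.
have mUU : measurable (\bigcup_n U n) by exact: bigcup_measurable.
have AU0 : mu (A `\` \bigcup_n U n) = 0.
  apply/eqP; rewrite eq_le measure_ge0 andbT.
  rewrite -(@eseries0 _ (fun n => mu ((A `&` F n) `\` \bigcup_m K (n, m))) 0 xpredT)//.
  apply: measure_sigma_subadditive => //.
    by apply: measurableD.
  move=> z [Az Uz]; have : [set: borel G] z by [].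
  rewrite FT => -[n _ Fz]; exists n => //; split=> // -[m _ Kz].
  apply: Uz; exists (pickle (n, m)).+1 => //.
  by exists (pickle (n, m)) => //=; rewrite /L pickleK.
have UA : \bigcup_n U n `<=` A by apply: bigcup_sub => n _; apply: bigcup_sub => j _; exact: LA.
have -> : mu A = mu (\bigcup_n U n).
  by rewrite (measure_setDK mu mA mUU UA) AU0 adde0.
have ndU : nondecreasing_seq U.
  move=> m n mn; apply/subsetPset; apply: bigcup_sub => j /= jm z Lz.
  by exists j => //=; exact: leq_trans mn.
have cvU := @nondecreasing_cvg_mu _ _ _ mu _ mU mUU ndU.
rewrite -(cvg_lim _ cvU)//; apply: lime_le; first by apply/cvg_ex; eexists; exact: cvU.
apply: nearW => n; apply: ereal_sup_ubound; exists (U n) => //; split=> //.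
by apply: bigcup_sub => j _; exact: LA.
Qed.

Lemma continuous_of_lsc (u : G -> R) (M : R) :
  lower_semicontinuous (fun y => (u y + M)%:E) ->
  lower_semicontinuous (fun y => (M - u y)%:E) -> continuous u.
Proof.
move=> l1 l2 y; apply/cvgrPdist_lt => e e0.
have [V yV V1] := l1 y (u y + M - e)%R ltac:(rewrite lte_fin; lra).
have [W yW W2] := l2 y (M - u y - e)%R ltac:(rewrite lte_fin; lra).
apply: filterS2 yV yW => z /V1 + /W2; rewrite !lte_fin => h1 h2.
by rewrite ltr_norml; apply/andP; split; lra.
Qed.

(** If [M] bounds the test function [f], semicontinuity for [f + M] and for [M - f] bounds the
    integral of [f] from both sides, because the integral of the constant [M] does not vary. The
    Radon property comes from domination. *)
Lemma continuous_probability_system_of_lsc (lambda ga : G -> borel_measure R G) :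
  continuous_system gr lambda ->
  (forall x, units gr x -> ga x setT = 1) ->
  (forall x, units gr x -> ga x (~` fiber gr x) = 0) ->
  (forall x, units gr x -> ga x `<< lambda x) ->
  (forall f : G -> \bar R, (forall z, 0 <= f z) -> lower_semicontinuous f ->
     lower_semicontinuous (fun g => \int[ga (src gr g)]_z f z)) ->
  continuous_probability_system gr ga.
Proof.
move=> clam ga1 ga0 gadom galsc; split=> //; split=> [x ux|f cf].
  have [lamr lams _ _] := clam.1 _ ux; split; last exact: ga0.
  - exact: radon_dominated lamr lams (gadom _ ux) (ga1 _ ux).
  - exists (fun=> setT); first by rewrite bigcup_const.
    by move=> _; split=> //; rewrite -ge0_fin_numE// [X in X \is a fin_num](ga1 _ ux).
  - by rewrite [X in X <> _](ga1 _ ux); apply/eqP; rewrite onee_neq0.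
have [M fM] := csc_bounded cf.
have mf : measurable_fun setT (f : borel G -> R) by apply: csc_measurable; case: cf.
have intf y : (ga (src gr y)).-integrable setT (EFin \o f).
  apply: measurable_bounded_integrable => //.
    by rewrite [X in X < _](ga1 _ (src_units gr y)) ltry.
  exists M; split; first exact: num_real.
  by move=> N MN z _; exact: le_trans (fM z) (ltW MN).
have intM y : (ga (src gr y)).-integrable setT (EFin \o cst M).
  apply: measurable_bounded_integrable => //.
    by rewrite [X in X < _](ga1 _ (src_units gr y)) ltry.
  exists `|M|%R; split; first exact: num_real.
  by move=> N MN z _; rewrite /= ltW.
have cstM y : (\int[ga (src gr y)]_z M%:E) = M%:E.
  by rewrite integral_cst// [X in _ * X](ga1 _ (src_units gr y)) mule1.
have [cf1 _] := cf.
suff cu : continuous (fun y => (\int[ga (src gr y)]_z f z)%R).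
  apply/subspace_continuousP => x ux A.
  rewrite -{1}[x](src_unit ux) => /(cu x); rewrite !nbhs_simpl /=.
  rewrite /within /=; apply: filterS => y Ay uy.
  by rewrite -[y](src_unit uy).
apply: (@continuous_of_lsc _ M).
- rewrite (_ : (fun _ => _) = fun y => \int[ga (src gr y)]_z (f z + M)%:E); last first.
    apply/funext => y; under eq_integral do rewrite EFinD.
    rewrite integralD// cstM EFinD /Rintegral fineK//.
    exact: integrable_fin_num.
  apply: galsc => [z|].
    by rewrite lee_fin; have := fM z; rewrite ler_norml => /andP[]; lra.
  by apply: lsc_EFin => z; apply: cvgD; [exact: cf1|exact: cvg_cst].
- rewrite (_ : (fun _ => _) = fun y => \int[ga (src gr y)]_z (M - f z)%:E); last first.
    apply/funext => y; under eq_integral do rewrite EFinB.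
    rewrite integralB// cstM EFinB /Rintegral fineK//.
    exact: integrable_fin_num.
  apply: galsc => [z|].
    by rewrite lee_fin; have := fM z; rewrite ler_norml => /andP[]; lra.
  by apply: lsc_EFin => z; apply: cvgB; [exact: cvg_cst|exact: cf1].
Qed.

End dominated_systems.

(** * Densities of translates and of convolutions *)

Lemma fubini_tonelli_sigma_finite d1 d2 (T1 : measurableType d1)
    (T2 : measurableType d2) (R : realType) (m1 : {measure set T1 -> \bar R})
    (m2 : {measure set T2 -> \bar R}) (f : T1 * T2 -> \bar R) :
  sigma_finite setT m1 -> sigma_finite setT m2 ->
  measurable_fun setT f -> (forall x, 0 <= f x)%E ->
  (\int[m1]_x \int[m2]_y f (x, y) = \int[m2]_y \int[m1]_x f (x, y))%E.
Proof.
move=> s1 s2 mf f0.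
pose mu1 : {sigma_finite_measure set T1 -> \bar R} := HB.pack (Measure.sort m1)
    (isSFinite.Build _ _ _ (Measure.sort m1) (sfinite_measure_sigma_finite s1))
    (isSigmaFinite.Build _ _ _ (Measure.sort m1) s1).
pose mu2 : {sigma_finite_measure set T2 -> \bar R} := HB.pack (Measure.sort m2)
    (isSFinite.Build _ _ _ (Measure.sort m2) (sfinite_measure_sigma_finite s2))
    (isSigmaFinite.Build _ _ _ (Measure.sort m2) s2).
exact: (@fubini_tonelli _ _ _ _ _ mu1 mu2 f mf f0).
Qed.

Section product_borel.
Context (G : ptopologicalType).
Hypothesis scG : @second_countable G.

(** By second countability an open set of the product is a countable union of boxes. Tonelli's
    theorem works with the product of the Borel sigma-algebras, while densities are Borel on the
    product space. *)
Lemma measurable_prod_borel : measurable_fun setT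
  (id : (borel G * borel G)%type -> borel (G * G)%type).
Proof.
have [B cB [oB bB]] := scG.
have [e eB] := countable_enum cB.
apply: (measurability _ (erefl : @measurable _ (borel (G * G)%type) = <<s @open (G * G)%type >>)).
move=> _ [W oW <-]; rewrite setTI preimage_id.
pose S (p : nat * nat) : set (borel G * borel G)%type :=
  if `[< [/\ open (e p.1), open (e p.2) & e p.1 `*` e p.2 `<=` W] >]
  then e p.1 `*` e p.2 else set0.
rewrite (_ : W = \bigcup_i \bigcup_j S (i, j)).
  apply: bigcup_measurable => i _; apply: bigcup_measurable => j _.
  rewrite /S; case: asboolP => // -[/= o1 o2 _].
  by apply: measurableX; exact: open_borel_measurable.
apply/seteqP; split=> [[x y] Wxy|p [i _ [j _]]]; last first.
  by rewrite /S; case: asboolP => // -[_ _ +]; apply.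
have : nbhs (x, y) W by apply: open_nbhs_nbhs.
move=> [[/= U V] [xU yV] UVW].
have [U' [BU' U'x] U'U] := bB _ _ xU; have [V' [BV' V'y] V'V] := bB _ _ yV.
have [i _ ei] := eB _ BU'; have [j _ ej] := eB _ BV'.
exists i => //; exists j => //; rewrite /S asboolT /= ei ej//; split=> //.
- exact: oB.
- exact: oB.
- by move=> [a b] [/U'U Ua /V'V Vb]; exact: UVW.
Qed.

End product_borel.

Section densities.
Context (R : realType) (G : ptopologicalType) (gr : groupoid G).
Hypothesis lcgG : locally_compact_groupoid gr.
Variable lambda : G -> borel_measure R G.
Hypothesis clam : continuous_system gr lambda.
Implicit Types al be : G -> borel_measure R G.
Local Open Scope ereal_scope.

(** The second clause of [adapted] with the version of the derivative named, so that its
    semicontinuity can be tracked. *)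
Definition is_density be (D : G * G -> \bar R) :=
  [/\ measurable_fun setT (D : borel (G * G)%type -> \bar R),
      forall p, 0 <= D p &
      forall (g : G) (A : set (borel G)), measurable A ->
        translate gr g (be (src gr g)) A =
        \int[lambda (tgt gr g)]_(h in A) D (g, h)].

Lemma measurable_section (D : G * G -> \bar R) (g : G) :
  measurable_fun setT (D : borel (G * G)%type -> \bar R) ->
  measurable_fun setT ((fun h => D (g, h)) : borel G -> \bar R).
Proof.
move=> mD; apply: measurableT_comp mD _.
apply: (@within_continuous_measurable G (G * G)%type _ (fun h => (g, h))).
  exact: closedT.
by apply: continuous_subspaceT => h; apply: cvg_pair => //=; exact: cvg_cst.
Qed.

(** At the unit [x] translation is the identity of the fiber, so the section of [D] at [x] is a
    density of [be x]. *)
Lemma density_dominates be D x : units gr x -> be x (~` fiber gr x) = 0 ->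
  is_density be D -> be x `<< lambda x.
Proof.
move=> ux be0 [mD D0 DE]; apply/null_content_dominatesP => A mA A0.
have mF := measurable_fiber lcgG x.
have : be x (fiber gr x `&` A) = 0.
  have := DE x A mA; rewrite src_unit// tgt_unit//.
  rewrite (null_set_integral _ _ A0)//; last first.
    by apply: measurable_funTS; exact: measurable_section.
  rewrite /translate src_unit// => <-; congr (be x _).
  apply/seteqP; split=> z [xz Az]; split=> //=.
    by rewrite /= -xz gmul_tgt.
  by move: Az; rewrite /= -xz gmul_tgt.
move=> A1; apply/eqP; rewrite eq_le measure_ge0 andbT.
rewrite -(setTI A) -(setUv (fiber gr x)) setIUl.
apply: (le_trans (measureU2 _ _ _)); [exact: measurableI|apply: measurableI => //; exact: measurableC|].
rewrite [X in X + _ <= _]A1 add0e -be0 le_measure ?inE//; [|exact: measurableC].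
by apply: measurableI => //; exact: measurableC.
Qed.

Lemma conv_density_fubini al (D : G * G -> \bar R) (g : G) (A : set (borel G)) :
  continuous_system gr al -> measurable A ->
  measurable_fun setT (D : borel (G * G)%type -> \bar R) -> (forall p, 0 <= D p) ->
  \int[al (src gr g)]_(z in fiber gr (src gr g))
    \int[lambda (tgt gr g)]_(h in A) D (gmul gr g z, h) =
  \int[lambda (tgt gr g)]_(h in A)
    \int[al (src gr g)]_(z in fiber gr (src gr g)) D (gmul gr g z, h).
Proof.
move=> cal mA mD D0.
have [_ sal _ _] := cal.1 _ (src_units gr g).
have [_ slam _ _] := clam.1 _ (tgt_units gr g).
have mF := measurable_fiber lcgG (src gr g).
(* Off the fiber [m] takes the default value [point]; [F] vanishes there, so this value is never
   read. *)
pose m : borel G -> borel G := (gmul gr g : borel G -> borel G) \_ (fiber gr (src gr g)).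
have mm : measurable_fun setT m.
  by apply/(measurable_restrictT _ _).1 => //; exact: measurable_gmul.
pose F : (borel G * borel G)%type -> \bar R :=
  (fun p => D (m p.1, p.2)) \_ (fiber gr (src gr g) `*` A).
have mFF : measurable_fun setT F.
  apply/(measurable_restrictT _ _).1; first exact: measurableX.
  apply: measurable_funTS.
  have mp : measurable_fun setT
      ((fun p => (m p.1, p.2)) : (borel G * borel G)%type -> (borel G * borel G)%type).
    by apply: measurable_fun_pair => //; exact: measurableT_comp.
  have scG := lcg_second_countable lcgG.
  exact: (measurableT_comp mD (measurableT_comp (measurable_prod_borel scG) mp)).
have F0 p : 0 <= F p by rewrite /F patchE; case: ifP.
have := fubini_tonelli_sigma_finite sal slam mFF F0.
have FE z h : z \in fiber gr (src gr g) -> h \in A -> F (z, h) = D (gmul gr g z, h).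
  move=> zF hA; rewrite /F patchE mem_set; last by split; exact: set_mem.
  by rewrite /= /m patchE zF.
have F0z z h : z \notin fiber gr (src gr g) -> F (z, h) = 0.
  by move=> zF; rewrite /F patchE memNset// => -[/= /mem_set]; rewrite (negbTE zF).
have F0h z h : h \notin A -> F (z, h) = 0.
  by move=> hA; rewrite /F patchE memNset// => -[/= _ /mem_set]; rewrite (negbTE hA).
rewrite (_ : \int[_]_x \int[_]_y F (x, y) = \int[al (src gr g)]_(z in fiber gr (src gr g))
    \int[lambda (tgt gr g)]_(h in A) D (gmul gr g z, h)); last first.
  rewrite [RHS]integral_mkcond; apply: eq_integral => z _; rewrite patchE.
  case: ifPn => zF; last by apply: integral0_eq => h _; exact: F0z.
  rewrite [RHS]integral_mkcond; apply: eq_integral => h _; rewrite patchE.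
  by case: ifPn => hA; [exact: FE|exact: F0h].
rewrite (_ : \int[_]_y \int[_]_x F (x, y) = \int[lambda (tgt gr g)]_(h in A)
    \int[al (src gr g)]_(z in fiber gr (src gr g)) D (gmul gr g z, h))//.
rewrite [RHS]integral_mkcond; apply: eq_integral => h _; rewrite patchE.
case: ifPn => hA; last by apply: integral0_eq => z _; exact: F0h.
rewrite [RHS]integral_mkcond; apply: eq_integral => z _; rewrite patchE.
by case: ifPn => zF; [exact: FE|exact: F0z].
Qed.

Section convolution_density.
Context (al be ga : G -> borel_measure R G) (D : G * G -> \bar R).
Hypothesis cal : continuous_probability_system gr al.
Hypothesis cbe : continuous_probability_system gr be.
Hypothesis gaE : forall x f, measurable_fun setT f -> (forall z, 0 <= f z) ->
    \int[ga x]_z f z = \int[al x]_z conv_op gr be f z.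
Hypothesis beD : is_density be D.

(** By associativity the translate of the convolution by [g] is a mixture of the translates of [be]
    by the products [gmul gr g z]; their densities are averaged accordingly. *)
Definition conv_density (p : G * G) : \bar R :=
  \int[al (src gr p.1)]_(z in fiber gr (src gr p.1)) D (gmul gr p.1 z, p.2).

Let X : set ((G * G) * G) := [set q | src gr q.1.1 = tgt gr q.2].

Let closedX : closed X.
Proof.
apply: (@closed_eq _ _ lcgG _ (src gr \o fst \o fst) (tgt gr \o snd)) => p.
- apply: continuous_comp; first exact: cvg_fst.
  by apply: continuous_comp; [exact: cvg_fst|exact: lcg_src].
- by apply: continuous_comp; [exact: cvg_snd|exact: lcg_tgt].
Qed.

Let phi (q : (G * G) * G) : G * G := (gmul gr q.1.1 q.2, q.1.2).

Let continuous_phi : {within X, continuous phi}.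
Proof.
apply/subspace_continuousP => -[[g h] z] gz; apply: cvg_pair => /=; last first.
  apply: cvg_within_filter.
  by apply: (@cvg_comp _ _ _ fst snd); [exact: cvg_fst|exact: cvg_snd].
have /subspace_continuousP/(_ (g, z) gz) /= cm := lcg_gmul lcgG.
move=> A /cm; rewrite !nbhs_simpl /= => -[[U V] /= [gU zV] UV].
exists (U `*` setT, V); first by split=> //; exists (U, setT) => //=; split=> //; exact: filterT.
by move=> [[a b] c] [[/= Ua _] Vc] ac; apply: (UV (a, c)).
Qed.

Let conv_densityE p (f : (G * G) * G -> \bar R) :
  (forall q, X q -> f q = D (phi q)) ->
  conv_density p =
    \int[al (src gr p.1)]_(z in fiber gr (src gr p.1)) f (p, z).
Proof.
move=> fD; apply: eq_integral => z; rewrite inE => pz.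
by rewrite fD.
Qed.

Lemma conv_densityP : is_density ga conv_density.
Proof.
have [mD D0 DE] := beD.
have cq : continuous (src gr \o fst : G * G -> G).
  by move=> p; apply: continuous_comp; [exact: cvg_fst|exact: lcg_src].
split.
- pose k : borel ((G * G) * G)%type -> \bar R := (D \o phi) \_ X.
  have mk : measurable_fun setT k.
    apply/(measurable_restrictT _ _).1.
      exact: (closed_borel_measurable (T := ((G * G) * G)%type) closedX).
    apply: (measurableT_comp mD).
    exact: (@within_continuous_measurable ((G * G) * G)%type (G * G)%type).
  rewrite (_ : conv_density = fun p =>
      \int[al (src gr p.1)]_(z in fiber gr (src gr p.1)) k (p, z)); last first.
    by apply/funext => p; apply: conv_densityE => q Xq; rewrite /k patchE mem_set.
  apply: (measurable_integral_fiber lcgG cq _ cal) => //.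
  + by move=> p; exact: src_units.
  + by move=> p; rewrite /k patchE; case: ifP => // _; exact: D0.
- by move=> p; exact: integral_ge0.
- move=> g A mA; rewrite translateE// (conv_op_convolution lcgG cal cbe gaE)//; last first.
    exact: measurable_EFin_indic.
  rewrite -conv_density_fubini//; last exact: cal.1.
  apply: eq_integral => z; rewrite inE => gz.
  rewrite -translateE// DE// tgt_gmul//.
Qed.

(** Regularity is inherited from the right factor [be] alone. This is how an arbitrary system [al]
    acquires a semicontinuous density. *)
Lemma lsc_conv_density : lower_semicontinuous D ->
  lower_semicontinuous conv_density.
Proof.
move=> lD; have [_ D0 _] := beD.
have cq : continuous (src gr \o fst : G * G -> G).
  by move=> p; apply: continuous_comp; [exact: cvg_fst|exact: lcg_src].
pose k := patch (cst +oo) X (D \o phi).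
rewrite (_ : conv_density = fun p =>
    \int[al (src gr p.1)]_(z in fiber gr (src gr p.1)) k (p, z)); last first.
  by apply/funext => p; apply: conv_densityE => q Xq; rewrite /k /patch mem_set.
apply: (lsc_integral_fiber lcgG cq _ cal.1).
- by move=> p; exact: src_units.
- by move=> p; rewrite /k /patch; case: ifP => _ /=; [exact: D0|exact: leey].
- exact: lsc_patch.
Qed.

Lemma convolution_system : continuous_probability_system gr ga.
Proof.
apply: (continuous_probability_system_of_lsc lcgG clam).
- exact: (convolution_setT lcgG cal cbe gaE).
- exact: (convolution_fiber lcgG cal cbe gaE).
- move=> x ux; apply: (density_dominates ux _ conv_densityP).
  exact: (convolution_fiber lcgG cal cbe gaE).
- exact: (lsc_convolution lcgG cal cbe gaE).
Qed.

End convolution_density.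

End densities.

(** * Infinite convex combinations of adapted systems *)

Section mixtures.
Context (R : realType) (G : ptopologicalType) (gr : groupoid G).
Hypothesis lcgG : locally_compact_groupoid gr.
Variable lambda : G -> borel_measure R G.
Hypothesis clam : continuous_system gr lambda.
Implicit Types al be : G -> borel_measure R G.
Local Open Scope ereal_scope.

Definition adapted_system be :=
  continuous_probability_system gr be /\ adapted gr lambda be.

Lemma adapted_system_density be : adapted_system be ->
  exists D, is_density gr lambda be D.
Proof. by move=> [_ [_ [D [mD D0 DE]]]]; exists D; split. Qed.

Lemma adapted_systemP be D : continuous_probability_system gr be ->
  is_density gr lambda be D -> adapted_system be.
Proof.
move=> cbe bD; split=> //; split.
  move=> x ux; apply: (density_dominates lcgG ux _ bD).
  by have [_ _ _ ->] := cbe.1.1 _ ux.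
by exists D; case: bD.
Qed.

Lemma lsc_integral_system al (f : G -> \bar R) : continuous_system gr al ->
  (forall z, 0 <= f z) -> lower_semicontinuous f ->
  lower_semicontinuous (fun y => \int[al (src gr y)]_z f z).
Proof.
move=> cal f0 lf; rewrite (_ : (fun _ => _) = conv_op gr al f \o src gr).
  by apply: lsc_comp; [exact: lcg_src|exact: lsc_conv_op].
apply/funext => y /=; rewrite (unit_conv_op lcgG cal) => //.
  exact: src_units.
exact: lsc_measurable.
Qed.

Section mixture.
Context (c : nat -> R) (al : nat -> G -> borel_measure R G).
Hypothesis c0 : forall n, (0 <= c n)%R.
Hypothesis c1 : \sum_(n <oo) (c n)%:E = 1.
Hypothesis alP : forall n, adapted_system (al n).

(** Uniform convergence is avoided: a series of nonnegative lower semicontinuous functions is lower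
    semicontinuous, and total mass 1 upgrades this to continuity. *)
Lemma mixture_system : exists ga, adapted_system ga /\
  forall x f, measurable_fun setT f -> (forall z, 0 <= f z) ->
    \int[ga x]_z f z = \sum_(n <oo) (c n)%:E * \int[al n x]_z f z.
Proof.
pose m x n : borel_measure R G := mscale (NngNum (c0 n)) (al n x).
pose ga x : borel_measure R G := mseries (m x) 0.
have gaE x A : ga x A = \sum_(n <oo) (c n)%:E * al n x A by [].
have gaf x (f : borel G -> \bar R) : measurable_fun setT f -> (forall z, 0 <= f z) ->
    \int[ga x]_z f z = \sum_(n <oo) (c n)%:E * \int[al n x]_z f z.
  move=> mf f0; rewrite ge0_integral_measure_series//.
  by apply: eq_eseriesr => n _; rewrite ge0_integral_mscale.
have /choice[D DP] : forall n, exists D, is_density gr lambda (al n) D.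
  by move=> n; exact: adapted_system_density.
pose E p := \sum_(n <oo) (c n)%:E * D n p.
have ED : is_density gr lambda ga E.
  split.
  - apply: ge0_emeasurable_sum => n.
      by move=> p _ _; rewrite mule_ge0 ?lee_fin//; case: (DP n).
    by move=> _; apply: measurable_funeM; case: (DP n).
  - move=> p; apply: nneseries_ge0 => n _ _.
    by rewrite mule_ge0 ?lee_fin//; case: (DP n).
  - move=> g A mA; rewrite /translate gaE integral_nneseries//; last 2 first.
    + move=> n; apply: measurable_funTS; apply: measurable_funeM.
      by apply: measurable_section; case: (DP n).
    + by move=> n h _; rewrite mule_ge0 ?lee_fin//; case: (DP n).
    apply: eq_eseriesr => n _; have [mD D0 DE] := DP n.
    rewrite ge0_integralZl ?lee_fin//; last first.
      by apply: measurable_funTS; exact: measurable_section.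
    by rewrite -DE.
exists ga; split; last exact: gaf.
apply: (adapted_systemP _ ED).
have ga0 x : units gr x -> ga x (~` fiber gr x) = 0.
  move=> ux; rewrite gaE eseries0// => n _ _.
  by have [[[/(_ _ ux)[_ _ _ ->] _] _] _] := alP n; rewrite mule0.
apply: (continuous_probability_system_of_lsc lcgG clam) => //.
- move=> x ux; rewrite gaE -c1; apply: eq_eseriesr => n _.
  by have [[_ /(_ _ ux) ->] _] := alP n; rewrite mule1.
- by move=> x ux; apply: (density_dominates lcgG ux _ ED); exact: ga0.
- move=> f f0 lf.
  have mf : measurable_fun setT (f : borel G -> \bar R) by exact: lsc_measurable.
  rewrite (_ : (fun _ => _) = fun g =>
      \sum_(n <oo) (c n)%:E * \int[al n (src gr g)]_z f z); last first.
    by apply/funext => g; rewrite gaf.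
  apply: lsc_nneseries => n.
    by move=> g; rewrite mule_ge0 ?lee_fin//; exact: integral_ge0.
  apply: lscM => //.
  + by move=> x; rewrite lee_fin.
  + by move=> x; exact: integral_ge0.
  + exact: lsc_cst.
  + by apply: lsc_integral_system => //; case: (alP n) => -[].
Qed.

End mixture.

Lemma conv_op_mixture (c : nat -> R) (al : nat -> G -> borel_measure R G)
    (ga : G -> borel_measure R G) :
  (forall x f, measurable_fun setT f -> (forall z, 0 <= f z) ->
    \int[ga x]_z f z = \sum_(n <oo) (c n)%:E * \int[al n x]_z f z) ->
  forall (f : borel G -> \bar R) g, measurable_fun setT f -> (forall z, 0 <= f z) ->
    conv_op gr ga f g = \sum_(n <oo) (c n)%:E * conv_op gr (al n) f g.
Proof.
move=> gaE f g mf f0; rewrite /conv_op integral_mkcond gaE; last 2 first.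
- apply/(measurable_restrictT _ _).1; first exact: measurable_fiber.
  exact: measurable_gmul_comp.
- by move=> z; rewrite patchE; case: ifP.
by apply: eq_eseriesr => n _; rewrite -integral_mkcond.
Qed.

Lemma convolution_adapted al be : adapted_system al -> adapted_system be ->
  exists2 ga, adapted_system ga & forall (f : borel G -> \bar R) g,
    measurable_fun setT f -> (forall z, 0 <= f z) ->
    conv_op gr ga f g = conv_op gr al (conv_op gr be f) g.
Proof.
move=> [cal _] bP; have [D DP] := adapted_system_density bP.
have [cbe _] := bP; have [ga gaE] := convolution_exists lcgG al cbe.
exists ga; last by move=> f g mf f0; exact: (conv_op_convolution lcgG cal cbe gaE).
apply: (adapted_systemP _ (conv_densityP lcgG clam cal cbe gaE DP)).
exact: (convolution_system lcgG clam cal cbe gaE DP).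
Qed.

End mixtures.

(** * A reference system with a positive lower semicontinuous density *)

Section positive_functions.
Context d (T : measurableType d) (R : realType).
Local Open Scope ereal_scope.

Lemma half_series n : \sum_(n <= k <oo) (2 ^- k.+1 : R)%:E = (2 ^- n : R)%:E.
Proof.
rewrite -nneseries_addn => [|k]; last by rewrite lee_fin invr_ge0 exprn_ge0.
apply/cvg_lim => //.
rewrite (_ : (fun m => _) = EFin \o series (fun k => 1 / (2 ^ (k + n.+1))%:R : R)%R); last first.
  apply/funext => m /=; rewrite -sumEFin; apply: eq_bigr => k _.
  by rewrite div1r natrX addnS.
apply: cvg_comp; first exact: (@cvg_geometric_series_half R 1 n).
by rewrite div1r.
Qed.

Lemma positive_integral_eq0 (mu : {measure set T -> \bar R}) (A : set T)
    (f : T -> \bar R) : measurable A -> measurable_fun A f ->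
  (forall x, A x -> 0 < f x) -> \int[mu]_(x in A) f x = 0 -> mu A = 0.
Proof.
move=> mA mf f0 If.
have /(ae_eq_integral_abs mu mA mf)[N [mN N0 AN]] : \int[mu]_(x in A) `|f x| = 0.
  by rewrite -[RHS]If; apply: eq_integral => x; rewrite inE => /f0 /ltW/gee0_abs.
apply: (subset_measure0 mA mN _ N0) => x Ax; apply: AN => /= /(_ Ax) fx.
by have := f0 x Ax; rewrite fx ltxx.
Qed.

End positive_functions.

Section reference_system.
Context (R : realType) (G : ptopologicalType) (gr : groupoid G).
Hypothesis lcgG : locally_compact_groupoid gr.
Variable lambda : G -> borel_measure R G.
Hypothesis haar : left_haar_system gr lambda.
Local Open Scope ereal_scope.

Let clam := haar.1.

Lemma haar_integral g (f : borel G -> \bar R) : measurable_fun setT f ->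
  (forall z, 0 <= f z) ->
  \int[lambda (tgt gr g)]_h f h =
  \int[lambda (src gr g)]_(z in fiber gr (src gr g)) f (gmul gr g z).
Proof.
move=> mf f0; have [nu [nuA nuf]] := translate_measure lcgG g (lambda (src gr g)).
rewrite -nuf//; apply: eq_measure_integral => A mA _.
by rewrite -haar.2// nuA.
Qed.

Lemma gmulKV g z : src gr g = tgt gr z -> gmul gr (ginv gr g) (gmul gr g z) = z.
Proof. by move=> gz; rewrite gmulA ?src_ginv// gmulVg gz gmul_tgt. Qed.

(* Weighting the bump functions by [1 / (1 + lambda^x(phi_j))] makes the series
   of their integrals converge uniformly in [x], so that its sum is continuous. *)
Lemma positive_lsc_density : exists r : G -> \bar R,
  [/\ lower_semicontinuous r, forall z, 0 < r z &
    forall x, units gr x -> \int[lambda x]_z r z = 1].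
Proof.
have [phi [cphi phi01 phiV]] := bump_family R (lcg_locally_compact lcgG)
  (lcg_hausdorff lcgG) (lcg_second_countable lcgG).
have phi0 j z : (0 <= phi j z)%R by case/andP: (phi01 j z).
have cphi1 j : continuous (phi j) by case: (cphi j).
pose a j (z : G) : R := (\int[lambda (tgt gr z)]_h phi j h)%R.
have ca j : continuous (a j).
  exact: (vague_continuous_comp (lcg_tgt lcgG) (tgt_units gr) clam (cphi j)).
have a0 j z : (0 <= a j z)%R by apply: Rintegral_ge0 => h _; exact: phi0.
have aE j z : \int[lambda (tgt gr z)]_h (phi j h)%:E = (a j z)%:E.
  rewrite /a /Rintegral fineK//; apply: integrable_fin_num => //.
  exact: (csc_integrable clam (tgt_units gr z) (cphi j)).
have a1 j z : (0 < 1 + a j z)%R by rewrite ltr_pwDl.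
pose F j z : R := (2 ^- j.+1 * (phi j z / (1 + a j z)))%R.
have F0 j z : (0 <= F j z)%R by rewrite mulr_ge0// divr_ge0// ltW.
have cF j : continuous (F j).
  move=> z; apply: cvgM; first exact: cvg_cst.
  apply: cvgM; first exact: cphi1.
  apply: cvgV; first by rewrite gt_eqF.
  by apply: cvgD; [exact: cvg_cst|exact: ca].
pose F0s z := \sum_(j <oo) (F j z)%:E.
have lF0s : lower_semicontinuous F0s.
  by apply: lsc_nneseries => [j z|j]; [rewrite lee_fin|exact: lsc_EFin].
have F0s_gt0 z : 0 < F0s z.
  have [n [phin _]] := phiV z setT filterT.
  rewrite (@lt_le_trans _ _ (F n z)%:E)//.
    by rewrite lte_fin /F phin div1r mulr_gt0 ?invr_gt0 ?exprn_gt0.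
  rewrite /F0s (nneseriesD1 (n := n))// => [|k _]; last by rewrite lee_fin.
  by rewrite leeDl// nneseries_ge0// => k _ _; rewrite lee_fin.
pose u j z : R := (a j z / (1 + a j z))%R.
have u01 j z : (0 <= u j z <= 1)%R.
  by rewrite divr_ge0 ?(ltW (a1 _ _))//= ler_pdivrMr// mul1r lerDr.
have cu j : continuous (u j).
  move=> z; apply: cvgM; first exact: ca.
  apply: cvgV; first by rewrite gt_eqF.
  by apply: cvgD; [exact: cvg_cst|exact: ca].
pose C z := \sum_(j <oo) (2 ^- j.+1 * u j z)%:E.
(* The complementary series: [C] and [C'] are both lower semicontinuous and add up to 1, which
   forces [C] to be continuous. *)
pose C' z := \sum_(j <oo) (2 ^- j.+1 * (1 - u j z))%:E.
have C0 z : 0 <= C z.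
  by apply: nneseries_ge0 => j _ _; rewrite lee_fin mulr_ge0//; case/andP: (u01 j z).
have C'0 z : 0 <= C' z.
  by apply: nneseries_ge0 => j _ _; rewrite lee_fin mulr_ge0// subr_ge0; case/andP: (u01 j z).
have CC' z : C z + C' z = 1.
  rewrite /C /C' -nneseriesD; last 2 first.
  - by move=> j _ _; rewrite lee_fin mulr_ge0//; case/andP: (u01 j z).
  - by move=> j _ _; rewrite lee_fin mulr_ge0// subr_ge0; case/andP: (u01 j z).
  rewrite -[RHS](_ : (2 ^- 0)%:E = 1); last by rewrite expr0 invr1.
  rewrite -half_series; apply: eq_eseriesr => j _.
  by rewrite -EFinD -mulrDr addrC subrK mulr1.
have lC : lower_semicontinuous C.
  apply: lsc_nneseries => [j z|j].
    by rewrite lee_fin mulr_ge0//; case/andP: (u01 j z).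
  by apply: lsc_EFin => z; apply: cvgM; [exact: cvg_cst|exact: cu].
have lC' : lower_semicontinuous C'.
  apply: lsc_nneseries => [j z|j].
    by rewrite lee_fin mulr_ge0// subr_ge0; case/andP: (u01 j z).
  apply: lsc_EFin => z; apply: cvgM; first exact: cvg_cst.
  by apply: cvgB; [exact: cvg_cst|exact: cu].
have Cfin z : C z \is a fin_num.
  by rewrite ge0_fin_numE// (@le_lt_trans _ _ 1) ?ltry// -(CC' z) leeDl.
have C'E z : C' z = 1 - C z by rewrite -(CC' z) addeAC subee// add0e.
pose c z := fine (C z).
have cc : continuous c.
  apply: (@continuous_of_lsc _ _ _ 1).
    rewrite (_ : (fun _ => _) = fun z => C z + 1); last first.
      by apply/funext => z; rewrite EFinD fineK.
    apply: lscD => //; exact: lsc_cst.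
  rewrite (_ : (fun _ => _) = C')//.
  by apply/funext => z; rewrite EFinB fineK// C'E.
have IF x : units gr x -> \int[lambda x]_z F0s z = C x.
  move=> ux; rewrite (integral_setT_fiber lcgG ux clam); last 2 first.
  - exact: lsc_measurable.
  - by move=> z; exact: ltW.
  rewrite integral_nneseries//; last 3 first.
  - exact: measurable_fiber.
  - by move=> j; apply: lsc_measurable; exact: lsc_EFin.
  - by move=> j z _; rewrite lee_fin.
  apply: eq_eseriesr => j _.
  rewrite (eq_integral (fun z : borel G => (2 ^- j.+1 / (1 + a j x))%:E * (phi j z)%:E)); last first.
    move=> z; rewrite inE => xz; rewrite -EFinM /F /a xz tgt_unit//.
    by congr EFin; ring.
  rewrite ge0_integralZl//; last 4 first.
  - exact: measurable_fiber.
  - exact: csc_measurable_EFin.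
  - by move=> z _; rewrite lee_fin.
  - by rewrite lee_fin divr_ge0// ltW.
  rewrite -(integral_setT_fiber lcgG ux clam); last 2 first.
  - exact: csc_measurable_EFin.
  - by move=> z; rewrite lee_fin.
  have := aE j x; rewrite tgt_unit// => ->; rewrite -EFinM /u; congr EFin; ring.
have c0 z : (0 < c z)%R.
  have Cz : C z = C (tgt gr z).
    by apply: eq_eseriesr => j _; rewrite /u /a (tgt_unit (tgt_units gr z)).
  rewrite lt_neqAle fine_ge0// andbT; apply/eqP => cz.
  have : \int[lambda (tgt gr z)]_y F0s y = 0.
    rewrite (IF _ (tgt_units gr z)) -Cz -[LHS]fineK//.
    by congr EFin; rewrite -/(c z) -cz.
  move=> /positive_integral_eq0 H.
  have [_ _ + _] := clam.1 _ (tgt_units gr z); apply; apply: H => //.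
  exact: lsc_measurable.
(* [c] is continuous, positive and constant on fibers, so dividing by it normalizes the integrals
   and preserves semicontinuity. *)
exists (fun z => F0s z * ((c z)^-1)%:E); split.
- apply: lscM => //.
  + by move=> z; exact: ltW.
  + by move=> z; rewrite lee_fin invr_ge0 ltW.
  + by apply: lsc_EFin => z; apply: cvgV; [rewrite gt_eqF|exact: cc].
- by move=> z; rewrite mule_gt0// lte_fin invr_gt0.
- move=> x ux.
  have mF0s D : measurable_fun D (F0s : borel G -> \bar R) by exact: lsc_measurable.
  rewrite (integral_setT_fiber lcgG ux clam); last 2 first.
  + apply: emeasurable_funM => //; apply: lsc_measurable.
    by apply: lsc_EFin => z; apply: cvgV; [rewrite gt_eqF|exact: cc].
  + by move=> z; apply: mule_ge0; [exact: ltW|rewrite lee_fin invr_ge0 ltW].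
  rewrite (eq_integral (fun z : borel G => ((c x)^-1)%:E * F0s z)); last first.
    move=> z; rewrite inE => xz; rewrite muleC; congr (_^-1%:E * _).
    by rewrite /c; congr fine; apply: eq_eseriesr => j _; rewrite /u /a xz tgt_unit.
  rewrite ge0_integralZl//; last 3 first.
  + exact: measurable_fiber.
  + by move=> z _; exact: ltW.
  + by rewrite lee_fin invr_ge0 ltW.
  rewrite -(integral_setT_fiber lcgG ux clam)//; last by move=> z; exact: ltW.
  by rewrite IF// -[X in _ * X]fineK// -EFinM mulVf// gt_eqF.
Qed.

End reference_system.

Section reference_system.
Context (R : realType) (G : ptopologicalType) (gr : groupoid G).
Hypothesis lcgG : locally_compact_groupoid gr.
Variable lambda : G -> borel_measure R G.
Hypothesis haar : left_haar_system gr lambda.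
Local Open Scope ereal_scope.

Let clam := haar.1.

(** By left invariance, the translate by [g] of the measure with density [r] has density
    [r (g^-1 h)] at [h]. Off the fiber of [tgt gr g], a null set, the value +oo preserves
    semicontinuity. *)
Definition translated_density (r : G -> \bar R) : G * G -> \bar R :=
  patch (cst +oo) [set p | tgt gr p.1 = tgt gr p.2]
    (r \o (fun p => gmul gr (ginv gr p.1) p.2)).

Lemma lsc_translated_density r : lower_semicontinuous r ->
  lower_semicontinuous (translated_density r).
Proof.
move=> lr; apply: lsc_patch => //.
  apply: (@closed_eq _ _ lcgG _ (tgt gr \o fst) (tgt gr \o snd)) => p.
  - by apply: continuous_comp; [exact: cvg_fst|exact: lcg_tgt].
  - by apply: continuous_comp; [exact: cvg_snd|exact: lcg_tgt].
apply/subspace_continuousP => -[g h] /= gh A.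
have /subspace_continuousP/(_ (ginv gr g, h)) := lcg_gmul lcgG.
rewrite /composable /= src_ginv => /(_ gh) cm /cm.
rewrite !nbhs_simpl /= => -[[U V] /= [gU hV] UV].
exists (ginv gr @^-1` U, V); first by split=> //; exact: lcg_ginv.
by move=> [a b] /= [Ua Vb] ab; apply: (UV (ginv gr a, b)) => //; rewrite /composable /= src_ginv.
Qed.

(** Used in both directions: the semicontinuous density regularizes the Reiter systems, and the
    positivity of [r] provides on each fiber a probability measure with the null sets of
    [lambda]. *)
Lemma reference_system : exists rho D,
  [/\ adapted_system gr lambda rho, is_density gr lambda rho D,
      lower_semicontinuous D &
      forall x, units gr x -> lambda x `<< rho x].
Proof.
have [r [lr r_gt0 r1]] := positive_lsc_density lcgG haar.
have mr (A : set (borel G)) : measurable_fun A (r : borel G -> \bar R) by exact: lsc_measurable.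
have r0 z : 0 <= r z by exact: ltW.
have /choice[rho rhoE] : forall x, exists nu : borel_measure R G,
    forall A, measurable A -> nu A = \int[lambda x]_(z in A) r z.
  by move=> x; exact: density_measure_exists.
have lD := lsc_translated_density lr.
have D0 p : 0 <= translated_density r p.
  by rewrite /translated_density /patch; case: ifP => _ /=; [exact: r0|exact: leey].
have rhoD : is_density gr lambda rho (translated_density r).
  split=> //; first exact: (@lsc_measurable _ (G * G)%type).
  move=> g A mA.
  have mD : measurable_fun setT ((fun h => translated_density r (g, h)) : borel G -> \bar R).
    by apply: lsc_measurable; exact: lsc_section.
  have mgA : measurable (fiber gr (src gr g) `&` gmul gr g @^-1` A : set (borel G)).
    have mgm : measurable_fun (fiber gr (src gr g) : set (borel G))
      (gmul gr g : borel G -> borel G) by exact: measurable_gmul.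
    exact: mgm (measurable_fiber lcgG _) _ mA.
  rewrite /translate rhoE// [RHS]integral_mkcond (haar_integral lcgG haar); last 2 first.
  - by apply/(measurable_restrictT _ _).1 => //; exact: measurable_funTS.
  - by move=> z; rewrite patchE; case: ifP.
  rewrite integral_mkcond [RHS]integral_mkcond; apply: eq_integral => z _.
  rewrite !patchE in_setI; case: ifPn => /= [/andP[zF]|].
    rewrite zF => zA; rewrite (_ : (gmul gr g z \in A) = true)//.
    move: zF; rewrite inE => zF; rewrite /translated_density /patch mem_set.
      by rewrite /= gmulKV.
    by rewrite /= tgt_gmul.
  rewrite negb_and => /orP[/negbTE -> //|zA]; case: ifP => // _.
  by rewrite (_ : (gmul gr g z \in A) = false)//; exact/negbTE.
have rho0 x : units gr x -> rho x (~` fiber gr x) = 0.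
  move=> ux; rewrite rhoE; last by apply: measurableC; exact: measurable_fiber.
  apply: null_set_integral => //; first exact: measurableC (measurable_fiber lcgG x).
  by have [_ _ _] := clam.1 _ ux.
exists rho, (translated_density r); split=> //.
- apply: (adapted_systemP lcgG _ rhoD).
  apply: (continuous_probability_system_of_lsc lcgG clam) => //.
  + by move=> x ux; rewrite rhoE// r1.
  + by move=> x ux; apply: (density_dominates lcgG ux _ rhoD); exact: rho0.
  + move=> f f0 lf.
    have mf : measurable_fun setT (f : borel G -> \bar R) by exact: lsc_measurable.
    rewrite (_ : (fun _ => _) = fun y => \int[lambda (src gr y)]_z (f z * r z)); last first.
      apply/funext => y.
      exact: (integral_density (mr setT) r0 (rhoE (src gr y)) mf f0).
    apply: (lsc_integral_system lcgG clam).
      by move=> z; rewrite mule_ge0.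
    exact: lscM.
- move=> x ux; apply/null_content_dominatesP => A mA.
  rewrite [X in X = _ -> _](rhoE x A mA) => A0.
  exact: (positive_integral_eq0 mA (mr A) (fun z _ => r_gt0 z) A0).
Qed.

End reference_system.

(** * Simons' argument: from pointwise to uniform smallness *)

Section simons.
Context (R : realType) (X : topologicalType).

Lemma usc_attains_max (K : set X) (g : X -> R) : compact K -> K !=set0 ->
  (forall a, open [set x | g x < a]) -> (exists M, forall x, g x <= M) ->
  exists2 y, K y & forall x, K x -> g x <= g y.
Proof.
move=> cK [x0 Kx0] ug [M gM].
have hs : has_sup (g @` K).
  by split; [exists (g x0), x0|exists M => _ [x _ <-]].
apply: contrapT => /forall2NP noy.
have gS x : K x -> g x < sup (g @` K).
  move=> Kx; rewrite lt_neqAle; apply/andP; split; last first.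
    by apply: (ub_le_sup hs.2); exists x.
  have [//|gx] := noy x; apply: contra_notN gx => /eqP -> z Kz.
  by apply: (ub_le_sup hs.2); exists z.
have : \forall n \near \oo, K `<=` [set x | g x < sup (g @` K) - n.+1%:R^-1].
  apply: ((compact_near_coveringP K).1 cK nat \oo
    (fun n x => g x < sup (g @` K) - n.+1%:R^-1)) => x Kx.
  have [n0 n0S] := ltr_add_invr (gS x Kx).
  have xn0 : \forall z \near x, g z < sup (g @` K) - n0.+1%:R^-1.
    by apply: open_nbhs_nbhs; split; [exact: ug|rewrite /= ltrBrDr].
  exists ([set z | g z < sup (g @` K) - n0.+1%:R^-1], [set n | (n0 <= n)%N]).
    by split=> //; exists n0.
  move=> [z n] /= [gz n0n]; rewrite (lt_le_trans gz)// lerD2l lerN2.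
  by rewrite lef_pV2 ?posrE// ler_nat ltnS.
move=> [n _ /(_ n (leqnn n)) /= Kn].
have : sup (g @` K) <= sup (g @` K) - n.+1%:R^-1.
  by apply: ge_sup; [exists (g x0), x0|move=> _ [x /Kn /= /ltW ? <-]].
by rewrite lerBrDr gerDl invr_le0 lern0.
Qed.

(* Simons' argument: the [g_ m] nearly minimize the supremum of the partial sums
   [sum_(j <= m) 2^-(j+1) g_ j]. At a point [y] where the full sum attains its
   supremum [S], all the tails of the sum must then be at least [S] up to [d]. *)
Lemma sigma_convex_small (K : set X) (C : nat -> set (X -> R)) (M : R) :
  compact K -> (forall m, C m.+1 `<=` C m) -> (forall m, C m !=set0) ->
  (forall m g, C m g -> forall x, 0 <= g x <= M) ->
  (forall m g, C m g -> forall a, open [set x | g x < a]) ->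
  (forall m (g_ : nat -> X -> R), (forall j, C m (g_ j)) ->
     exists2 g, C m g &
       forall x, (g x)%:E = (\sum_(j <oo) (2 ^- j.+1 * g_ j x)%:E)%E) ->
  (forall x e, 0 < e -> exists m, forall g, C m g -> g x <= e) ->
  forall e, 0 < e -> exists2 g, C 0%N g & forall x, K x -> g x <= e.
Proof.
move=> cK Cd C0 Cb Cu Cs Cp e e0.
have [K0|/negP/negP/set0P Kn] := eqVneq K set0.
  by have [g Cg] := C0 0%N; exists g => // x; rewrite K0.
have [x0 Kx0] := Kn.
pose S (h : X -> R) := sup (h @` K).
(* One half of [e] will bound the value of a tail at the maximum point, the other half the
   accumulated errors of the near-minimizations. *)
pose d := e / 2.
have d0 : 0 < d by rewrite divr_gt0.
pose bnd (h : X -> R) := exists B, forall x, `|h x| <= B.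
have leS h x : bnd h -> K x -> h x <= S h.
  move=> [B hB] Kx; apply: ub_le_sup; last by exists x.
  by exists B => _ [z _ <-]; rewrite (le_trans (ler_norm _)).
have Sle h a : (forall x, K x -> h x <= a) -> S h <= a.
  by move=> ha; apply: ge_sup; [exists (h x0), x0|move=> _ [x Kx <-]; exact: ha].
have Cbnd m g : C m g -> bnd g.
  move=> Cg; exists M => x; have /andP[g0 gM] := Cb _ _ Cg x.
  by rewrite ger0_norm.
have bndD h g (c : R) : bnd h -> bnd g -> bnd (fun x => h x + c * g x).
  move=> [B hB] [B' gB]; exists (B + `|c| * B') => x.
  by rewrite (le_trans (ler_normD _ _))// lerD// normrM ler_wpM2l.
(* The choice is made for every index and every partial sum beforehand, so that the recursion
   defining [H] can call it. The tolerance decays like 4^-m because the gap will be divided by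
   2^-m. *)
have pickP (p : nat * (X -> R)) : exists g, C p.1 g /\ (bnd p.2 ->
    forall g', C p.1 g' -> S (fun x => p.2 x + 2 ^- p.1.+1 * g x) <=
      S (fun x => p.2 x + 2 ^- p.1.+1 * g' x) + d * 4 ^- p.1.+1).
  case: p => m h /=; have [bh|nbh] := pselect (bnd h); last first.
    by have [g Cg] := C0 m; exists g.
  pose V := (fun g => S (fun x => h x + 2 ^- m.+1 * g x)) @` C m.
  have hiV : has_inf V.
    split; first by have [g Cg] := C0 m; exists (S (fun x => h x + 2 ^- m.+1 * g x)), g.
    exists (h x0) => _ [g Cg <-].
    rewrite (@le_trans _ _ (h x0 + 2 ^- m.+1 * g x0))//.
      by rewrite lerDl mulr_ge0 ?invr_ge0 ?exprn_ge0//; have /andP[] := Cb _ _ Cg x0.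
    by apply: (leS (fun x => h x + 2 ^- m.+1 * g x)) => //; apply: bndD => //; exact: Cbnd Cg.
  have dm : 0 < d * 4 ^- m.+1 by rewrite mulr_gt0 ?invr_gt0 ?exprn_gt0.
  have [_ [g Cg <-] gV] := inf_adherent dm hiV.
  exists g; split=> // _ g' Cg'; apply: (le_trans (ltW gV)); rewrite lerD2r.
  by apply: (ge_inf hiV.2); exists g'.
have [pick pickE] := choice pickP.
pose H := fix H m : X -> R :=
  if m is m'.+1 then (fun x => H m' x + 2 ^- m'.+1 * pick (m', H m') x)
  else (fun=> 0).
pose g_ m := pick (m, H m).
have Cg_ m : C m (g_ m) by have [] := pickE (m, H m).
have bH m : bnd (H m).
  elim: m => [|m ih]; first by exists 0 => x /=; rewrite normr0.
  by apply: bndD => //; exact: Cbnd (Cg_ m).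
have Cmono m j : C (m + j)%N `<=` C m.
  by elim: j => [|j ih]; rewrite ?addn0// addnS => g /Cd/ih.
have [g Cg gE] := Cs 0%N g_ (fun j => Cmono 0%N j _ (Cg_ j)).
(* The rescaled tail is again an infinite convex combination of members of [C m]. *)
have tailP m : exists2 g', C m g' & forall x, g x = H m x + 2 ^- m * g' x.
  have [g' Cg' g'E] := Cs m (fun j => g_ (m + j)%N) (fun j => Cmono m j _ (Cg_ _)).
  exists g' => // x; apply: EFin_inj.
  have a0 j : (0 <= (2 ^- j.+1 * g_ j x)%:E)%E.
    rewrite lee_fin mulr_ge0 ?invr_ge0 ?exprn_ge0//.
    by have /andP[] := Cb _ _ (Cg_ j) x.
  rewrite gE (nneseries_split 0 m)// add0n EFinD; congr (_ + _)%E.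
    rewrite big_mkord; elim: m {g' Cg' g'E} => [|m ih]; first by rewrite big_ord0.
    by rewrite big_ord_recr /= ih.
  rewrite -nneseries_addn// EFinM g'E -nneseriesZl; last first.
    move=> j _; rewrite lee_fin mulr_ge0 ?invr_ge0 ?exprn_ge0//.
    by have /andP[] := Cb _ _ (Cg_ (m + j)%N) x.
  apply: eq_eseriesr => j _; rewrite -EFinM mulrA -invfM -exprD addnS.
  by rewrite addnC.
have [y Ky gy] : exists2 y, K y & forall x, K x -> g x <= g y.
  apply: usc_attains_max => //; first exact: Cu Cg.
  by exists M => x; have /andP[] := Cb _ _ Cg x.
(* The tail [g'] competes with the selected [g_ m], and adding [2^-(m+1) g'] to [H m] gives exactly
   the midpoint of [H m] and [g]. *)
have step m : S (H m.+1) <= S (H m) / 2 + g y / 2 + d * 4 ^- m.+1.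
  have [g' Cg' g'E] := tailP m.
  have [_ /(_ (bH m) g' Cg') /= le1] := pickE (m, H m).
  rewrite (le_trans le1)// lerD2r; apply: Sle => x Kx.
  have -> : H m x + 2 ^- m.+1 * g' x = H m x / 2 + g x / 2.
    by rewrite g'E exprS invfM; field; rewrite expf_neq0.
  by rewrite lerD// ler_pM2r ?invr_gt0 ?gy//; exact: leS.
(* By [step], the gap [g y - S (H m)] divided by [2^-m] drops by at most [d 2^-(m+1)] each time,
   hence by at most [d (1 - 2^-m)] in total. *)
have main m : 2 ^- m * (g y - d * (1 - 2 ^- m)) <= g y - S (H m).
  elim: m => [|m ih].
    rewrite expr0 invr1 mul1r subrr mulr0 subr0 lerBrDr gerDl.
    exact: Sle.
  have := step m.
  have -> : 4 ^- m.+1 = 2 ^- m.+1 * 2 ^- m.+1 :> R.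
    by rewrite -invfM -exprMn; congr (_ ^- _); rewrite -natrM.
  have -> : 2 ^- m.+1 = 2^-1 * 2 ^- m :> R by rewrite exprS invfM.
  move: ih; set v := 2 ^- m; set w := S (H m); set w' := S _.
  by move=> h1 h2; nra.
(* Only the single point [y] matters now: for this [m] every member of [C m], the tail [g']
   included, is at most [d] at [y], whereas [main] makes [g' y] at least [g y - d]. *)
have [m mP] := Cp y d d0.
have [g' Cg' g'E] := tailP m.
exists g => // x Kx; rewrite (le_trans (gy x Kx))//.
have := main m; have := leS _ _ (bH m) Ky; have := mP _ Cg'; have := g'E y.
have v0 : 0 < 2 ^- m :> R by rewrite invr_gt0 exprn_gt0.
rewrite /d; move: (2 ^- m) v0 => v v0 E1 h1 h2 h3.
have : v * (g y - e / 2 * (1 - v)) <= v * g' y by lra.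
rewrite ler_pM2l// => h4; nra.
Qed.

End simons.

Lemma EFin_indic01 (R : realType) (T : Type) (A : set T) z :
  (0 <= (\1_A z : R)%:E <= 1)%E.
Proof. by rewrite !lee_fin indicE; case: (_ \in _); rewrite /= ?lexx ?ler01. Qed.

(** * The defect of invariance and its upper semicontinuity *)

Section almost_invariance.
Context (R : realType) (G : ptopologicalType) (gr : groupoid G).
Hypothesis lcgG : locally_compact_groupoid gr.
Variable lambda : G -> borel_measure R G.
Hypothesis clam : continuous_system gr lambda.
Implicit Types al be : G -> borel_measure R G.
Local Open Scope ereal_scope.

(** The third clause is upper semicontinuity of [N]. Since [N] has only to dominate the defect, an
    infinite convex combination of systems can be given the same combination of the functions
    [N]. *)
Definition almost_invariant al (N : G -> R) :=
  [/\ adapted_system gr lambda al, forall g, (0 <= N g <= 1)%R,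
      lower_semicontinuous (fun g => (1 - N g)%:E) &
      forall f : borel G -> \bar R, measurable_fun setT f ->
        (forall z, 0 <= f z <= 1) -> forall g,
        conv_op gr al f g <= conv_op gr al f (tgt gr g) + (N g)%:E /\
        conv_op gr al f (tgt gr g) <= conv_op gr al f g + (N g)%:E].

Lemma conv_op_fin_num al (f : borel G -> \bar R) g :
  continuous_probability_system gr al -> measurable_fun setT f ->
  (forall z, 0 <= f z <= 1) -> conv_op gr al f g \is a fin_num.
Proof.
move=> cal mf f01; have /andP[i0 i1] := conv_op01 lcgG g cal mf f01.
by rewrite ge0_fin_numE//; exact: le_lt_trans i1 (ltry _).
Qed.

Lemma conv_op_indic_fin_num al (A : set (borel G)) g :
  continuous_probability_system gr al -> measurable A ->
  conv_op gr al (fun z => (\1_A z)%:E) g \is a fin_num.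
Proof.
move=> cal mA; apply: conv_op_fin_num => // [|z]; last exact: EFin_indic01.
exact: measurable_EFin_indic.
Qed.

Lemma conv_op_le_of_indic al g g' (e : R) : continuous_probability_system gr al ->
  (forall A : set (borel G), measurable A ->
     conv_op gr al (fun z => (\1_A z)%:E) g <=
     conv_op gr al (fun z => (\1_A z)%:E) g' + e%:E) ->
  forall f : borel G -> \bar R, measurable_fun setT f ->
    (forall z, 0 <= f z <= 1) -> conv_op gr al f g <= conv_op gr al f g' + e%:E.
Proof.
move=> cal le_e f mf f01.
have f0 z : 0 <= f z by case/andP: (f01 z).
have [m [mA mf_]] := translate_measure lcgG g (al (src gr g)).
have [m' [mA' mf'_]] := translate_measure lcgG g' (al (src gr g')).
have m1 : m setT = 1.
  rewrite mA// /translate preimage_setT setIT.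
  exact: (probability_fiber lcgG cal (src_units gr g)).
have m'1 : m' setT = 1.
  rewrite mA'// /translate preimage_setT setIT.
  exact: (probability_fiber lcgG cal (src_units gr g')).
rewrite /conv_op -mf_// -mf'_//.
apply: (le_integral_of_le_measure m1 m'1) => // A mAA.
by rewrite mA// mA'// !translateE//; exact: le_e.
Qed.

Section defect.
Context al (D : G * G -> \bar R).
Hypothesis cal : continuous_probability_system gr al.
Hypothesis alD : is_density gr lambda al D.
Hypothesis lD : lower_semicontinuous D.

(* [1 - overlap g] is half the total variation distance between the translate of
   [al (src g)] by [g] and [al (tgt g)]. *)
Definition overlap (g : G) : \bar R :=
  \int[lambda (tgt gr g)]_(h in fiber gr (tgt gr g)) Order.min (D (tgt gr g, h)) (D (g, h)).

Let mD (g : G) (A : set (borel G)) : measurable_fun A ((fun h => D (g, h)) : borel G -> \bar R).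
Proof. by apply: measurable_funTS; apply: measurable_section; case: alD. Qed.

Let mmin (g x : G) (A : set (borel G)) :
  measurable_fun A ((fun h => Order.min (D (x, h)) (D (g, h))) : borel G -> \bar R).
Proof. by apply: measurable_mine; exact: mD. Qed.

Let min0 (g x h : G) : 0 <= Order.min (D (x, h)) (D (g, h)).
Proof. by case: alD => _ D0 _; rewrite le_min !D0. Qed.

Let overlapT g : overlap g = \int[lambda (tgt gr g)]_h Order.min (D (tgt gr g, h)) (D (g, h)).
Proof.
by rewrite [RHS](integral_setT_fiber lcgG (tgt_units gr g) clam).
Qed.

Let overlap_split g (A : set (borel G)) : measurable A ->
  overlap g = \int[lambda (tgt gr g)]_(h in A) Order.min (D (tgt gr g, h)) (D (g, h)) +
   \int[lambda (tgt gr g)]_(h in ~` A) Order.min (D (tgt gr g, h)) (D (g, h)).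
Proof.
move=> mA; rewrite overlapT -(setUv A) ge0_integral_setU//; first exact: measurableC.
by rewrite disj_set2E setICr.
Qed.

Let ind (A : set (borel G)) : borel G -> \bar R := fun z => (\1_A z)%:E.

Let densE g (A : set (borel G)) : measurable A ->
  conv_op gr al (ind A) g = \int[lambda (tgt gr g)]_(h in A) D (g, h).
Proof. by move=> mA; rewrite /ind -translateE//; case: alD => _ _ ->. Qed.

Let ind_compl g (A : set (borel G)) : measurable A ->
  conv_op gr al (ind A) g + conv_op gr al (ind (~` A)) g = 1.
Proof.
move=> mA; rewrite -(conv_op_cst lcgG 1 g cal) -conv_opD//.
- apply: eq_conv_op => z _; rewrite /ind -EFinD !indicE in_setC.
  by case: (z \in A) => /=; rewrite ?addr0 ?add0r.
- exact: measurable_EFin_indic.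
- by apply: measurable_EFin_indic; exact: measurableC.
- by move=> z; rewrite lee_fin.
- by move=> z; rewrite lee_fin.
Qed.

Let ind_fin g (A : set (borel G)) : measurable A ->
  conv_op gr al (ind A) g \is a fin_num.
Proof. exact: conv_op_indic_fin_num. Qed.

Let densT g (A : set (borel G)) : measurable A ->
  conv_op gr al (ind A) (tgt gr g) = \int[lambda (tgt gr g)]_(h in A) D (tgt gr g, h).
Proof. by move=> mA; rewrite densE// tgt_unit//; exact: tgt_units. Qed.

Let overlap_le g (A : set (borel G)) : measurable A ->
  overlap g <= conv_op gr al (ind A) (tgt gr g) + conv_op gr al (ind (~` A)) g /\
  overlap g <= conv_op gr al (ind A) g + conv_op gr al (ind (~` A)) (tgt gr g).
Proof.
move=> mA; have mAC := measurableC mA.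
rewrite !densT// !densE// (overlap_split _ mA); split; apply: leeD;
  apply: ge0_le_integral => //; do ?[by move=> h _; case: alD];
  by move=> h _; rewrite ge_min lexx ?orbT.
Qed.

Let overlap_attained g : exists2 A : set (borel G), measurable A &
  overlap g = conv_op gr al (ind A) g + conv_op gr al (ind (~` A)) (tgt gr g).
Proof.
(* A Hahn set: the minimum of the two densities is that of the translate by [g] on [A], and that of
   [al (tgt gr g)] off [A]. *)
pose A : set (borel G) := [set h | D (g, h) < D (tgt gr g, h)].
have mA : measurable A.
  rewrite -[A]setTI; by apply: emeasurable_fun_lt => //; exact: mD.
exists A => //; have mAC := measurableC mA.
rewrite densT// densE// (overlap_split _ mA); congr (_ + _).
  by apply: eq_integral => h; rewrite inE => /ltW; exact: min_r.
apply: eq_integral => h; rewrite inE /= => /negP; rewrite -leNgt; exact: min_l.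
Qed.

(** The overlap integrates a lower semicontinuous minimum over moving fibers, so [1 - overlap] is
    upper semicontinuous. It equals the largest excess of [al (tgt gr g)] over the translate on a
    Borel set, which is why a one-sided estimate on sets suffices to bound it. *)
Lemma overlap_defect : exists2 N, almost_invariant al N &
  forall (g : G) (e : R), (0 <= e)%R -> (forall A : set (borel G), measurable A ->
     conv_op gr al (fun z => (\1_A z)%:E) (tgt gr g) <=
     conv_op gr al (fun z => (\1_A z)%:E) g + e%:E) -> (N g <= e)%R.
Proof.
have W0 g : 0 <= overlap g by apply: integral_ge0.
have W1 g : overlap g <= 1.
  rewrite -(conv_op_cst lcgG 1 g cal) (_ : cst 1 = ind setT); last first.
    by apply/funext => z; rewrite /ind indicT.
  rewrite densE// overlapT; apply: ge0_le_integral => // h _.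
  by rewrite ge_min lexx orbT.
have Wfin g : overlap g \is a fin_num by rewrite ge0_fin_numE//; exact: le_lt_trans (W1 g) (ltry _).
pose w g := fine (overlap g); have WE g : overlap g = (w g)%:E by rewrite fineK.
pose p (A : set (borel G)) g := fine (conv_op gr al (ind A) g).
have pE A g : measurable A -> conv_op gr al (ind A) g = (p A g)%:E.
  by move=> mA; rewrite fineK// ind_fin.
have pC A g : measurable A -> (p (~` A) g = 1 - p A g)%R.
  move=> mA; have := ind_compl g mA; rewrite !pE//; last exact: measurableC.
  by rewrite -EFinD => -[]; lra.
have w_le A g : measurable A -> (w g <= p A (tgt gr g) + (1 - p A g) /\
    w g <= p A g + (1 - p A (tgt gr g)))%R.
  move=> mA; have := overlap_le g mA; rewrite !pE//; [|exact: measurableC..].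
  by rewrite !pC// WE -!EFinD !lee_fin.
have w_att g : exists2 A : set (borel G), measurable A & (w g = p A g + (1 - p A (tgt gr g)))%R.
  have [A mA] := overlap_attained g; exists A => //; move: q.
  by rewrite !pE//; [|exact: measurableC..]; rewrite pC// WE -EFinD => -[].
have w01 g : (0 <= w g <= 1)%R by rewrite -!lee_fin -WE W0 W1.
exists (fun g => 1 - w g)%R; last first.
  move=> g e e0 Ae; have [A mA ->] := w_att g; have := Ae A mA.
  by rewrite -/(ind A) !pE// -EFinD lee_fin; lra.
split.
- exact: (adapted_systemP lcgG cal alD).
- by move=> g; have := w01 g; lra.
- rewrite (_ : (fun _ => _) = overlap); last first.
    by apply/funext => g; rewrite subKr WE.
  apply: (lsc_integral_fiber lcgG (lcg_tgt lcgG) (tgt_units gr) clam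
    (k := fun q => Order.min (D (tgt gr q.1, q.2)) (D q))) => //.
    by move=> [g h]; exact: min0.
  apply: lsc_mine => //; apply: (lsc_comp (h := fun q => (tgt gr q.1, q.2))) lD => q.
  apply: cvg_pair => /=; last exact: cvg_snd.
  by apply: continuous_comp; [exact: cvg_fst|exact: lcg_tgt].
- move=> f mf f01 g; split; apply: conv_op_le_of_indic => // A mA;
    rewrite -/(ind A) !pE// -EFinD lee_fin; have := w_le A g mA; lra.
Qed.
End defect.
End almost_invariance.

Lemma le_total_variation_norm (R : realType) (T : ptopologicalType)
    (nu : set T -> \bar R) (A : set (borel T)) : measurable A ->
  (nu A <= total_variation_norm nu)%E.
Proof.
move=> mA; pose F (i : 'I_2) : set (borel T) := if i == 0%N :> nat then A else ~` A.
apply: (@le_trans _ _ (\sum_(i < 2) `|nu (F i)|)%E).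
  rewrite big_ord_recl /= /F /= (le_trans (lee_abs _))// leeDl//.
  by apply: sume_ge0 => i _; exact: abse_ge0.
apply: ereal_sup_ubound; exists 2%N, F; split=> //.
- by move=> i; rewrite /F; case: ifP => // _; exact: measurableC.
- apply/trivIsetP => i j _ _ ij; rewrite /F.
  case: ifPn => i0; case: ifPn => j0; rewrite ?setICr ?setICl//.
    by case/eqP: ij; apply/val_inj; rewrite /= (eqP i0) (eqP j0).
  case/eqP: ij; apply/val_inj => /=.
  by move: i j i0 j0 => [[|[|]]//= ?] [[|[|]]//= ?].
- apply/seteqP; split=> // z _; have [Az|Az] := pselect (A z).
    by exists ord0.
  by exists ord_max.
Qed.

(** * Regularization of a Reiter sequence *)

Section asymptotic_invariance.
Context (R : realType) (G : ptopologicalType) (gr : groupoid G).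
Hypothesis lcgG : locally_compact_groupoid gr.
Variable lambda : G -> borel_measure R G.
Hypothesis haar : left_haar_system gr lambda.
Local Open Scope ereal_scope.

(** Right convolution with the reference system does not increase the defect: testing the
    convolution on a set means testing [theta n] on a function with values in [0, 1]. It also makes
    the density lower semicontinuous. *)
Lemma reiter_almost_invariant : reiter gr lambda ->
  exists al N, (forall n, almost_invariant gr lambda (al n) (N n)) /\
    forall (g : G) (e : R), (0 < e)%R -> exists m, forall n, (m <= n)%N -> (N n g <= e)%R.
Proof.
move=> [theta [ctheta thetaN]]; have clam := haar.1.
have [rho [D [[crho _] rhoD lD _]]] := reference_system lcgG haar.
have /choice[tau] n : exists tau : (G -> borel_measure R G) * (G -> R),
  almost_invariant gr lambda tau.1 tau.2 /\
  forall (g : G) (e : R), (0 <= e)%R -> (forall A : set (borel G), measurable A ->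
     theta n (tgt gr g) A <= translate gr g (theta n (src gr g)) A + e%:E) ->
    (tau.2 g <= e)%R.
  have [ct _] := ctheta n.
  have [ga gaE] := convolution_exists lcgG (theta n) crho.
  have cga := convolution_system lcgG clam ct crho gaE rhoD.
  have gaD := conv_densityP lcgG clam ct crho gaE rhoD.
  have lgaD := lsc_conv_density lcgG ct rhoD lD.
  have [N gaN Ne] := overlap_defect lcgG clam cga gaD lgaD.
  exists (ga, N); split=> //= g e e0 Ae; apply: Ne => // A mA.
  have m1 := measurable_EFin_indic (R := R) mA.
  have i01 := EFin_indic01 R A.
  rewrite !(conv_op_convolution lcgG ct crho gaE)//.
  apply: (conv_op_le_of_indic lcgG ct) => [B mB||z].
  - rewrite -[X in _ <= X + _]translateE// (unit_conv_op lcgG ct.1)//.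
    + by rewrite -measure_integral_indic//; exact: Ae.
    + exact: tgt_units.
    + exact: measurable_EFin_indic.
  - exact: measurable_conv_op.
  - exact: conv_op01.
move=> tauP; exists (fun n => (tau n).1), (fun n => (tau n).2); split=> [n|g e e0].
  by case: (tauP n).
have := thetaN g => /fine_cvgP[fin fcv]; have lt_e := cvgr_lt _ fcv e e0.
have [m _ mP] : \forall n \near \oo, total_variation_norm (fun A =>
    theta n (tgt gr g) A - translate gr g (theta n (src gr g)) A) <= e%:E.
  near=> n; rewrite -[leLHS]fineK; last by near: n.
  by rewrite lee_fin; apply: ltW; near: n; exact: lt_e.
exists m => n mn; have [_] := tauP n; apply; first exact: ltW.
move=> A mA; rewrite -leeBlDl ?translateE//; last first.
  by have [ct _] := ctheta n; exact: conv_op_indic_fin_num.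
rewrite -translateE//; apply: le_trans (mP n mn); exact: le_total_variation_norm.
Unshelve. all: by end_near.
Qed.
End asymptotic_invariance.

Lemma history_choice (T : Type) (P : seq T -> T -> Prop) :
  (forall s, exists t, P s t) -> exists f : nat -> T, forall n, P (mkseq f n) (f n).
Proof.
move=> /choice[F FP]; pose h n := iter n (fun s => rcons s (F s)) [::].
have hE n : mkseq (F \o h) n = h n.
  by elim: n => // n ih; rewrite mkseqS ih.
by exists (F \o h) => n; rewrite hE; exact: FP.
Qed.

(** * Positive operators generated by averaging *)

Section positive_operators.
Context (R : realType) (G : ptopologicalType) (gr : groupoid G).
Hypothesis lcgG : locally_compact_groupoid gr.
Local Open Scope ereal_scope.
Implicit Types (M : (borel G -> \bar R) -> borel G -> \bar R) (f : borel G -> \bar R).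

(** A common interface for averaging operators and their finite sums and compositions, with total
    mass [c]. The last clause says that they act fiber by fiber: a function of the target is merely
    scaled. *)
Record positive_op (c : R) M : Prop := PositiveOp {
  positive_op_cst_ge0 : (0 <= c)%R ;
  positive_op_measurable : forall f, measurable_fun setT f ->
    (forall z, 0 <= f z) -> measurable_fun setT (M f) ;
  positive_op_ge0 : forall f g, (forall z, 0 <= f z) -> 0 <= M f g ;
  le_positive_op : forall f f' g, measurable_fun setT f -> measurable_fun setT f' ->
    (forall z, 0 <= f z) -> (forall z, f z <= f' z) -> M f g <= M f' g ;
  positive_op_series : forall (a : nat -> R) (f : nat -> borel G -> \bar R) g,
    (forall n, 0 <= a n)%R -> (forall n, measurable_fun setT (f n)) ->
    (forall n z, 0 <= f n z) ->
    M (fun z => \sum_(n <oo) (a n)%:E * f n z) g = \sum_(n <oo) (a n)%:E * M (f n) g ;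
  lsc_positive_op : forall f, (forall z, 0 <= f z) ->
    lower_semicontinuous (f : G -> \bar R) ->
    lower_semicontinuous (M f : G -> \bar R) ;
  positive_op_tgt : forall (v : G -> \bar R) g, (forall z, 0 <= v z) ->
    M (v \o tgt gr) g = c%:E * v (tgt gr g)
}.

Lemma positive_op_conv al : continuous_probability_system gr al ->
  positive_op 1 (conv_op gr al).
Proof.
move=> cal; split => //.
- by move=> f mf f0; exact: measurable_conv_op.
- by move=> f g f0; exact: conv_op_ge0.
- by move=> f f' g mf mf' f0 ff'; apply: le_conv_op => // z _; exact: ff'.
- move=> a f g a0 mf f0; rewrite conv_op_nneseries//.
  + by apply: eq_eseriesr => n _; rewrite conv_opZ.
  + by move=> n; exact: measurable_funeM.
  + by move=> n z; rewrite mule_ge0// lee_fin.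
- by move=> f f0 lf; apply: lsc_conv_op => //; case: cal.
- by move=> v g v0; rewrite conv_op_tgt// mul1e.
Qed.

Lemma positive_op_id : positive_op 1 id.
Proof. by split => // v g v0; rewrite mul1e. Qed.

Lemma positive_op_comp c1 M1 c2 M2 : positive_op c1 M1 -> positive_op c2 M2 ->
  positive_op (c1 * c2) (M1 \o M2).
Proof.
move=> M1P M2P.
have M20 f : (forall z, 0 <= f z) -> forall z, 0 <= M2 f z.
  by move=> f0 z; exact: positive_op_ge0 M2P _ _ _.
split.
- by apply: mulr_ge0; [exact: positive_op_cst_ge0 M1P|exact: positive_op_cst_ge0 M2P].
- move=> f mf f0; apply: (positive_op_measurable M1P); last exact: M20.
  exact: (positive_op_measurable M2P).
- by move=> f g f0; apply: (positive_op_ge0 M1P); exact: M20.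
- move=> f f' g mf mf' f0 ff'.
  have f'0 z : 0 <= f' z by apply: le_trans (ff' z).
  apply: (le_positive_op M1P).
  + exact: (positive_op_measurable M2P).
  + exact: (positive_op_measurable M2P).
  + exact: M20.
  + by move=> z; exact: (le_positive_op M2P).
- move=> a f g a0 mf f0 /=.
  rewrite (_ : M2 _ = fun z => \sum_(n <oo) (a n)%:E * M2 (f n) z); last first.
    by apply/funext => z; exact: (positive_op_series M2P).
  rewrite (positive_op_series M1P)// => n.
    exact: (positive_op_measurable M2P).
  exact: M20.
- move=> f f0 lf; apply: (lsc_positive_op M1P); first exact: M20.
  exact: (lsc_positive_op M2P).
- move=> v g v0 /=.
  rewrite (_ : M2 _ = (fun z => c2%:E * v z) \o tgt gr); last first.
    by apply/funext => z; rewrite (positive_op_tgt M2P).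
  rewrite (positive_op_tgt M1P); first by rewrite EFinM muleA.
  by move=> z; rewrite mule_ge0// lee_fin; exact: positive_op_cst_ge0 M2P.
Qed.

Lemma positive_op_sum (I : Type) (s : seq I) (a c : I -> R)
    (M : I -> (borel G -> \bar R) -> borel G -> \bar R) :
  (forall i, 0 <= a i)%R -> (forall i, positive_op (c i) (M i)) ->
  positive_op (\sum_(i <- s) a i * c i)%R (fun f g => \sum_(i <- s) (a i)%:E * M i f g).
Proof.
move=> a0 MP.
have M0 f i : (forall z, 0 <= f z) -> forall z, 0 <= (a i)%:E * M i f z.
  by move=> f0 z; rewrite mule_ge0 ?lee_fin//; exact: positive_op_ge0 (MP i) _ _ _.
split.
- by apply: sumr_ge0 => i _; rewrite mulr_ge0//; exact: positive_op_cst_ge0 (MP i).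
- move=> f mf f0; apply: emeasurable_sum => i; apply: measurable_funeM.
  exact: (positive_op_measurable (MP i)).
- by move=> f g f0; apply: sume_ge0 => i _; exact: M0.
- move=> f f' g mf mf' f0 ff'; apply: lee_sum => i _; apply: lee_wpmul2l.
    by rewrite lee_fin.
  exact: (le_positive_op (MP i)).
- move=> b f g b0 mf f0.
  under eq_bigr do rewrite (positive_op_series (MP _))//.
  rewrite (eq_eseriesr (g := fun n => \sum_(i <- s) (a i)%:E * ((b n)%:E * M i (f n) g))); last first.
    move=> n _; rewrite ge0_sume_distrr//; last by move=> i _; exact: M0.
    by apply: eq_bigr => i _; rewrite muleCA.
  have bM0 i n : 0 <= (b n)%:E * M i (f n) g.
    by rewrite mule_ge0 ?lee_fin//; exact: positive_op_ge0 (MP i) _ _ _.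
  rewrite nneseries_sum; last by move=> i n; rewrite mule_ge0// lee_fin.
  by apply: eq_bigr => i _; rewrite nneseriesZl.
- move=> f f0 lf; apply: lsc_sum => [i x _|i _]; first exact: M0.
  apply: lscM => //.
  + by move=> x; rewrite lee_fin.
  + by move=> x; exact: positive_op_ge0 (MP i) _ _ _.
  + exact: lsc_cst.
  + exact: (lsc_positive_op (MP i)).
- move=> v g v0; rewrite -sumEFin ge0_sume_distrl; last first.
    move=> i _; rewrite lee_fin mulr_ge0//; exact: positive_op_cst_ge0 (MP i).
  by apply: eq_bigr => i _; rewrite (positive_op_tgt (MP i))// EFinM muleA.
Qed.

End positive_operators.

Section positive_operators_theory.
Context (R : realType) (G : ptopologicalType) (gr : groupoid G).
Hypothesis lcgG : locally_compact_groupoid gr.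
Local Open Scope ereal_scope.
Implicit Types (M : (borel G -> \bar R) -> borel G -> \bar R) (f : borel G -> \bar R).

Lemma positive_op_iter c M n : positive_op gr c M -> positive_op gr (c ^+ n)%R (iter n M).
Proof.
move=> MP; elim: n => [|n ih]; first by rewrite expr0; exact: positive_op_id.
by rewrite exprS; exact: (positive_op_comp MP ih).
Qed.

Section one_operator.
Context c M (MP : positive_op gr c M).

Lemma positive_op_cst a g : 0 <= a -> M (cst a) g = c%:E * a.
Proof. by move=> a0; exact: (positive_op_tgt MP (v := cst a)). Qed.

Lemma positive_op_nneseries (f : nat -> borel G -> \bar R) g :
  (forall n, measurable_fun setT (f n)) -> (forall n z, 0 <= f n z) ->
  M (fun z => \sum_(n <oo) f n z) g = \sum_(n <oo) M (f n) g.
Proof.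
move=> mf f0; have := positive_op_series MP (a := cst 1%R) g _ mf f0.
rewrite (_ : (fun z => \sum_(n <oo) 1%:E * f n z) = fun z => \sum_(n <oo) f n z); last first.
  by apply/funext => z; apply: eq_eseriesr => n _; rewrite mul1e.
by move=> ->//; apply: eq_eseriesr => n _; rewrite mul1e.
Qed.

Lemma positive_opD f f' g : measurable_fun setT f -> measurable_fun setT f' ->
  (forall z, 0 <= f z) -> (forall z, 0 <= f' z) ->
  M (fun z => f z + f' z) g = M f g + M f' g.
Proof.
move=> mf mf' f0 f'0.
pose F n : borel G -> \bar R := if n is 0 then f else if n is 1 then f' else cst 0.
have sum2 (u : nat -> \bar R) : (forall n, 0 <= u n) -> (forall n, (1 < n)%N -> u n = 0) ->
    \sum_(n <oo) u n = u 0%N + u 1%N.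
  move=> u0 u2; rewrite (nneseries_split 0 2)// big_mkord !big_ord_recl big_ord0 adde0.
  by rewrite [X in _ + X]eseries0 ?adde0// => k k2 _; exact: u2.
have F0 n z : 0 <= F n z by case: n => [|[|n]]//=.
rewrite (_ : (fun z => _) = fun z => \sum_(n <oo) F n z); last first.
  by apply/funext => z; rewrite sum2// => -[|[|n]].
rewrite positive_op_nneseries//; last by case=> [|[|n]].
rewrite sum2//= => [n|[|[|n]]//= _].
  exact: (positive_op_ge0 MP).
by rewrite positive_op_cst// mule0.
Qed.

Lemma positive_op_decreasing (e : nat -> G -> R) :
  (forall n, measurable_fun setT (e n : borel G -> R)) ->
  (forall n z, 0 <= e n z <= 1)%R -> (forall n z, e n.+1 z <= e n z)%R ->
  (forall z (d : R), 0 < d -> exists m, e m z <= d)%R ->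
  forall g (d : R), (0 < d)%R -> exists m, M (EFin \o e m) g <= d%:E.
Proof.
move=> me e01 de e0.
have e_ge0 n z : (0 <= e n z)%R by case/andP: (e01 n z).
have de_le m n z : (m <= n)%N -> (e n z <= e m z)%R.
  by move=> mn; apply: (@nonincreasing_seqP _ _ (e ^~ z)).1 => // k; exact: de.
pose D n : borel G -> \bar R := fun z => (e n z - e n.+1 z)%:E.
have D0 n z : 0 <= D n z by rewrite lee_fin subr_ge0.
have mD n : measurable_fun setT (D n).
  by apply/measurable_EFinP; apply: measurable_funB.
have ED m : EFin \o e m = fun z => \sum_(m <= n <oo) D n z.
  apply/funext => z /=; apply/esym/cvg_lim => //.
  apply: (@squeeze_cvge _ _ _ _ (fun n => (e m z - e n z)%:E) _ (cst (e m z)%:E)).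
  - near=> n; have mn : (m <= n)%N by near: n; exists m.
    have -> : \sum_(m <= i < n) D i z = (e m z - e n z)%:E.
      rewrite sumEFin -(opprB (e n z)) -(telescope_sumr (e ^~ z) mn) -sumrN.
      by congr EFin; apply: eq_bigr => k _; rewrite opprB.
    by rewrite lexx /= lee_fin gerBl.
  - apply: cvg_EFin; first by near=> n.
    rewrite -[X in _ --> X]subr0; apply: cvgB; first exact: cvg_cst.
    apply/cvgrPdist_le => d d0; have [k kd] := e0 z d d0.
    near=> n; rewrite sub0r normrN ger0_norm//; apply: le_trans kd.
    by apply: de_le; near: n; exists k.
  - exact: cvg_cst.
have MED m g : M (EFin \o e m) g = \sum_(m <= n <oo) M (D n) g.
  rewrite ED (_ : (fun z => _) = fun z => \sum_(n <oo) D (n + m)%N z); last first.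
    by apply/funext => z; rewrite -(nneseries_addn m (fun n => D0 n z)).
  rewrite positive_op_nneseries//; apply: (nneseries_addn m (f := fun n => M (D n) g)) => n.
  exact: (positive_op_ge0 MP).
move=> g d d0.
have MD0 n : 0 <= M (D n) g by exact: (positive_op_ge0 MP).
have fin0 : \sum_(0 <= n <oo) M (D n) g < +oo.
  rewrite -MED; apply: (@le_lt_trans _ _ (M (cst 1) g)).
    apply: (le_positive_op MP) => //; first exact/measurable_EFinP.
    + by move=> z; rewrite lee_fin.
    + by move=> z; rewrite lee_fin; case/andP: (e01 0%N z).
  by rewrite positive_op_cst// mule1 ltry.
have := nneseries_tail_cvg fin0 (fun n _ => MD0 n).
move=> /fine_cvgP[fin fcv]; have lt_d := cvgr_lt _ fcv d d0.
have [m _ mP] : \forall m \near \oo, M (EFin \o e m) g <= d%:E.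
  near=> m; rewrite MED -[leLHS]fineK; last by near: m.
  by rewrite lee_fin; apply: ltW; near: m; exact: lt_d.
by exists m; exact: (mP m (leqnn m)).
Unshelve. all: by end_near.
Qed.

End one_operator.
End positive_operators_theory.

(** * Almost invariant combinations that are small on compact sets *)

Section convex_series.
Context (R : realType) (c : nat -> R).
Hypothesis c0 : forall n, 0 <= c n.
Hypothesis c1 : (\sum_(n <oo) (c n)%:E = 1)%E.

Lemma convex_series_le (u : nat -> R) (b : R) : (forall n, 0 <= u n <= b) ->
  (0 <= \sum_(n <oo) (c n)%:E * (u n)%:E <= b%:E)%E.
Proof.
move=> ub; have cu n : (0 <= (c n)%:E * (u n)%:E)%E.
  by rewrite mule_ge0 ?lee_fin//; case/andP: (ub n).
rewrite nneseries_ge0//= -[leRHS]mule1 -c1 -nneseriesZl//; last first.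
  by move=> n _; rewrite lee_fin.
by apply: lee_nneseries => // n _; rewrite -!EFinM lee_fin mulrC ler_wpM2r//; case/andP: (ub n).
Qed.

Lemma convex_series_fin (u : nat -> R) : (forall n, 0 <= u n <= 1) ->
  (\sum_(n <oo) (c n)%:E * (u n)%:E \is a fin_num)%E.
Proof.
move=> /convex_series_le/andP[u0 u1]; rewrite ge0_fin_numE//.
exact: le_lt_trans u1 (ltry _).
Qed.

Lemma convex_series_compl (u : nat -> R) : (forall n, 0 <= u n <= 1) ->
  (\sum_(n <oo) (c n)%:E * (1 - u n)%:E =
   1 - \sum_(n <oo) (c n)%:E * (u n)%:E)%E.
Proof.
move=> u01; have fu := convex_series_fin u01.
have u0 n : 0 <= u n by case/andP: (u01 n).
have u1 n : 0 <= 1 - u n by rewrite subr_ge0; case/andP: (u01 n).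
apply/esym/eqP; rewrite sube_eq//; last by rewrite fin_num_adde_defl.
rewrite -nneseriesD => [|n _ _|n _ _]; [|by rewrite mule_ge0 ?lee_fin..].
rewrite -c1; apply/eqP/eq_eseriesr => n _.
by rewrite -!EFinM -EFinD; congr EFin; ring.
Qed.

End convex_series.

Section mixture_of_almost_invariant.
Context (R : realType) (G : ptopologicalType) (gr : groupoid G).
Hypothesis lcgG : locally_compact_groupoid gr.
Variable lambda : G -> borel_measure R G.
Hypothesis clam : continuous_system gr lambda.
Local Open Scope ereal_scope.
Variables (c : nat -> R) (al : nat -> G -> borel_measure R G) (N : nat -> G -> R).
Hypothesis c0 : forall n, (0 <= c n)%R.
Hypothesis c1 : \sum_(n <oo) (c n)%:E = 1.
Hypothesis alN : forall n, almost_invariant gr lambda (al n) (N n).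

Lemma almost_invariant_mixture : exists ga N', almost_invariant gr lambda ga N' /\
  forall g, (N' g)%:E = \sum_(n <oo) (c n)%:E * (N n g)%:E.
Proof.
have alP n : adapted_system gr lambda (al n) by case: (alN n).
have N01 n g : (0 <= N n g <= 1)%R by case: (alN n).
have [ga [gaP gaE]] := mixture_system lcgG clam c0 c1 alP.
pose N' g := fine (\sum_(n <oo) (c n)%:E * (N n g)%:E).
have N'E g : (N' g)%:E = \sum_(n <oo) (c n)%:E * (N n g)%:E.
  by rewrite fineK//; exact: convex_series_fin.
exists ga, N'; split=> //; split=> //.
- move=> g; have := convex_series_le c0 c1 (fun n => N01 n g).
  by rewrite -N'E !lee_fin.
- rewrite (_ : (fun g => _) = fun g => \sum_(n <oo) (c n)%:E * (1 - N n g)%:E).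
    apply: lsc_nneseries => n.
      by move=> g; rewrite mule_ge0 ?lee_fin// subr_ge0; case/andP: (N01 n g).
    apply: lscM => //.
    + by move=> g; rewrite lee_fin.
    + by move=> g; rewrite lee_fin subr_ge0; case/andP: (N01 n g).
    + exact: lsc_cst.
    + by case: (alN n).
  by apply/funext => g; rewrite convex_series_compl// -N'E.
- move=> f mf f01 g; have f0 z : 0 <= f z by case/andP: (f01 z).
  have cf0 n g' : 0 <= (c n)%:E * conv_op gr (al n) f g'.
    by rewrite mule_ge0 ?lee_fin//; exact: conv_op_ge0.
  have cN0 n : 0 <= (c n)%:E * (N n g)%:E.
    by rewrite mule_ge0 ?lee_fin//; case/andP: (N01 n g).
  rewrite !(conv_op_mixture lcgG gaE)// N'E.
  split; rewrite -nneseriesD//; apply: lee_nneseries => // n _;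
    rewrite -ge0_muleDr; do ?[exact: conv_op_ge0 | by rewrite lee_fin; case/andP: (N01 n g)];
    apply: lee_wpmul2l; rewrite ?lee_fin//; by have [_ _ _ /(_ f mf f01 g)[? ?]] := alN n.
Qed.

End mixture_of_almost_invariant.

Section selection.
Context (R : realType) (G : ptopologicalType) (gr : groupoid G).
Hypothesis lcgG : locally_compact_groupoid gr.
Variable lambda : G -> borel_measure R G.
Hypothesis clam : continuous_system gr lambda.
Local Open Scope ereal_scope.

Lemma almost_invariant_measurable al N : almost_invariant gr lambda al N ->
  measurable_fun setT (N : borel G -> R).
Proof.
move=> [_ _ lN _]; rewrite (_ : N = fun g => (1 - (1 - N g))%R); last first.
  by apply/funext => g; rewrite subKr.
by apply: measurable_funB => //; apply/measurable_EFinP; exact: lsc_measurable.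
Qed.

Variables (al : nat -> G -> borel_measure R G) (N : nat -> G -> R).
Hypothesis alN : forall n, almost_invariant gr lambda (al n) (N n).
Hypothesis N_small : forall (g : G) (e : R), (0 < e)%R ->
  exists m, forall n, (m <= n)%N -> (N n g <= e)%R.

(** Stands for the infinite convex combinations of the systems of index at least [m], without naming
    coefficients: every common pointwise bound of their defects is inherited. *)
Definition tail_bounded m (p : (G -> borel_measure R G) * (G -> R)) :=
  almost_invariant gr lambda p.1 p.2 /\
  forall g (e : R), (forall n, (m <= n)%N -> (N n g <= e)%R) -> (p.2 g <= e)%R.

(** [sigma_convex_small] is applied to the functions [M N'] with [N'] the defect of a tail-bounded
    system, so that the smallness already accounts for the operator [M]. *)
Lemma tail_bounded_small (K : set G) c M m (e : R) : compact K ->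
  positive_op gr c M -> (0 < e)%R ->
  exists2 p, tail_bounded m p & forall g, K g -> M (EFin \o p.2) g <= e%:E.
Proof.
move=> cK MP e0.
pose C k := [set u : G -> R | exists2 p, tail_bounded (m + k) p &
  forall g, (u g)%:E = M (EFin \o p.2) g].
have mN p k : tail_bounded k p -> measurable_fun setT (EFin \o p.2 : borel G -> \bar R).
  by move=> [/almost_invariant_measurable /measurable_EFinP].
have N01 p k : tail_bounded k p -> forall g, 0 <= (p.2 g)%:E <= 1.
  by move=> [[_ + _ _] _] g => /(_ g); rewrite !lee_fin.
have MN01 p k : tail_bounded k p -> forall g, 0 <= M (EFin \o p.2) g <= c%:E.
  move=> pP g; rewrite (positive_op_ge0 MP); last by move=> z; case/andP: (N01 _ _ pP z).
  rewrite -(mule1 c%:E) -(positive_op_cst MP g lee01).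
  apply: (le_positive_op MP) => //; first exact: mN pP.
  - by move=> z; case/andP: (N01 _ _ pP z).
  - by move=> z; case/andP: (N01 _ _ pP z).
have MNfin p k : tail_bounded k p -> forall g, M (EFin \o p.2) g \is a fin_num.
  move=> pP g; have /andP[M0 M1] := MN01 p k pP g.
  by rewrite ge0_fin_numE//; exact: le_lt_trans M1 (ltry _).
have [||||||u [p pP uE] uK] := @sigma_convex_small R G K C c cK _ _ _ _ _ _ e e0.
- move=> k u [p [aip pN] uE]; exists p => //; split=> // g d Nd; apply: pN => n.
  by rewrite addnS => /ltnW; exact: Nd.
- move=> k; exists (fun g => fine (M (EFin \o N (m + k)%N) g)).
  have pP : tail_bounded (m + k) (al (m + k)%N, N (m + k)%N).
    by split=> //= g d; apply; exact: leqnn.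
  by exists (al (m + k)%N, N (m + k)%N) => // g; rewrite fineK//; exact: MNfin pP g.
- by move=> k u [p pP uE] g; rewrite -!lee_fin uE; exact: MN01 pP g.
- move=> k u [p pP uE] a.
  have [[_ _ lp _] _] := pP.
  have p1 z : 0 <= (1 - p.2 z)%:E.
    by have := N01 _ _ pP z; rewrite !lee_fin subr_ge0 => /andP[].
  (* Upper semicontinuity of [M] applied to the defect is lower semicontinuity of [M] applied to its
     complement to 1, the two adding up to [c]. *)
  have ME g : M (fun z => (1 - p.2 z)%:E) g = (c - u g)%:E.
    have : M (fun z => (1 - p.2 z)%:E + (p.2 z)%:E) g = c%:E.
      rewrite -[RHS]mule1 -(positive_op_cst MP g lee01); congr (M _ g).
      by apply/funext => z; rewrite -EFinD subrK.
    rewrite (positive_opD MP)//; last 3 first.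
    + exact: lsc_measurable.
    + exact: mN pP.
    + by move=> z; case/andP: (N01 _ _ pP z).
    rewrite -[X in _ + X]uE; case: (M _ g) => [r| |]//=.
    by rewrite -EFinD => -[<-]; rewrite addrK.
  have -> : [set x | (u x < a)%R] =
      [set x | (c - a)%:E < M (fun z => (1 - p.2 z)%:E) x].
    by apply/seteqP; split=> x /=; rewrite ME lte_fin; lra.
  by have /lower_semicontinuousP := lsc_positive_op MP p1 lp; exact.
- move=> k u_ Cu; have /choice[p_ pP] : forall j, exists p, tail_bounded (m + k) p /\
      forall g, (u_ j g)%:E = M (EFin \o p.2) g.
    by move=> j; have [p ? ?] := Cu j; exists p.
  have t0 n : (0 <= 2 ^- n.+1 :> R)%R by rewrite invr_ge0 exprn_ge0.
  have t1 : \sum_(n <oo) (2 ^- n.+1 : R)%:E = 1 by rewrite half_series expr0 invr1.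
  have [ga [N' [gaN' N'E]]] := almost_invariant_mixture lcgG clam t0 t1 (fun j => (pP j).1.1).
  have p01 j g : (0 <= (p_ j).2 g <= 1)%R by have [_ + _ _] := (pP j).1.1.
  have gaP : tail_bounded (m + k) (ga, N').
    split=> //= g d Nd; rewrite -lee_fin N'E.
    have ub n : (0 <= (p_ n).2 g <= d)%R.
      by case/andP: (p01 n g) => -> _; exact: (pP n).1.2.
    by have /andP[] := convex_series_le t0 t1 ub.
  exists (fun g => fine (M (EFin \o N') g)).
    by exists (ga, N') => // g; rewrite fineK//; exact: MNfin gaP g.
  move=> g; rewrite fineK; last exact: MNfin gaP g.
  rewrite (_ : EFin \o N' = fun z => \sum_(n <oo) (2 ^- n.+1)%:E * ((p_ n).2 z)%:E); last first.
    by apply/funext => z; rewrite /= N'E.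
  rewrite (positive_op_series MP)//.
  + by apply: eq_eseriesr => j _; rewrite EFinM (pP j).2.
  + by move=> j; exact: mN (pP j).1.
  + by move=> j z; rewrite lee_fin; case/andP: (p01 j z).
- move=> g d d0.
  have N01' n z : (0 <= N n z <= 1)%R by case: (alN n).
  have hN z : has_ubound (range (N^~ z)).
    by exists 1%R => _ [n _ <-]; case/andP: (N01' n z).
  pose E k z := sups (N^~ z) (m + k)%N.
  have EN k n z : (m + k <= n)%N -> (N n z <= E k z)%R.
    move=> kn; apply: ub_le_sup; last by exists n.
    by exists 1%R => _ [j _ <-]; case/andP: (N01' j z).
  have EE k z (b : R) : (forall n, (m + k <= n)%N -> (N n z <= b)%R) -> (E k z <= b)%R.
    move=> Nb; apply: ge_sup; first by exists (N (m + k)%N z), (m + k)%N => //=.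
    by move=> _ [n /= kn <-]; exact: Nb.
  have mE k : measurable_fun setT (E k : borel G -> R).
    apply: measurable_fun_sups => // n; exact: almost_invariant_measurable (alN n).
  have E01 k z : (0 <= E k z <= 1)%R.
    apply/andP; split; last by apply: EE => n _; case/andP: (N01' n z).
    by apply: le_trans (EN k _ z (leqnn _)); case/andP: (N01' (m + k)%N z).
  have [||k kd] := positive_op_decreasing MP mE E01 _ _ g d0.
  + by move=> k z; apply: EE => n; rewrite addnS => /ltnW; exact: EN.
  + move=> z b b0; have [k kb] := N_small z b0; exists k; apply: EE => n kn; apply: kb.
    exact: leq_trans (leq_addl _ _) kn.
  exists k => u [p pP uE]; rewrite -lee_fin uE; apply: le_trans kd.
  apply: (le_positive_op MP).
  + exact: mN pP.
  + exact/measurable_EFinP.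
  + by move=> z; case/andP: (N01 _ _ pP z).
  + by move=> z; rewrite lee_fin; apply: pP.2 => n; exact: EN.
exists p; first by rewrite -(addn0 m).
by move=> g Kg; rewrite -uE lee_fin; exact: uK.
Qed.

End selection.

(** * Inductive choice of the systems to be mixed *)

Section partial_mixture.
Context (R : realType) (G : ptopologicalType) (gr : groupoid G).
Hypothesis lcgG : locally_compact_groupoid gr.
Variable lambda : G -> borel_measure R G.
Hypothesis clam : continuous_system gr lambda.
Local Open Scope ereal_scope.

(** The factors 1 are the masses of the averaging operators, kept to match [positive_op_sum]. *)
Definition partial_mass i : R := (\sum_(0 <= k < i) 2 ^- k.+1 * 1)%R.

Lemma partial_massE i : partial_mass i = (1 - 2 ^- i)%R.
Proof.
rewrite /partial_mass; elim: i => [|i ih]; first by rewrite big_geq// expr0 invr1 subrr.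
rewrite big_nat_recr//= ih mulr1 exprS invfM; lra.
Qed.

(** The partial mixture of the first [i] systems has mass less than 1; this provides a power of it
    that is negligible at level [i]. *)
Lemma partial_mass_pow i : exists n, (partial_mass i ^+ n <= 2 ^- i)%R.
Proof.
have p0 : (0 < 2 ^- i :> R)%R by rewrite invr_gt0 exprn_gt0.
have p1 : (2 ^- i <= 1 :> R)%R by rewrite invf_le1 ?exprn_gt0// exprn_ege1// ler1n.
have : (`|partial_mass i| < 1)%R by rewrite partial_massE ger0_norm; lra.
move=> /cvg_expr/cvgr_lt/(_ _ p0)[n _ nP]; exists n; apply: ltW; exact: (nP n (leqnn n)).
Qed.

Definition partial_op (al : nat -> G -> borel_measure R G) i (f : borel G -> \bar R)
    (g : borel G) : \bar R :=
  \sum_(0 <= k < i) (2 ^- k.+1)%:E * conv_op gr (al k) f g.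

Lemma eq_partial_op al al' i : (forall k, (k < i)%N -> al k = al' k) ->
  partial_op al i = partial_op al' i.
Proof.
move=> alE; apply/funext => f; apply/funext => g.
by apply: eq_big_nat => k /andP[_ ki]; rewrite alE.
Qed.

Lemma positive_op_partial al i : (forall k, continuous_probability_system gr (al k)) ->
  positive_op gr (partial_mass i) (partial_op al i).
Proof.
move=> cal; apply: (@positive_op_sum _ _ gr _ _ (fun k => (2 ^- k.+1)%R) (cst 1%R)
  (fun k => conv_op gr (al k))) => k; last exact: positive_op_conv.
by rewrite invr_ge0 exprn_ge0.
Qed.

Lemma positive_op_sum1 (I : Type) (s : seq I) (c : I -> R)
    (M : I -> (borel G -> \bar R) -> borel G -> \bar R) :
  (forall i, positive_op gr (c i) (M i)) ->
  positive_op gr (\sum_(i <- s) c i)%R (fun f g => \sum_(i <- s) M i f g).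
Proof.
move=> MP; have := @positive_op_sum _ _ gr _ s (cst 1%R) c M (fun=> ler01) MP.
rewrite (eq_bigr c) => [|i _]; last by rewrite /= mul1r.
congr (positive_op _ _ _); apply/funext => f; apply/funext => g.
by apply: eq_bigr => i _; rewrite /= mul1e.
Qed.

Variables (theta : nat -> G -> borel_measure R G) (N : nat -> G -> R).
Hypothesis thetaN : forall n, almost_invariant gr lambda (theta n) (N n).
Hypothesis N_small : forall (g : G) (e : R), (0 < e)%R ->
  exists m, forall n, (m <= n)%N -> (N n g <= e)%R.

(* The choice of Kaimanovich and Vershik: the invariance defect of the k-th system
   is small on the k-th compact set, even after applying the first few powers of
   the partial mixtures of the previous systems. *)
Lemma almost_invariant_selection (K : nat -> set G) (n : nat -> nat) :
  (forall k, compact (K k)) ->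
  exists al D, (forall k, almost_invariant gr lambda (al k) (D k)) /\
    forall k i g, (i <= k)%N -> K k g ->
      \sum_(0 <= j < n i) iter j (partial_op al i) (EFin \o D k) g <= (2 ^- k)%:E.
Proof.
move=> cK.
pose T := {p : (G -> borel_measure R G) * (G -> R) | almost_invariant gr lambda p.1 p.2}.
(* The default of [nth]. It is read only beyond the history [s], which [partial_op (ms s) i] with
   [i <= size s] never consults. *)
pose t0 : T := exist _ (theta 0%N, N 0%N) (thetaN 0%N).
pose ms (s : seq T) k := (sval (nth t0 s k)).1.
(* All the constraints for [i <= size s] and [j < n i] are summed into one positive operator;
   smallness of the sum implies each of them. *)
pose M s : (borel G -> \bar R) -> borel G -> \bar R :=
  fun f g => \sum_(i < (size s).+1) \sum_(0 <= j < n i) iter j (partial_op (ms s) i) f g.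
have MP s : exists c, positive_op gr c (M s).
  eexists; apply: positive_op_sum1 => i; apply: positive_op_sum1 => j.
  apply: positive_op_iter; apply: positive_op_partial => k.
  by have [[]] := svalP (nth t0 s k).
have [s|f fP] := @history_choice T (fun s t => forall g, K (size s) g ->
    M s (EFin \o (sval t).2) g <= (2 ^- size s)%:E).
  have [c Mc] := MP s.
  have e0 : (0 < 2 ^- size s :> R)%R by rewrite invr_gt0 exprn_gt0.
  have [p [pP _] pK] := tail_bounded_small lcgG clam thetaN N_small 0 (cK (size s)) Mc e0.
  by exists (exist _ p pP).
exists (fun k => (sval (f k)).1), (fun k => (sval (f k)).2); split=> [k|k i g ik Kg].
  exact: svalP (f k).
have := fP k g; rewrite size_mkseq => /(_ Kg); apply: le_trans.
rewrite /M size_mkseq (bigD1 (Ordinal (ik : (i < k.+1)%N)))//=.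
rewrite (@eq_partial_op _ (ms (mkseq f k))) => [|l li]; last first.
  by rewrite /ms nth_mkseq//; exact: leq_trans ik.
rewrite leeDl//; apply: sume_ge0 => l _; apply: sume_ge0 => j _.
have D0 z : 0 <= (EFin \o (sval (f k)).2) z.
  by have [_ /(_ z)/andP[? _] _ _] := svalP (f k); rewrite lee_fin.
have cms j' : continuous_probability_system gr (ms (mkseq f k) j').
  by have [[]] := svalP (nth t0 (mkseq f k) j').
exact: (positive_op_ge0 (positive_op_iter j (positive_op_partial l cms))).
Qed.

End partial_mixture.

(** * Oscillation of harmonic functions for the infinite mixture *)

Section harmonic_functions.
Context (R : realType) (G : ptopologicalType) (gr : groupoid G).
Hypothesis lcgG : locally_compact_groupoid gr.
Variable lambda : G -> borel_measure R G.
Local Open Scope ereal_scope.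
Variables (al : nat -> G -> borel_measure R G) (D : nat -> G -> R).
Hypothesis alD : forall n, almost_invariant gr lambda (al n) (D n).
Variable pi : G -> borel_measure R G.
Hypothesis cpi : continuous_probability_system gr pi.
Hypothesis piE : forall (f : borel G -> \bar R) g, measurable_fun setT f ->
  (forall z, 0 <= f z) ->
  conv_op gr pi f g = \sum_(k <oo) (2 ^- k.+1)%:E * conv_op gr (al k) f g.

Let t0 n : (0 <= 2 ^- n.+1 :> R)%R. Proof. by rewrite invr_ge0 exprn_ge0. Qed.

Let tE0 n : 0 <= (2 ^- n.+1 : R)%:E. Proof. by rewrite lee_fin. Qed.

Let cal k : continuous_probability_system gr (al k).
Proof. by have [[]] := alD k. Qed.

Let D0 k z : 0 <= (D k z)%:E.
Proof. by have [_ /(_ z)/andP[? _] _ _] := alD k; rewrite lee_fin. Qed.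

Let mD k : measurable_fun setT (EFin \o D k : borel G -> \bar R).
Proof. by apply/measurable_EFinP; exact: almost_invariant_measurable (alD k). Qed.

Section one_level.
Variables (f : borel G -> \bar R) (i n : nat).
Hypothesis mf : measurable_fun setT f.
Hypothesis f01 : forall z, 0 <= f z <= 1.
Hypothesis harmf : forall g, conv_op gr pi f g = f g.

Let f0 z : 0 <= f z. Proof. by case/andP: (f01 z). Qed.

Let A := partial_op gr al i.
Let s := @partial_mass R i.
Let AP j : positive_op gr (s ^+ j) (iter j A).
Proof. by apply: positive_op_iter; exact: positive_op_partial. Qed.

Let b : borel G -> \bar R := fun g =>
  \sum_(k <oo) (2 ^- (k + i).+1)%:E * conv_op gr (al (k + i)) f g.
Let r : borel G -> \bar R := fun g =>
  \sum_(k <oo) (2 ^- (k + i).+1)%:E * (D (k + i) g)%:E.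

Let b0 g : 0 <= b g.
Proof.
by apply: nneseries_ge0 => k _ _; rewrite mule_ge0//; exact: conv_op_ge0.
Qed.

Let r0 g : 0 <= r g.
Proof. by apply: nneseries_ge0 => k _ _; rewrite mule_ge0. Qed.

Let mb : measurable_fun setT b.
Proof.
apply: ge0_emeasurable_sum => k.
  by move=> g _ _; rewrite mule_ge0//; exact: conv_op_ge0.
by move=> _; apply: measurable_funeM; exact: measurable_conv_op.
Qed.

Let mr : measurable_fun setT r.
Proof.
apply: ge0_emeasurable_sum => k.
  by move=> g _ _; rewrite mule_ge0.
by move=> _; apply: measurable_funeM; exact: mD.
Qed.

Let mbtgt : measurable_fun setT (b \o tgt gr : borel G -> \bar R).
Proof.
apply: (measurableT_comp mb).
apply: (@within_continuous_measurable G G setT (tgt gr)); first exact: closedT.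
by apply: continuous_subspaceT; exact: lcg_tgt.
Qed.

Let btgt0 z : 0 <= (b \o tgt gr) z.
Proof. exact: b0. Qed.

Let b_le g : b g <= b (tgt gr g) + r g /\ b (tgt gr g) <= b g + r g.
Proof.
have cf0 k g' : 0 <= (2 ^- (k + i).+1)%:E * conv_op gr (al (k + i)) f g'.
  by rewrite mule_ge0//; exact: conv_op_ge0.
have cD0 k : 0 <= (2 ^- (k + i).+1)%:E * (D (k + i) g)%:E by rewrite mule_ge0.
split; rewrite -nneseriesD//; apply: lee_nneseries => // k _;
  rewrite -ge0_muleDr; do ?[exact: conv_op_ge0 | exact: D0];
  apply: lee_wpmul2l; rewrite ?lee_fin//; by have [_ _ _ /(_ f mf f01 g)[? ?]] := alD (k + i)%N.
Qed.

Let fAb g : f g = A f g + b g.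
Proof.
rewrite -harmf piE// (nneseries_split 0 i); last first.
  by move=> k _; rewrite mule_ge0//; exact: conv_op_ge0.
rewrite add0n -(nneseries_addn i (f := fun k => (2 ^- k.+1)%:E * conv_op gr (al k) f g))// => k.
by rewrite mule_ge0//; exact: conv_op_ge0.
Qed.

Let f_expand m g : f g = iter m A f g + \sum_(0 <= j < m) iter j A b g.
Proof.
elim: m => [|m ih]; first by rewrite big_geq//= adde0.
rewrite {}ih big_nat_recr//= addeA addeAC; congr (_ + _).
rewrite -[A (iter m A f)]/(iter m.+1 A f) iterSr -(positive_opD (AP m))//.
- by congr (iter m A _ g); apply/funext => z; rewrite [LHS]fAb.
- by apply: (positive_op_measurable (AP 1)).
- by move=> z; apply: (positive_op_ge0 (AP 1)).
Qed.

Let err g := \sum_(0 <= j < n) iter j A r g.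
Let S x := \sum_(0 <= j < n) (s ^+ j)%:E * b x.

(** [b] and [b \o tgt gr] differ by at most [r], and [iter j A] multiplies a function of the target
    by [s ^+ j]. Hence the sum is compared with [S (tgt gr g)], a quantity common to [g] and
    [tgt gr g]. *)
Let sum_b_le g : \sum_(0 <= j < n) iter j A b g <= S (tgt gr g) + err g /\
  S (tgt gr g) <= \sum_(0 <= j < n) iter j A b g + err g.
Proof.
split; rewrite -big_split/=; apply: lee_sum => j _.
  rewrite -(positive_op_tgt (AP j) g b0) -(positive_opD (AP j))//=.
  apply: (le_positive_op (AP j)) => //; first exact: emeasurable_funD.
  by move=> z; have [] := b_le z.
rewrite -(positive_op_tgt (AP j) g b0) -(positive_opD (AP j))//=.
apply: (le_positive_op (AP j)) => //; first exact: emeasurable_funD.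
by move=> z; have [] := b_le z.
Qed.

(* [f = A^n f + sum_(j < n) A^j b], where [A] gathers the first [i] systems and [b]
   the contribution of the others: [A^n f] is small, and [b] is nearly a function
   of the target because the systems beyond [i] are nearly invariant. *)
Lemma harmonic_oscillation g (d : R) : (s ^+ n <= d)%R ->
  (forall k z, (i <= k)%N -> z = g \/ z = tgt gr g ->
    \sum_(0 <= j < n) iter j A (EFin \o D k) z <= d%:E) ->
  f g <= f (tgt gr g) + (3 * d)%:E /\ f (tgt gr g) <= f g + (3 * d)%:E.
Proof.
move=> snd Dd.
have iter_le z : iter n A f z <= d%:E.
  apply: (@le_trans _ _ (iter n A (cst 1) z)).
    by apply: (le_positive_op (AP n)) => // y; case/andP: (f01 y).
  by rewrite (positive_op_cst (AP n))// mule1 lee_fin.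
have err_le z : z = g \/ z = tgt gr g -> err z <= d%:E.
  move=> zg; rewrite /err.
  under eq_bigr => j _.
    rewrite (positive_op_series (AP j) (a := fun k => (2 ^- (k + i).+1)%R)
      (f := fun k => EFin \o D (k + i)%N))//; last by move=> k y; exact: D0.
    over.
  have AD0 j k : 0 <= iter j A (EFin \o D k) z.
    by apply: (positive_op_ge0 (AP j)) => y; exact: D0.
  rewrite -nneseries_sum; last by move=> j k _; rewrite mule_ge0.
  apply: (@le_trans _ _ (\sum_(k <oo) (2 ^- (k + i).+1)%:E * d%:E)).
    apply: lee_nneseries => k _.
      by move=> _; apply: sume_ge0 => j _; rewrite mule_ge0.
    rewrite -ge0_sume_distrr => [|j _]; last exact: AD0.
    by apply: lee_wpmul2l => //; apply: Dd => //; exact: leq_addl.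
  have d0 : (0 <= d)%R.
    by apply: le_trans snd; exact: positive_op_cst_ge0 (AP n).
  under eq_eseriesr do rewrite muleC.
  rewrite nneseriesZl//.
  rewrite (nneseries_addn i (f := fun k => (2 ^- k.+1)%:E))// half_series.
  rewrite -EFinM lee_fin -[leRHS]mulr1 ler_wpM2l// invf_le1 ?exprn_gt0//.
  by rewrite exprn_ege1// ler1n.
have sum_le z : \sum_(0 <= j < n) iter j A b z <= f z.
  rewrite (f_expand n z) leeDr//; apply: (positive_op_ge0 (AP n)) => //.
have [bg Sg] := sum_b_le g; have [bx Sx] := sum_b_le (tgt gr g).
rewrite (tgt_unit (tgt_units gr g)) in bx Sx.
have eg := err_le _ (or_introl erefl); have ex := err_le _ (or_intror erefl).
(* One [d] bounds the term [iter n A f]; the other two are the errors at [g] and at [tgt gr g] in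
   passing through [S (tgt gr g)]. *)
have -> : (3 * d)%:E = d%:E + d%:E + d%:E by rewrite -!EFinD; congr EFin; ring.
split.
  rewrite (f_expand n g) [leRHS]addeC; rewrite -!addeA; apply: leeD => //.
  apply: (le_trans bg); rewrite addeC; apply: leeD => //.
  apply: (le_trans Sx); rewrite [leRHS]addeC; exact: leeD.
rewrite (f_expand n (tgt gr g)) [leRHS]addeC; rewrite -!addeA; apply: leeD => //.
apply: (le_trans bx); rewrite addeC; apply: leeD => //.
apply: (le_trans Sg); rewrite [leRHS]addeC; exact: leeD.
Qed.

End one_level.
End harmonic_functions.

Lemma ae_mono d (T : measurableType d) (R : realType) (mu : {measure set T -> \bar R})
    (P Q : T -> Prop) : (forall x, P x -> Q x) ->
  {ae mu, forall x, P x} -> {ae mu, forall x, Q x}.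
Proof. exact: filterS. Qed.

Lemma ae_mono2 d (T : measurableType d) (R : realType) (mu : {measure set T -> \bar R})
    (P P' Q : T -> Prop) : (forall x, P x -> P' x -> Q x) ->
  {ae mu, forall x, P x} -> {ae mu, forall x, P' x} -> {ae mu, forall x, Q x}.
Proof. exact: filterS2. Qed.

(** * Reiter implies Liouville *)

Section reiter_liouville.
Context (R : realType) (G : ptopologicalType) (gr : groupoid G).
Hypothesis lcgG : locally_compact_groupoid gr.
Variable lambda : G -> borel_measure R G.
Hypothesis haar : left_haar_system gr lambda.
Implicit Types pi : G -> borel_measure R G.
Local Open Scope ereal_scope.

(** This handles functions that are harmonic at every arrow; classes modulo [lambda] are reduced to
    them in [harmonic_ae_constant]. *)
Lemma reiter_harmonic : reiter gr lambda ->
  exists2 pi, adapted_system gr lambda pi &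
    forall f : borel G -> \bar R, measurable_fun setT f -> (forall z, 0 <= f z <= 1) ->
      (forall g, conv_op gr pi f g = f g) -> forall g, f g = f (tgt gr g).
Proof.
move=> /(reiter_almost_invariant lcgG haar)[theta [N [thetaN N_small]]].
have clam := haar.1.
have [K [cK Kn KT]] := compact_exhaustion R (lcg_locally_compact lcgG)
  (lcg_hausdorff lcgG) (lcg_second_countable lcgG).
have /choice[n nP] := @partial_mass_pow R.
have [al [D [alD DK]]] := almost_invariant_selection lcgG clam thetaN N_small n cK.
have t0 k : (0 <= 2 ^- k.+1 :> R)%R by rewrite invr_ge0 exprn_ge0.
have t1 : \sum_(k <oo) (2 ^- k.+1 : R)%:E = 1 by rewrite half_series expr0 invr1.
have alP k : adapted_system gr lambda (al k) by case: (alD k).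
have [pi [piP piE]] := mixture_system lcgG clam t0 t1 alP.
exists pi => // f mf f01 harmf g.
have convE := conv_op_mixture lcgG piE.
have inK z : exists i, K i z.
  by have [i _ Kiz] : (\bigcup_i K i) z by [rewrite KT]; exists i.
have [i1 Ki1] := inK g; have [i2 Ki2] := inK (tgt gr g).
have osc i : (maxn i1 i2 <= i)%N ->
    f g <= f (tgt gr g) + (3 * 2 ^- i)%:E /\ f (tgt gr g) <= f g + (3 * 2 ^- i)%:E.
  rewrite geq_max => /andP[ii1 ii2].
  apply: (harmonic_oscillation lcgG alD convE mf f01 harmf (nP i)) => k z ik zg.
  apply: (@le_trans _ _ (2 ^- k)%:E).
    apply: DK => //; case: zg => ->.
    - exact: (Kn _ _ (leq_trans ii1 ik)).
    - exact: (Kn _ _ (leq_trans ii2 ik)).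
  by rewrite lee_fin lef_pV2 ?posrE ?exprn_gt0// ler_weXn2l// ler1n.
have small (e : R) : (0 < e)%R -> exists2 i, (maxn i1 i2 <= i)%N & (3 * 2 ^- i <= e)%R.
  move=> e0; have e3 : (0 < e / 3)%R by rewrite divr_gt0.
  have : (`|2^-1 : R| < 1)%R by rewrite ger0_norm ?invr_ge0// invf_lt1 ?ltr1n.
  move=> /cvg_expr/cvgr_lt/(_ _ e3)[m _ mP]; exists (maxn (maxn i1 i2) m).
    exact: leq_maxl.
  have := mP _ (leq_maxr (maxn i1 i2) m); rewrite /= exprVn; lra.
apply/eqP; rewrite eq_le; apply/andP; split; apply/lee_addgt0Pr => e /small[i mi ie].
  have [+ _] := osc i mi; move=> /le_trans; apply; by rewrite leeD2l// lee_fin.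
have [_ +] := osc i mi; move=> /le_trans; apply; by rewrite leeD2l// lee_fin.
Qed.

(** The density of the translate of [pi] by [g] exists for every [g], so null sets of
    [lambda (tgt gr g)] pull back to null sets without any exceptional arrows. *)
Lemma adapted_ae pi g (Q : G -> Prop) : adapted_system gr lambda pi ->
  {ae lambda (tgt gr g), forall z, fiber gr (tgt gr g) z -> Q z} ->
  {ae pi (src gr g), forall h, fiber gr (src gr g) h -> Q (gmul gr g h)}.
Proof.
move=> piP [A [mA A0 AQ]]; have [D [mD D0 DE]] := adapted_system_density piP.
exists (fiber gr (src gr g) `&` gmul gr g @^-1` A); split.
- have mgm : measurable_fun (fiber gr (src gr g) : set (borel G))
      (gmul gr g : borel G -> borel G) by exact: measurable_gmul.
  exact: mgm (measurable_fiber lcgG _) _ mA.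
- rewrite -[LHS]/(translate gr g (pi (src gr g)) A) DE//.
  by rewrite null_set_integral//; apply: measurable_funTS; exact: measurable_section.
- move=> h /= /not_implyP[gh nQ]; split=> //; apply: AQ => /= /(_ _); apply: contra_not nQ.
  by apply; rewrite /fiber /= tgt_gmul.
Qed.

(** Averaging therefore gives a class of functions a definite value at every arrow, which makes
    comparison at individual arrows meaningful. *)
Lemma conv_op_ae_eq pi g (u v : borel G -> \bar R) : adapted_system gr lambda pi ->
  measurable_fun (fiber gr (tgt gr g) : set (borel G)) u ->
  measurable_fun (fiber gr (tgt gr g) : set (borel G)) v ->
  {ae lambda (tgt gr g), forall z, fiber gr (tgt gr g) z -> u z = v z} ->
  conv_op gr pi u g = conv_op gr pi v g.
Proof.
move=> piP mu mv /(adapted_ae piP) uv.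
have mF := measurable_fiber lcgG.
have gF : gmul gr g @` fiber gr (src gr g) `<=` fiber gr (tgt gr g).
  by move=> _ [h gh <-]; rewrite /fiber /= tgt_gmul.
apply: ae_eq_integral => //.
- apply: (@measurable_comp _ _ _ _ _ _ (fiber gr (tgt gr g) : set (borel G)) u) => //.
  exact: measurable_gmul.
- apply: (@measurable_comp _ _ _ _ _ _ (fiber gr (tgt gr g) : set (borel G)) v) => //.
  exact: measurable_gmul.
Qed.

Lemma Rintegral_conv_op pi g (u : G -> R) :
  (\int[pi (src gr g)]_(h in fiber gr (src gr g)) u (gmul gr g h))%R =
  fine (conv_op gr pi (EFin \o u) g).
Proof. by []. Qed.

Lemma Rintegral_affine pi g (a b : R) (v : borel G -> R) :
  adapted_system gr lambda pi -> measurable_fun setT v -> (forall z, 0 <= v z <= 1)%R ->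
  fine (conv_op gr pi (fun z => (a * v z + b)%:E) g) =
  (a * fine (conv_op gr pi (EFin \o v) g) + b)%R.
Proof.
move=> [cpi _] mv v01; rewrite -!Rintegral_conv_op.
have mF := measurable_fiber lcgG (src gr g).
have F1 : pi (src gr g) (fiber gr (src gr g)) = 1.
  by apply: (probability_fiber lcgG cpi); exact: src_units.
have Foo : pi (src gr g) (fiber gr (src gr g)) < +oo by rewrite F1 ltry.
have mvg : measurable_fun (fiber gr (src gr g) : set (borel G)) (v \o gmul gr g).
  by apply: measurableT_comp => //; exact: measurable_gmul.
have iv : (pi (src gr g)).-integrable (fiber gr (src gr g)) (EFin \o (v \o gmul gr g)).
  apply: measurable_bounded_integrable => //.
  exists 1%R; split=> // M M1 h _ /=; apply: le_trans (ltW M1).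
  by rewrite ger0_norm; case/andP: (v01 (gmul gr g h)).
have iav : (pi (src gr g)).-integrable (fiber gr (src gr g))
    (EFin \o (fun h => a * v (gmul gr g h))%R).
  exact: (integrableZl mF a iv).
have ib : (pi (src gr g)).-integrable (fiber gr (src gr g)) (EFin \o (fun=> b)).
  by apply: measurable_bounded_integrable => //; exact: bounded_cst.
rewrite RintegralD// RintegralZl// Rintegral_cst// F1 mulr1.
by [].
Qed.

(** An affine change of scale and a modification on a null set give [v] with values in [0, 1].
    Averaging [v] once yields [w], equal to [v] almost everywhere on the fiber; since averaging sees
    only classes, [w] is harmonic at every arrow. *)
Lemma harmonic_ae_constant pi x (u : G -> R) (M : R) : adapted_system gr lambda pi ->
  (forall f : borel G -> \bar R, measurable_fun setT f -> (forall z, 0 <= f z <= 1) ->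
     (forall g, conv_op gr pi f g = f g) -> forall g, f g = f (tgt gr g)) ->
  units gr x -> measurable_fun (fiber gr x : set (borel G)) u ->
  {ae lambda x, forall z, fiber gr x z -> (`|u z| <= M)%R} ->
  {ae lambda x, forall z, fiber gr x z -> fine (conv_op gr pi (EFin \o u) z) = u z} ->
  exists c, {ae lambda x, forall z, fiber gr x z -> u z = c}.
Proof.
move=> piP harm ux mu uM Pu; have [cpi _] := piP.
have mF := measurable_fiber lcgG x.
(* The bound [M] may be zero or negative; [L] is a positive bound, as the division by [2 * L]
   requires. *)
pose L := (`|M| + 1)%R; have L0 : (0 < L)%R by rewrite ltr_wpDl.
have ML : (M <= L)%R by rewrite (le_trans (ler_norm M))// lerDl.
pose clip z : R := ((Num.min (Num.max (u z) (- L)) L + L) / (2 * L))%R.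
have clip01 z : (0 <= clip z <= 1)%R.
  have L2 : (0 < 2 * L)%R by rewrite mulr_gt0.
  rewrite /clip divr_ge0 ?(ltW L2)//=; last first.
    by rewrite -[X in (X <= _)%R](addNr L) lerD2r le_min le_max lexx orbT /= ge0_cp// ltW.
  by rewrite ler_pdivrMr// mul1r mulr2n mulrDl !mul1r lerD2r ge_min lexx orbT.
pose v : borel G -> R := clip \_ (fiber gr x).
have v01 z : (0 <= v z <= 1)%R by rewrite /v patchE; case: ifP; rewrite ?lexx ?ler01.
have mv : measurable_fun setT v.
  apply/(measurable_restrictT _ _).1 => //.
  apply: measurable_funM => //; apply: measurable_funD => //.
  by apply: measurable_minr => //; apply: measurable_maxr.
have uv : {ae lambda x, forall z, fiber gr x z -> u z = (2 * L * v z + - L)%R}.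
  apply: (ae_mono _ uM) => z uMz xz; rewrite /v patchE mem_set// /clip.
  move: (uMz xz); rewrite ler_norml => /andP[uM1 uM2].
  rewrite (max_l (le_trans _ uM1)) ?lerN2// (min_l (le_trans uM2 ML)).
  by field; rewrite gt_eqF.
have mvE : measurable_fun setT (EFin \o v) by exact/measurable_EFinP.
have v01E z : 0 <= (EFin \o v) z <= 1 by rewrite !lee_fin.
have v0E z : 0 <= (EFin \o v) z by case/andP: (v01E z).
pose w := conv_op gr pi (EFin \o v).
have w01 z : 0 <= w z <= 1 by exact: conv_op01.
have mw : measurable_fun setT (w : borel G -> \bar R) by exact: measurable_conv_op.
have wv : {ae lambda x, forall z, fiber gr x z -> w z = (v z)%:E}.
  apply: (ae_mono2 _ Pu uv) => z Puz uvz xz; move: (Puz xz).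
  have -> : conv_op gr pi (EFin \o u) z = conv_op gr pi (fun z => (2 * L * v z + - L)%:E) z.
    apply: conv_op_ae_eq => //; rewrite xz.
    - exact/measurable_EFinP.
    - apply/measurable_EFinP/measurable_funTS.
      by apply: measurable_funD => //; apply: measurable_funM.
    - by apply: (ae_mono _ uv) => y uvy /uvy /= ->.
  rewrite Rintegral_affine// (uvz xz) => /addIr/mulfI.
  rewrite mulf_neq0 ?gt_eqF// => /(_ isT) <-.
  by rewrite fineK// conv_op_fin_num.
have harmw g : conv_op gr pi w g = w g.
  have [xg|xg] := pselect (tgt gr g = x).
    apply: conv_op_ae_eq => //; [exact: measurable_funTS..|].
    by rewrite xg.
  have v0 z : tgt gr z = tgt gr g -> v z = 0%R.
    by move=> zg; rewrite /v patchE memNset//= /fiber /= zg.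
  have w0' z : tgt gr z = tgt gr g -> w z = 0.
    move=> zg; apply: integral0_eq => h /= zh.
    by rewrite v0// tgt_gmul.
  rewrite (w0' g)//; apply: integral0_eq => h /= gh.
  by rewrite w0'// tgt_gmul.
exists (2 * L * fine (w x) + - L)%R.
apply: (ae_mono2 _ wv uv) => z wvz uvz xz.
by rewrite (uvz xz) -xz -(harm w)// (wvz xz).
Qed.

End reiter_liouville.

Section complex_harmonic_functions.
Context (R : realType) (G : ptopologicalType) (gr : groupoid G).
Hypothesis lcgG : locally_compact_groupoid gr.
Variable lambda : G -> borel_measure R G.
Hypothesis haar : left_haar_system gr lambda.
Implicit Types pi : G -> borel_measure R G.

Lemma Re_Im_le (z : R[i]) (M : R) : `|z| <= M%:C%C ->
  `|complex.Re z| <= M /\ `|complex.Im z| <= M.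
Proof.
rewrite normc_def lecR => zM; split; apply: le_trans zM;
  by rewrite -sqrtr_sqr ler_wsqrtr// ?lerDl ?lerDr sqr_ge0.
Qed.

Lemma markov_operatorE pi (f : G -> R[i]) z : markov_operator gr pi f z =
  (fine (conv_op gr pi (EFin \o (@complex.Re R \o f)) z) +i*
   fine (conv_op gr pi (EFin \o (@complex.Im R \o f)) z))%C.
Proof. by []. Qed.

Lemma constant_sub_harmonic pi x : adapted_system gr lambda pi ->
  constant_functions gr lambda x `<=` bounded_harmonic gr lambda pi x.
Proof.
move=> piP f [Lf [c fc]]; split=> //; have [mre mim _] := Lf; have [cpi _] := piP.
apply: (ae_mono _ fc) => z fz xz; rewrite (fz xz).
have fcz : {ae lambda (tgt gr z), forall y, fiber gr (tgt gr z) y -> f y = c}.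
  by rewrite xz.
have part (p : R[i] -> R) : measurable_fun (fiber gr x : set (borel G)) (p \o f) ->
    fine (conv_op gr pi (EFin \o (p \o f)) z) = p c.
  move=> mp; rewrite (@conv_op_ae_eq _ _ _ lcgG lambda pi z _ (cst (p c)%:E))//.
  - by rewrite conv_op_cst.
  - by rewrite xz; exact/measurable_EFinP.
  - by apply: (ae_mono _ fcz) => y fy /fy /= ->.
by rewrite markov_operatorE !part//; case: (c).
Qed.

Lemma reiter_liouville : reiter gr lambda -> liouville gr lambda.
Proof.
move=> /(reiter_harmonic lcgG haar)[pi piP harm].
exists pi; split; [exact: piP.1|exact: piP.2|move=> x ux].
apply/seteqP; split; last exact: constant_sub_harmonic.
move=> f [Lf Pf]; split=> //; have [mre mim [M fM]] := Lf.
have part (p : R[i] -> R) : measurable_fun (fiber gr x : set (borel G)) (p \o f) ->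
    (forall z, `|z| <= M%:C%C -> `|p z| <= M) ->
    {ae lambda x, forall z, fiber gr x z ->
       fine (conv_op gr pi (EFin \o (p \o f)) z) = p (f z)} ->
    exists c, {ae lambda x, forall z, fiber gr x z -> p (f z) = c}.
  move=> mp pM Pp; apply: (harmonic_ae_constant lcgG piP harm ux mp _ Pp (M := M)).
  by apply: (ae_mono _ fM) => z fz /fz; exact: pM.
have [a fa] := part (@complex.Re R) mre (fun z zM => (Re_Im_le zM).1)
  (ae_mono (fun z Pz xz => congr1 (@complex.Re R) (Pz xz)) Pf).
have [b fb] := part (@complex.Im R) mim (fun z zM => (Re_Im_le zM).2)
  (ae_mono (fun z Pz xz => congr1 (@complex.Im R) (Pz xz)) Pf).
exists (a +i* b)%C; apply: (ae_mono2 _ fa fb) => z faz fbz xz.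
by rewrite -(faz xz) -(fbz xz); case: (f z).
Qed.

End complex_harmonic_functions.

(** * Convolution powers and Cesaro means *)

Section cesaro.
Context (R : realType) (G : ptopologicalType) (gr : groupoid G).
Hypothesis lcgG : locally_compact_groupoid gr.
Variable lambda : G -> borel_measure R G.
Hypothesis clam : continuous_system gr lambda.
Local Open Scope ereal_scope.
Variable pi : G -> borel_measure R G.
Hypothesis piP : adapted_system gr lambda pi.

Let P := conv_op gr pi.
Let PP : positive_op gr 1 P.
Proof. by apply: positive_op_conv => //; case: piP. Qed.

(** Powers start at the first: the zeroth one, made of point masses at the units, need not be
    absolutely continuous with respect to [lambda]. *)
Lemma convolution_power k : exists2 q, adapted_system gr lambda q &
  forall (f : borel G -> \bar R) g, measurable_fun setT f -> (forall z, 0 <= f z) ->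
    conv_op gr q f g = iter k.+1 P f g.
Proof.
elim: k => [|k [q qP qE]]; first by exists pi.
have [ga gaP gaE] := convolution_adapted lcgG clam piP qP.
exists ga => // f g mf f0; rewrite gaE//= -/P; congr (P _ g).
by apply/funext => z; exact: qE.
Qed.

Lemma cesaro_system n : exists2 th, adapted_system gr lambda th &
  forall (f : borel G -> \bar R) g, measurable_fun setT f -> (forall z, 0 <= f z) ->
    conv_op gr th f g = \sum_(0 <= j < n.+1) (n.+1%:R^-1)%:E * iter j.+1 P f g.
Proof.
have /choice[q qP] : forall k, exists q, adapted_system gr lambda q /\
    forall (f : borel G -> \bar R) g, measurable_fun setT f -> (forall z, 0 <= f z) ->
    conv_op gr q f g = iter k.+1 P f g.
  by move=> k; have [q ? ?] := convolution_power k; exists q.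
pose c j : R := if (j < n.+1)%N then n.+1%:R^-1%R else 0%R.
have c0 j : (0 <= c j)%R by rewrite /c; case: ifP; rewrite ?invr_ge0.
have cE (u : nat -> \bar R) : (forall j, 0 <= u j) ->
    \sum_(j <oo) (c j)%:E * u j = \sum_(0 <= j < n.+1) (n.+1%:R^-1)%:E * u j.
  move=> u0; rewrite (nneseries_split 0 n.+1) => [|j _]; last by rewrite mule_ge0// lee_fin.
  rewrite [X in _ + X]eseries0 ?adde0 => [|j]; last first.
    by rewrite add0n /c leqNgt => /negbTE -> _; rewrite mul0e.
  by rewrite add0n; apply: eq_big_nat => j /andP[_ jn]; rewrite /c jn.
have c1 : \sum_(j <oo) (c j)%:E = 1.
  transitivity (\sum_(j <oo) (c j)%:E * 1); first by apply: eq_eseriesr => j _; rewrite mule1.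
  rewrite (cE (cst 1))//; under eq_bigr do rewrite mule1.
  rewrite [LHS](_ : _ = (\sum_(0 <= j < n.+1) n.+1%:R^-1 : R)%R%:E); last by rewrite -sumEFin.
  by rewrite sumr_const_nat subn0 -[(_^-1 *+ _)%R]mulr_natr mulVf// pnatr_eq0.
have [th [thP thE]] := mixture_system lcgG clam c0 c1 (fun j => (qP j).1).
exists th => // f g mf f0; rewrite (conv_op_mixture lcgG thE)// cE.
  by apply: eq_bigr => j _; rewrite (qP j).2.
by move=> j; exact: conv_op_ge0.
Qed.

(** Averaging shifts the powers by one, so the two means differ only in their end terms, each
    between 0 and 1 / (n + 1). *)
Lemma cesaro_almost_invariant n th (f : borel G -> \bar R) g :
  (forall (f : borel G -> \bar R) g, measurable_fun setT f -> (forall z, 0 <= f z) ->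
    conv_op gr th f g = \sum_(0 <= j < n.+1) (n.+1%:R^-1)%:E * iter j.+1 P f g) ->
  measurable_fun setT f -> (forall z, 0 <= f z <= 1) ->
  P (conv_op gr th f) g <= conv_op gr th f g + (n.+1%:R^-1)%:E /\
  conv_op gr th f g <= P (conv_op gr th f) g + (n.+1%:R^-1)%:E.
Proof.
move=> thE mf f01; have f0 z : 0 <= f z by case/andP: (f01 z).
have PjP j : positive_op gr (1 ^+ j)%R (iter j P) by exact: positive_op_iter.
have Pj1 j z : 0 <= iter j P f z <= 1.
  rewrite (positive_op_ge0 (PjP j))//=.
  rewrite -[leRHS]mule1 -[X in X%:E * _](expr1n _ j) -(positive_op_cst (PjP j) z lee01).
  by apply: (le_positive_op (PjP j)) => // y; case/andP: (f01 y).
have Pj0 j z : 0 <= iter j P f z by case/andP: (Pj1 j z).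
have mPj j : measurable_fun setT (iter j P f : borel G -> \bar R) by exact: (positive_op_measurable (PjP j)).
pose c : \bar R := (n.+1%:R^-1)%:E.
have c0 : 0 <= c by rewrite lee_fin invr_ge0.
have thE' : conv_op gr th f = fun z => \sum_(0 <= j < n.+1) c * iter j.+1 P f z.
  by apply/funext => z; exact: thE.
have PE : P (conv_op gr th f) g = \sum_(0 <= j < n.+1) c * iter j.+2 P f g.
  rewrite thE' /P conv_op_sum//.
  - by apply: eq_bigr => j _; rewrite conv_opZ// invr_ge0.
  - by move=> j; exact: measurable_funeM.
  - by move=> j z; rewrite mule_ge0.
rewrite PE thE'.
have cP j z : c * iter j P f z <= c.
  by rewrite -[leRHS]mule1 lee_wpmul2l//; case/andP: (Pj1 j z).
split.
- rewrite big_nat_recr//= [X in _ <= X + _]big_nat_recl//=.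
  apply: leeD; last exact: (cP n.+2).
  by rewrite leeDr// mule_ge0//; exact: (Pj0 1%N).
- rewrite big_nat_recl//= [X in _ <= X + _]big_nat_recr//= addeC.
  apply: leeD; last exact: (cP 1%N).
  by rewrite leeDl// mule_ge0//; exact: (Pj0 n.+2).
Qed.

End cesaro.

(** Group the pieces by the sign of the difference. Equal total masses make the negative part as
    large as the positive one, whence the factor 2. *)
Lemma total_variation_norm_le (R : realType) (T : ptopologicalType)
    (mu nu : borel_measure R T) (d : R) : mu setT = 1%E -> nu setT = 1%E ->
  (forall A : set (borel T), measurable A -> mu A <= nu A + d%:E)%E ->
  (total_variation_norm (fun A => mu A - nu A) <= (2 * d)%:E)%E.
Proof.
move=> mu1 nu1 le_d; apply: ge_ereal_sup => _ [n [A [mA tA AT ->]]].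
have fin (m : borel_measure R T) (B : set (borel T)) : m setT = 1%E -> measurable B ->
    m B \is a fin_num.
  move=> m1 mB; rewrite ge0_fin_numE//; apply: (@le_lt_trans _ _ 1%E); last exact: ltry.
  by rewrite -m1 le_measure ?inE.
pose p (B : set (borel T)) := fine (mu B); pose q (B : set (borel T)) := fine (nu B).
have pE B : measurable B -> mu B = (p B)%:E by move=> mB; rewrite fineK// fin.
have qE B : measurable B -> nu B = (q B)%:E by move=> mB; rewrite fineK// fin.
pose pos (i : 'I_n) := 0 <= p (A i) - q (A i).
have add (m : borel_measure R T) (Q : pred 'I_n) : (forall B, measurable B -> m B \is a fin_num) ->
    fine (m (\big[setU/set0]_(i < n | Q i) A i)) = \sum_(i < n | Q i) fine (m (A i)).
  move=> finm; rewrite measure_bigsetU_ord_cond//.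
    by rewrite sum_fine// => i _; apply: finm; exact: mA.
  exact: sub_trivIset tA.
pose B := \big[setU/set0]_(i < n | pos i) A i.
have mB : measurable B by apply: bigsetU_measurable => i _; exact: mA.
have all (m : borel_measure R T) : m setT = 1%E -> (forall B, measurable B -> m B \is a fin_num) ->
    \sum_(i < n) fine (m (A i)) = 1 :> R.
  move=> m1 finm; rewrite -(add m xpredT finm).
  rewrite (_ : \big[setU/set0]_(i < n) A i = setT) ?m1//.
  apply/seteqP; split=> // z _; have : (\bigcup_i A i) z by rewrite AT.
  by move=> [i _ Aiz]; rewrite (bigD1 i)//=; left.
have pall : \sum_(i < n) p (A i) = 1 by apply: all => // C; exact: fin.
have qall : \sum_(i < n) q (A i) = 1 by apply: all => // C; exact: fin.
have pB : p B = \sum_(i < n | pos i) p (A i) by apply: add => // C; exact: fin.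
have qB : q B = \sum_(i < n | pos i) q (A i) by apply: add => // C; exact: fin.
have pqB : p B - q B <= d.
  by have := le_d _ mB; rewrite pE// qE// -EFinD lee_fin lerBlDl.
have -> : (\sum_(i < n) `|mu (A i) - nu (A i)| = (\sum_(i < n) `|p (A i) - q (A i)|)%:E)%E.
  by rewrite -sumEFin; apply: eq_bigr => i _; rewrite pE// qE.
rewrite lee_fin (bigID pos)/=.
rewrite (eq_bigr (fun i => p (A i) - q (A i))); last by move=> i; exact: ger0_norm.
rewrite [X in _ + X](eq_bigr (fun i => q (A i) - p (A i))); last first.
  by move=> i; rewrite /pos -ltNge => /ltr0_norm ->; rewrite opprB.
rewrite !sumrB -pB -qB.
move: pall qall; rewrite (bigID pos)/= -pB => pall; rewrite (bigID pos)/= -qB => qall.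
by rewrite -subr_ge0; move: pqB pall qall; lra.
Qed.

(** * Almost everywhere convergence along convex combinations *)

Section komlos.
Context d (T : measurableType d) (R : realType) (mu : {measure set T -> \bar R}).
Hypothesis mu1 : mu setT = 1%E.

Let bounded_integrable (h : T -> R) (M : R) : measurable_fun setT h ->
  (forall x, `|h x| <= M) -> mu.-integrable setT (EFin \o h).
Proof.
move=> mh hM; apply: measurable_bounded_integrable => //; first by rewrite mu1 ltry.
exists M; split; first exact: num_real.
by move=> N MN x _ /=; apply: le_trans (hM x) (ltW MN).
Qed.

Let unit_norm (h : T -> R) : (forall x, 0 <= h x <= 1) -> forall x, `|h x| <= 1.
Proof. by move=> h01 x; have /andP[h0 h1] := h01 x; rewrite ger0_norm. Qed.

Let energy (h : T -> R) := \int[mu]_x (h x ^+ 2).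

Let sqr_norm (h : T -> R) : (forall x, 0 <= h x <= 1) -> forall x, `|h x ^+ 2| <= 1.
Proof. by move=> h01 x; rewrite normrX exprn_ile1//; exact: unit_norm. Qed.

Lemma parallelogram (a b : T -> R) : measurable_fun setT a -> measurable_fun setT b ->
  (forall x, 0 <= a x <= 1) -> (forall x, 0 <= b x <= 1) ->
  \int[mu]_x ((a x - b x) ^+ 2) =
  2 * energy a + 2 * energy b - 4 * energy (fun x => (a x + b x) / 2).
Proof.
move=> ma mb a01 b01.
have mc : measurable_fun setT (fun x => (a x + b x) / 2).
  by apply: measurable_funM => //; exact: measurable_funD.
have c01 x : 0 <= (a x + b x) / 2 <= 1.
  by have /andP[? ?] := a01 x; have /andP[? ?] := b01 x; apply/andP; split; lra.
have sq (h : T -> R) : measurable_fun setT h -> (forall x, 0 <= h x <= 1) ->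
    mu.-integrable setT (EFin \o (fun x => h x ^+ 2)).
  by move=> mh h01; apply: (@bounded_integrable _ 1); [exact: measurable_funX|exact: sqr_norm].
have sqZ (h : T -> R) (k : R) : measurable_fun setT h -> (forall x, 0 <= h x <= 1) ->
    mu.-integrable setT (EFin \o (fun x => k * h x ^+ 2)).
  by move=> mh h01; exact: (integrableZl measurableT k (sq h mh h01)).
rewrite /energy -!RintegralZl//; [|exact: sq..].
rewrite -RintegralD//; [|exact: sqZ..].
rewrite -RintegralB//; last 2 first.
- have := integrableD measurableT (sqZ a 2 ma a01) (sqZ b 2 mb b01).
  by apply: eq_integrable => // x _.
- exact: sqZ.
by apply: eq_Rintegral => x _; field.
Qed.

Variable C : nat -> set (T -> R).
Hypothesis C_decr : forall m, C m.+1 `<=` C m.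
Hypothesis C_neq0 : forall m, C m !=set0.
Hypothesis C_meas : forall m h, C m h -> measurable_fun setT h.
Hypothesis C01 : forall m h, C m h -> forall x, 0 <= h x <= 1.
Hypothesis C_mid : forall m h h', C m h -> C m h' -> C m (fun x => (h x + h' x) / 2).

Let C_le m n : (m <= n)%N -> C n `<=` C m.
Proof.
move=> /subnK <-; elim: (n - m)%N => [//|k ih] h Ch; apply: ih.
by rewrite addSn in Ch; exact: C_decr.
Qed.

Let energy01 m h : C m h -> 0 <= energy h <= 1.
Proof.
move=> Ch; apply/andP; split; first by apply: Rintegral_ge0 => x _; exact: sqr_ge0.
apply: (@le_trans _ _ (\int[mu]_x (cst 1 x : R))).
  apply: le_Rintegral => //.
  - apply: (@bounded_integrable _ 1); last exact/sqr_norm/(C01 Ch).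
    by apply: measurable_funX; exact: C_meas Ch.
  - by apply: (@bounded_integrable _ 1) => // x; rewrite normr1.
  - by move=> x _ /=; have /andP[? ?] := C01 Ch x; rewrite exprn_ile1.
by rewrite Rintegral_cst// mu1 mulr1.
Qed.

(* By the parallelogram identity, near-minimizers of the energy over decreasing
   midpoint-convex sets form a rapidly convergent sequence in L^2. *)
Lemma komlos_sequence : exists u : nat -> T -> R,
  (forall k, C k (u k)) /\
  (forall k, \int[mu]_x ((u k x - u k.+1 x) ^+ 2) <= 8 * 8 ^- k).
Proof.
pose dm m := inf (energy @` C m).
have hi m : has_inf (energy @` C m).
  split; first by have [h Ch] := C_neq0 m; exists (energy h), h.
  by exists 0 => _ [h Ch <-]; case/andP: (energy01 Ch).
have dm1 m : dm m <= 1.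
  have [h Ch] := C_neq0 m; apply: (@le_trans _ _ (energy h)).
    by apply: (ge_inf (hi m).2); exists h.
  by case/andP: (energy01 Ch).
pose D := sup (range dm).
have hs : has_sup (range dm).
  by split; [exists (dm 0%N), 0%N|exists 1 => _ [m _ <-]].
(* The infima [dm] increase to [D]. Going to an index beyond [k] where [dm] is within [8^-k] of [D]
   makes a near-minimizer there nearly minimal at all later indices too. *)
have /choice[u uP] : forall k, exists h : nat * (T -> R),
    [/\ (k <= h.1)%N, C h.1 h.2, energy h.2 < D + 8 ^- k & D - 8 ^- k < dm h.1].
  move=> k; have e0 : (0 : R) < 8 ^- k by rewrite invr_gt0 exprn_gt0.
  have [_ [m _ <-] Dm] := sup_adherent e0 hs.
  have mono : dm m <= dm (maxn k m).
    apply: lb_le_inf; first by have [h Ch] := C_neq0 (maxn k m); exists (energy h), h.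
    move=> _ [h Ch <-]; apply: (ge_inf (hi m).2); exists h => //.
    exact: C_le (leq_maxr k m) _ Ch.
  have [_ [h Ch <-] Eh] := inf_adherent e0 (hi (maxn k m)).
  exists (maxn k m, h); split=> //=; first exact: leq_maxl.
    apply: (lt_le_trans Eh); rewrite lerD2r; apply: (ub_le_sup hs.2).
    by exists (maxn k m).
  exact: lt_le_trans Dm mono.
exists (fun k => (u k).2); split=> [k|k].
  by have [ku Cu _ _] := uP k; exact: C_le ku _ Cu.
have [ku Cu Eu Du] := uP k; have [ku' Cu' Eu' Du'] := uP k.+1.
rewrite parallelogram//; [|exact: C_meas Cu|exact: C_meas Cu'|exact: C01 Cu|exact: C01 Cu'].
have e8 : (8 ^- k.+1 : R) <= 8 ^- k.
  by rewrite lef_pV2 ?posrE ?exprn_gt0// ler_weXn2l// ler1n.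
(* The midpoint belongs to the set with the smaller of the two indices, whose infimum already
   exceeds [D - 8^-k]. *)
have : D - 8 ^- k <= energy (fun x => ((u k).2 x + (u k.+1).2 x) / 2).
  have [le|/ltnW le] := leqP (u k).1 (u k.+1).1.
    apply: (le_trans (ltW Du)); apply: (ge_inf (hi _).2); eexists; last by [].
    by apply: C_mid => //; exact: C_le le _ Cu'.
  apply: (@le_trans _ _ (dm (u k.+1).1)); first by apply: le_trans (ltW Du'); lra.
  apply: (ge_inf (hi _).2); eexists; last by [].
  by apply: C_mid => //; exact: C_le le _ Cu.
by move: Eu Eu' e8; lra.
Qed.

(** The rate obtained in L^2 makes the increments summable in L^1, hence absolutely summable at
    almost every point. *)
Lemma ae_cvg_sequence : exists u : nat -> T -> R, (forall k, C k (u k)) /\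
  {ae mu, forall x, cvgn (fun k => u k x)}.
Proof.
have [u [Cu uE]] := komlos_sequence; exists u; split=> //.
pose v k x := `|u k.+1 x - u k x|.
have v0 k x : 0 <= v k x by exact: normr_ge0.
have mu_ k : measurable_fun setT (u k) by exact: C_meas (Cu k).
have mv k : measurable_fun setT (v k).
  by apply: measurableT_comp => //; apply: measurable_funB.
have v1 k x : `|v k x| <= 1.
  rewrite /v normr_id ler_norml; have /andP[? ?] := C01 (Cu k) x.
  by have /andP[? ?] := C01 (Cu k.+1) x; apply/andP; split; lra.
have iv k : mu.-integrable setT (EFin \o v k) by exact: (bounded_integrable (mv k) (v1 k)).
(* From t <= 2^k t^2 + 2^-k, in place of the Cauchy-Schwarz inequality; the bound is 8 * 4^-k +
   2^-k. *)
have Iv k : \int[mu]_x v k x <= 9 * 2 ^- k.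
  have msq : measurable_fun setT (fun x => (u k x - u k.+1 x) ^+ 2).
    by apply: measurable_funX; exact: measurable_funB.
  have isq : mu.-integrable setT (EFin \o (fun x => (u k x - u k.+1 x) ^+ 2)).
    apply: (@bounded_integrable _ 1) => // x; rewrite normrX exprn_ile1//.
    by have := v1 k x; rewrite /v normr_id distrC.
  have isqZ : mu.-integrable setT (EFin \o (fun x => 2 ^+ k * (u k x - u k.+1 x) ^+ 2)).
    exact: (integrableZl measurableT (2 ^+ k) isq).
  have ic : mu.-integrable setT (EFin \o (fun=> 2 ^- k : R)).
    by apply: (@bounded_integrable _ (2 ^- k)) => // x; rewrite ger0_norm// invr_ge0 exprn_ge0.
  apply: (@le_trans _ _ (\int[mu]_x (2 ^+ k * (u k x - u k.+1 x) ^+ 2 + 2 ^- k))).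
    apply: le_Rintegral => //.
      have := integrableD measurableT isqZ ic.
      by apply: eq_integrable => // x _.
    move=> x _; rewrite /v distrC -real_normK ?num_real//.
    set t := `|_|; have t0 : 0 <= t by exact: normr_ge0.
    have e0 : (0 : R) < 2 ^- k by rewrite invr_gt0 exprn_gt0.
    have [te|te] := leP t (2 ^- k).
      by rewrite ler_wpDl// mulr_ge0// ?exprn_ge0.
    rewrite ler_wpDr ?(ltW e0)// expr2 mulrA ler_peMl//.
    by rewrite -ler_pdivrMl ?exprn_gt0// mulr1 ltW.
  rewrite RintegralD// RintegralZl// Rintegral_cst// mu1 mulr1.
  apply: (@le_trans _ _ (2 ^+ k * (8 * 8 ^- k) + 2 ^- k)).
    by rewrite lerD2r ler_wpM2l// exprn_ge0.
  have -> : 2 ^+ k * (8 * 8 ^- k) = 8 * (4 ^- k) :> R.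
    rewrite (_ : 8 = 2 * 4 :> R); last by ring.
    by rewrite [X in _ * (_ * X)](_ : _ = 2 ^- k * 4 ^- k) ?exprMn ?invfM//; field; rewrite ?expf_neq0.
  have : (4 ^- k : R) <= 2 ^- k by rewrite lef_pV2 ?posrE ?exprn_gt0// lerXn2r ?nnegrE ?ler0n// ler_nat.
  lra.
pose S x := (\sum_(k <oo) (v k x)%:E)%E.
have mS : measurable_fun setT S.
  apply: ge0_emeasurable_sum => k; first by move=> x _ _; rewrite lee_fin.
  by move=> _; exact/measurable_EFinP.
have S0 x : (0 <= S x)%E by apply: nneseries_ge0 => k _ _; rewrite lee_fin.
have IS : (\int[mu]_x S x < +oo)%E.
  rewrite integral_nneseries//; last 2 first.
  - by move=> k; exact/measurable_EFinP.
  - by move=> k x _; rewrite lee_fin.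
  apply: (@le_lt_trans _ _ (\sum_(k <oo) (18 * 2 ^- k.+1)%:E)%E).
    apply: lee_nneseries => k.
      by move=> _ _; apply: integral_ge0 => x _; rewrite lee_fin.
    move=> _; rewrite -[leLHS]fineK; last exact: (integrable_fin_num _ (iv k)).
    rewrite lee_fin; apply: (le_trans (Iv k)).
    by rewrite exprS invfM; lra.
  under eq_eseriesr do rewrite EFinM.
  rewrite nneseriesZl; last by move=> k _; rewrite lee_fin invr_ge0 exprn_ge0.
  by rewrite half_series expr0 invr1 mule1 ltry.
have iS : mu.-integrable setT S.
  by apply/integrableP; split=> //; under eq_integral do rewrite gee0_abs//.
apply: (ae_mono _ (integrable_ae measurableT iS)) => x /(_ I) Sfin.
have : cvgn (series (fun k => u k.+1 x - u k x)).
  apply: normed_cvg.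
  have /cvg_ex[/= l Sl] : cvgn (fun n => \sum_(0 <= k < n) (v k x)%:E)%E.
    by apply: is_cvg_nneseries => k _ _; rewrite lee_fin.
  have Sx : S x = l by apply/cvg_lim.
  apply/cvg_ex; exists (fine l); move: Sl; rewrite -{1}(fineK (_ : l \is a fin_num)) -?Sx//.
  move=> /fine_cvg; rewrite Sx; apply: cvg_trans; apply: near_eq_cvg; near=> n.
  by rewrite /= sumEFin.
move=> /cvg_ex[/= l ul]; apply/cvg_ex; exists (l + u 0%N x).
rewrite (_ : (fun k => u k x) = (fun k => series (fun k => u k.+1 x - u k x) k + u 0%N x)).
  by apply: cvgD => //; exact: cvg_cst.
apply/funext => k; rewrite /series /= (telescope_sumr (fun k => u k x))//.
by rewrite subrK.
Unshelve. all: by end_near.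
Qed.

End komlos.

(** * Real-valued averages and their limits *)

Section averages.
Context (R : realType) (G : ptopologicalType) (gr : groupoid G).
Hypothesis lcgG : locally_compact_groupoid gr.
Variable pi : G -> borel_measure R G.
Hypothesis cpi : continuous_probability_system gr pi.
Implicit Types h : borel G -> R.

Definition average (h : borel G -> R) (z : G) : R :=
  fine (conv_op gr pi (EFin \o h) z).

Lemma averageE h z : measurable_fun setT h -> (forall y, 0 <= h y <= 1) ->
  (average h z)%:E = conv_op gr pi (EFin \o h) z.
Proof.
move=> mh h01; rewrite fineK// conv_op_fin_num//; exact/measurable_EFinP.
Qed.

Lemma average_mid h h' z : measurable_fun setT h -> measurable_fun setT h' ->
  (forall y, 0 <= h y <= 1) -> (forall y, 0 <= h' y <= 1) ->
  average (fun y => (h y + h' y) / 2) z = (average h z + average h' z) / 2.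
Proof.
move=> mh mh' h01 h'01; apply: EFin_inj.
have m1 : measurable_fun setT (EFin \o h) by exact/measurable_EFinP.
have m2 : measurable_fun setT (EFin \o h') by exact/measurable_EFinP.
have h0 y : (0 <= (EFin \o h) y)%E by rewrite lee_fin; case/andP: (h01 y).
have h'0 y : (0 <= (EFin \o h') y)%E by rewrite lee_fin; case/andP: (h'01 y).
rewrite averageE; last 2 first.
- by apply: measurable_funM => //; exact: measurable_funD.
- by move=> y; have /andP[? ?] := h01 y; have /andP[? ?] := h'01 y; apply/andP; split; lra.
rewrite mulrC EFinM EFinD !averageE// -conv_opD// -conv_opZ//.
- by congr (conv_op _ _ _ z); apply/funext => y /=; rewrite mulrC EFinM EFinD.
- exact: emeasurable_funD.
- by move=> y; rewrite adde_ge0.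
Qed.

Lemma average_cvg (u : nat -> borel G -> R) h z :
  (forall k, measurable_fun setT (u k)) -> measurable_fun setT h ->
  (forall k y, 0 <= u k y <= 1) ->
  (forall y, u ^~ y @ \oo --> h y) ->
  average (u k) z @[k --> \oo] --> average h z.
Proof.
move=> mu mh u01 uh.
have mF := measurable_fiber lcgG (src gr z).
have F1 : pi (src gr z) (fiber gr (src gr z)) = 1%E.
  by apply: (probability_fiber lcgG cpi); exact: src_units.
have mc (v : borel G -> R) : measurable_fun setT v ->
    measurable_fun (fiber gr (src gr z) : set (borel G)) (fun y => (v (gmul gr z y))%:E).
  by move=> mv; apply/measurable_EFinP; apply: measurableT_comp mv _; exact: measurable_gmul.
have [ | | | | | ih _ cv] := @dominated_convergence _ _ _ (pi (src gr z))
  (fiber gr (src gr z)) mF (fun k y => (u k (gmul gr z y))%:E)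
  (fun y => (h (gmul gr z y))%:E) (cst 1%E).
- by move=> k; exact: mc.
- exact: mc.
- by apply: aeW => y _; apply: cvg_EFin; [exact: nearW|exact: uh].
- apply: (measurable_bounded_integrable (f := cst 1)) => //; first by rewrite F1 ltry.
  exact: bounded_cst.
- apply: aeW => y k _; rewrite /= lee_fin ger0_norm; case/andP: (u01 k (gmul gr z y)) => //.
by apply: fine_cvg; rewrite fineK//; exact: integrable_fin_num ih.
Qed.

End averages.

(** * Liouville implies Reiter *)

Section liouville_reiter.
Context (R : realType) (G : ptopologicalType) (gr : groupoid G).
Hypothesis lcgG : locally_compact_groupoid gr.
Variable lambda : G -> borel_measure R G.
Hypothesis haar : left_haar_system gr lambda.
Implicit Types pi : G -> borel_measure R G.

Lemma liouville_real pi x (h : borel G -> R) : adapted_system gr lambda pi ->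
  bounded_harmonic gr lambda pi x = constant_functions gr lambda x ->
  measurable_fun setT h -> (forall z, 0 <= h z <= 1) ->
  {ae lambda x, forall z, fiber gr x z -> average gr pi h z = h z} ->
  exists c, {ae lambda x, forall z, fiber gr x z -> h z = c}.
Proof.
move=> piP BC mh h01 hh; have [cpi _] := piP.
suff [_ [c fc]] : constant_functions gr lambda x (fun z => (h z)%:C%C).
  by exists (complex.Re c); apply: (ae_mono _ fc) => z /[apply] /= <-.
rewrite -BC; split.
  split; [exact: measurable_funTS|exact: measurable_cst|].
  exists 1; apply: aeW => z _.
  by rewrite normc_def /= expr0n addr0 lecR sqrtr_sqr ger0_norm; case/andP: (h01 z).
apply: (ae_mono _ hh) => z /[apply] hz.
rewrite markov_operatorE; congr Complex; first exact: hz.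
rewrite (_ : EFin \o _ = cst 0%E)//.
by rewrite conv_op_cst.
Qed.

(* The functions [u k] are asymptotically harmonic, so that their limit is harmonic. *)
Lemma average_limit_constant pi x (u : nat -> borel G -> R) :
  adapted_system gr lambda pi -> units gr x ->
  bounded_harmonic gr lambda pi x = constant_functions gr lambda x ->
  (forall k, measurable_fun setT (u k)) -> (forall k z, 0 <= u k z <= 1) ->
  (forall k z, `|average gr pi (u k) z - u k z| <= k.+1%:R^-1) ->
  {ae lambda x, forall z, cvgn (u ^~ z)} ->
  exists c, forall z, tgt gr z = x -> average gr pi (u k) z @[k --> \oo] --> (c : R).
Proof.
move=> piP ux BC mu u01 Pu [N [mN N0 uN]]; have [cpi _] := piP.
(* Setting the functions to 0 on the exceptional null set makes them converge everywhere; by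
   [conv_op_ae_eq] the averages on the fiber over [x] do not change. *)
pose u' k : borel G -> R := u k \_ (~` N).
have mu' k : measurable_fun setT (u' k).
  apply/(measurable_restrictT _ _).1; first exact: measurableC.
  exact: measurable_funTS.
have u'01 k z : 0 <= u' k z <= 1 by rewrite /u' patchE; case: ifP => // _; rewrite lexx ler01.
have cu' z : cvgn (u' ^~ z).
  have [Nz|Nz] := pselect (N z).
    rewrite (_ : (fun k => u' k z) = cst 0); first exact: is_cvg_cst.
    by apply/funext => k; rewrite /u' patchE memNset.
  rewrite (_ : (fun k => u' k z) = u ^~ z).
    by apply: contrapT => nc; apply: Nz; apply: uN.
  by apply/funext => k; rewrite /u' patchE mem_set.
pose h z : R := limn (u' ^~ z).
have uh z : u' ^~ z @ \oo --> h z by exact: cu'.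
have mh : measurable_fun setT (h : borel G -> R).
  exact: (measurable_fun_cvg mu' (fun z _ => uh z)).
have h01 z : 0 <= h z <= 1.
  apply/andP; split; first by apply: limr_ge => //; apply: nearW => k; case/andP: (u'01 k z).
  by apply: limr_le => //; apply: nearW => k; case/andP: (u'01 k z).
have avu' k z : tgt gr z = x -> average gr pi (u k) z = average gr pi (u' k) z.
  move=> xz; congr fine; apply: (conv_op_ae_eq lcgG piP).
  - by apply: measurable_funTS; exact/measurable_EFinP.
  - by apply: measurable_funTS; exact/measurable_EFinP.
  - rewrite xz; exists N; split=> // y /= /not_implyP[_ ny]; apply: contrapT => Ny.
    by apply: ny; rewrite /u' patchE mem_set.
have avh z : tgt gr z = x -> average gr pi (u k) z @[k --> \oo] --> average gr pi h z.
  move=> xz; under eq_fun do rewrite avu'//.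
  exact: average_cvg.
have [c hc] : exists c, {ae lambda x, forall z, fiber gr x z -> h z = c}.
  apply: (liouville_real piP BC mh h01).
  exists N; split=> // z /= /not_implyP[xz nz]; apply: contrapT => Nz; apply: nz.
  have uz : u ^~ z @ \oo --> h z.
    rewrite (_ : u ^~ z = u' ^~ z)//; apply/funext => k.
    by rewrite /u' patchE mem_set.
  have lim1 := cvgB (avh z xz) uz.
  have lim2 : average gr pi (u k) z - u k z @[k --> \oo] --> (0 : R).
    apply/cvgrPdist_le => e e0; near=> k; rewrite sub0r normrN.
    apply: le_trans (Pu k z) _.
    apply: ltW; near: k; exact: (cvgr_lt _ (@cvg_harmonic R) e e0).
  apply/eqP; rewrite -subr_eq0; apply/eqP; exact: (cvg_unique (@Rhausdorff R) (lim1 _) lim2).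
exists c => z xz; rewrite (_ : c = average gr pi h z); first exact: avh.
rewrite /average (conv_op_ae_eq (v := cst c%:E) lcgG piP)//.
- by rewrite conv_op_cst.
- by apply: measurable_funTS; exact/measurable_EFinP.
- by rewrite xz; apply: (ae_mono _ hc) => y /[apply] /= ->.
Unshelve. all: by end_near.
Qed.

Lemma cesaro_difference_small pi (th : nat -> G -> borel_measure R G) g (e : R) :
  adapted_system gr lambda pi ->
  (forall x, units gr x ->
     bounded_harmonic gr lambda pi x = constant_functions gr lambda x) ->
  (forall n, adapted_system gr lambda (th n)) ->
  (forall n (f : borel G -> \bar R) g, measurable_fun setT f -> (forall z, (0 <= f z)%E) ->
    conv_op gr (th n) f g =
    (\sum_(0 <= j < n.+1) (n.+1%:R^-1)%:E * iter j.+1 (conv_op gr pi) f g)%E) ->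
  0 < e -> exists m, forall n, (m <= n)%N -> forall A : set (borel G), measurable A ->
    (conv_op gr (th n) (fun z => (\1_A z)%:E) (tgt gr g) <=
     conv_op gr (th n) (fun z => (\1_A z)%:E) g + e%:E)%E.
Proof.
move=> piP BC thP thE e0; have [cpi _] := piP; have clam := haar.1.
apply: contrapT => /forallNP bad.
set x := tgt gr g; have ux : units gr x by exact: tgt_units.
have xx : tgt gr x = x by exact: tgt_unit.
have ave := averageE lcgG cpi.
(* Replacing [h] by its average at [x] and at [g] costs at most [e / 4] each time, which leaves a
   gap of [e / 2]. *)
have e8 : 0 < e / 4 by rewrite divr_gt0.
have [m0 _ m0P] := cvgr_lt _ (@cvg_harmonic R) (e / 4) e8.
(* The gap is required of the averages: these pass to the limit at each arrow, while an almost
   everywhere limit says nothing about the single points [x] and [g]. All the conditions survive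
   midpoints and grow stricter with [m]. *)
pose C m := [set h : borel G -> R | [/\ measurable_fun setT h, forall z, 0 <= h z <= 1,
  forall z, `|average gr pi h z - h z| <= m.+1%:R^-1 &
  e / 2 <= average gr pi h x - average gr pi h g]].
(* The convergence argument needs a probability measure on the fiber, and [lambda x] may be
   infinite; null sets of [rho x] are null for [lambda x]. *)
have [rho [D [rhoP _ _ lamrho]]] := reference_system lcgG haar.
have [||||| u [Cu ucv]] := @ae_cvg_sequence _ (borel G) R (rho x) (rhoP.1.2 x ux) C.
- move=> m h [mh h01 Ph xg]; split=> // z; apply: le_trans (Ph z) _.
  by rewrite lef_pV2 ?posrE// ler_nat.
- move=> m.
  have [n [mn [A [mA bA]]]] : exists n, (maxn m m0 <= n)%N /\ exists A : set (borel G),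
      measurable A /\ ~ (conv_op gr (th n) (fun z => (\1_A z)%:E) (tgt gr g) <=
     conv_op gr (th n) (fun z => (\1_A z)%:E) g + e%:E)%E.
    apply: contrapT => /forallNP nbad; apply: (bad (maxn m m0)) => n mn A mA.
    by apply: contrapT => nA; apply: (nbad n); split=> //; exists A.
  have [cth _] := thP n.
  have mi := measurable_EFin_indic (R := R) mA; have i01 := @EFin_indic01 R G A.
  pose h z := fine (conv_op gr (th n) (fun z => (\1_A z)%:E) z).
  have hE : EFin \o h = conv_op gr (th n) (fun z => (\1_A z)%:E).
    by apply/funext => z /=; rewrite fineK//; exact: conv_op_indic_fin_num.
  have h01 z : 0 <= h z <= 1.
    by rewrite -!lee_fin -/((EFin \o h) z) hE; exact: conv_op01.
  have mh : measurable_fun setT (h : borel G -> R).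
    apply/measurable_EFinP; rewrite hE; exact: measurable_conv_op.
  have Ph z : `|average gr pi h z - h z| <= n.+1%:R^-1.
    have := cesaro_almost_invariant lcgG piP z (thE n) mi i01.
    rewrite -hE -ave// => -[].
    rewrite -[(EFin \o h) z]/((h z)%:E) -!EFinD !lee_fin => p1 p2.
    by rewrite ler_distl p1 andbT lerBlDr.
  have ne : n.+1%:R^-1 < e / 4.
    by apply: m0P; rewrite /=; apply: leq_trans mn; exact: leq_maxr.
  exists h; split=> //.
    move=> z; apply: le_trans (Ph z) _; rewrite lef_pV2 ?posrE// ler_nat ltnS.
    by apply: leq_trans mn; exact: leq_maxl.
  move/negP: bA; rewrite -hE /= -EFinD lee_fin -ltNge -/x => hx.
  move: ne hx (Ph x) (Ph g); rewrite !ler_distl.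
  move: (n.+1%:R^-1) (h x) (h g) (average gr pi h x) (average gr pi h g) => r a b pa pb.
  by move=> re ab /andP[a1 a2] /andP[b1 b2]; lra.
- by move=> m h [].
- by move=> m h [].
- move=> m h h' [mh h01 Ph xg] [mh' h'01 Ph' xg']; split=> //.
  + by apply: measurable_funM => //; exact: measurable_funD.
  + by move=> z; have /andP[? ?] := h01 z; have /andP[? ?] := h'01 z; apply/andP; split; lra.
  + move=> z; rewrite average_mid//; have := Ph z; have := Ph' z.
    move: (m.+1%:R^-1) => r; rewrite !ler_distl => /andP[? ?] /andP[? ?].
    by apply/andP; split; lra.
  + by rewrite !average_mid//; lra.
have ucvl : {ae lambda x, forall z, cvgn (u ^~ z)}.
  have [N [mN N0 uN]] := ucv; exists N; split=> //.
  by apply: (null_content_dominatesP _ _).1 (lamrho x ux) _ mN N0.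
have [|||c uc] := average_limit_constant piP ux (BC x ux) _ _ _ ucvl.
- by move=> k; case: (Cu k).
- by move=> k; case: (Cu k).
- by move=> k; case: (Cu k).
have := cvgB (uc x xx) (uc g erefl) => /(_ _)/cvgr_lt; rewrite subrr.
have e2 : 0 < e / 2 by rewrite divr_gt0.
move=> /(_ (e / 2) e2)[k _ /(_ k (leqnn k))].
by rewrite ltNge; have [_ _ _ ->] := Cu k.
Qed.

Lemma liouville_reiter : liouville gr lambda -> reiter gr lambda.
Proof.
move=> [pi [cpi api BC]]; have piP : adapted_system gr lambda pi by split.
have clam := haar.1.
have /choice[th thP] : forall n, exists th, adapted_system gr lambda th /\
    forall (f : borel G -> \bar R) g, measurable_fun setT f -> (forall z, (0 <= f z)%E) ->
    conv_op gr th f g =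
    (\sum_(0 <= j < n.+1) (n.+1%:R^-1)%:E * iter j.+1 (conv_op gr pi) f g)%E.
  by move=> n; have [th ? ?] := cesaro_system lcgG clam piP n; exists th.
exists th; split=> [n|g]; first exact: (thP n).1.
pose tv n := total_variation_norm
  (fun A => th n (tgt gr g) A - translate gr g (th n (src gr g)) A)%E.
have tv_le (e : R) : 0 < e -> exists m, forall n, (m <= n)%N -> (0 <= tv n <= e%:E)%E.
  move=> e0; have e2 : 0 < e / 2 by rewrite divr_gt0.
  have [m mP] := cesaro_difference_small g piP BC (fun n => (thP n).1) (fun n => (thP n).2) e2.
  exists m => n mn; have [[cth _] _] := thP n.
  have [nu [nuA _]] := translate_measure lcgG g (th n (src gr g)).
  have th1 : th n (tgt gr g) setT = 1%E by apply: cth.2; exact: tgt_units.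
  have nu1 : nu setT = 1%E.
    rewrite nuA// /translate preimage_setT setIT.
    by apply: (probability_fiber lcgG cth); exact: src_units.
  apply/andP; split.
    apply: le_trans (le_total_variation_norm _ measurableT).
    by rewrite -nuA// th1 nu1 subee.
  rewrite (_ : e = 2 * (e / 2)); last by field.
  rewrite /tv.
  (* [nu] and the translate agree on Borel sets only, so it is the norms that are identified,
     partition by partition. *)
  have -> : total_variation_norm (fun A => th n (tgt gr g) A - translate gr g (th n (src gr g)) A)%E =
      total_variation_norm (fun A => th n (tgt gr g) A - nu A)%E.
    congr ereal_sup; apply/seteqP; split=> _ [p [A [mA tA AT ->]]]; exists p, A; split=> //;
      by apply: eq_bigr => i _; rewrite nuA.
  apply: total_variation_norm_le => // A mA.
  have := mP n mn A mA; rewrite (unit_conv_op lcgG cth.1) -?translateE//.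
  - by rewrite -measure_integral_indic// nuA.
  - exact: tgt_units.
  - exact: measurable_EFin_indic.
apply/fine_cvgP; split.
  have [m mP] := tv_le 1 ltr01; exists m => // n /= mn.
  have /andP[t0 t1] := mP n mn; rewrite ge0_fin_numE//.
  exact: le_lt_trans t1 (ltry _).
apply/cvgrPdist_le => e e0; have [m mP] := tv_le e e0; exists m => // n /= mn.
have /andP[t0 t1] := mP n mn; rewrite sub0r normrN ger0_norm ?fine_ge0//.
rewrite -lee_fin fineK// ge0_fin_numE//.
exact: le_lt_trans t1 (ltry _).
Qed.

End liouville_reiter.

Theorem theorem6p3 (R : realType) (G : ptopologicalType) (gr : groupoid G)
    (lambda : G -> borel_measure R G) :
  locally_compact_groupoid gr ->
  left_haar_system gr lambda ->
  (liouville gr lambda <-> reiter gr lambda).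
Proof.
move=> lcgG haar; split; first exact: liouville_reiter.
exact: reiter_liouville.
Qed.
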